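(* For $\lambda_1,\lambda_2\in(0,1)$ let $\nu_{\lambda_1,\lambda_2}$ be the natural self-similar measure for the IFS $\{\lambda_1x,\ \lambda_2x+1\}$ on the real line. Then $\nu_{\lambda_1,\lambda_2}$ is absolutely continuous with a density in $L^2$ for Lebesgue almost every $(\lambda_1,\lambda_2)$ such that $\lambda_1+\lambda_2>1$ and $\max\{\lambda_1,\lambda_2\}\le0.668$.
   Context: For a self-similar IFS $\mathcal{F}=\{f_j(x)=r_jx+a_j\}_{j=1}^m$ on $\mathbb{R}$ with $r_j\in(0,1)$, the similarity dimension is the number $s$ with $\sum_jr_j^s=1$. The natural self-similar measure is $\Pi_*(\mathbf{p}^{\mathbb{N}})$, where $\mathbf{p}=(r_1^s,\dots,r_m^s)$, $\mathbf{p}^{\mathbb{N}}$ is the Bernoulli product measure on $\{1,\dots,m\}^{\mathbb{N}}$, and $\Pi(\omega)=\lim_{n\to\infty}f_{\omega_1}\circ\cdots\circ f_{\omega_n}(x_0)$ is the natural projection (independent of $x_0$). Equivalently, it is the unique Borel probability measure $\nu$ with $\nu=\sum_jr_j^s\,(f_j)_*\nu$. *)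

(* Defs.v *)
From HB Require Export structures.
From mathcomp Require Export all_boot all_order all_algebra.
From mathcomp Require Export all_classical all_reals all_analysis.
Export Order.TTheory GRing.Theory Num.Theory.
Export numFieldNormedType.Exports.

#[export] Set Implicit Arguments.
#[export] Unset Strict Implicit.
#[export] Unset Printing Implicit Defensive.

Local Open Scope classical_set_scope.
Local Open Scope ring_scope.

HB.instance Definition _ (m : nat) := isPointed.Build 'I_m.+1 ord0.

(* The cylinders generate the product sigma-algebra of the discrete ones. *)
Definition cylinder (m : nat) (w : seq 'I_m.+1) : set (nat -> 'I_m.+1) :=
  [set omega | mkseq omega (size w) = w].

Definition cylinders (m : nat) : set (set (nat -> 'I_m.+1)) :=
  range (@cylinder m).

Definition symbolic (m : nat) := g_sigma_algebraType (@cylinders m).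

HB.instance Definition _ (m : nat) := Measurable.on (symbolic m).

(* P is the product measure p^N; by the pi-system theorem its values on
   cylinders determine it. *)
Definition is_bernoulli (R : realType) (m : nat) (p : 'I_m.+1 -> R)
    (P : probability (symbolic m) R) : Prop :=
  forall w : seq 'I_m.+1, P (cylinder w) = (\prod_(j <- w) p j)%:E.

Definition ifs_map (R : realType) (m : nat) (r a : 'I_m.+1 -> R)
    (j : 'I_m.+1) (x : R) : R := r j * x + a j.

(* foldr computes f_(omega 0) \o ... \o f_(omega n.-1); when the ratios lie in
   ]0, 1[ the limit does not depend on the base point, which is taken to be 0. *)
Definition natural_projection (R : realType) (m : nat) (r a : 'I_m.+1 -> R)
    (omega : symbolic m) : R :=
  lim ((fun n : nat => foldr (ifs_map r a) 0 (mkseq omega n)) @ \oo).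

Definition is_similarity_dimension (R : realType) (m : nat)
    (r : 'I_m.+1 -> R) (s : R) : Prop :=
  \sum_j r j `^ s = 1.

Definition is_natural_measure (R : realType) (m : nat) (r a : 'I_m.+1 -> R)
    (nu : probability (measurableTypeR R) R) : Prop :=
  exists (s : R) (P : probability (symbolic m) R),
    [/\ is_similarity_dimension r s,
        is_bernoulli (fun j => r j `^ s) P &
        forall A : set (measurableTypeR R), measurable A ->
          nu A = pushforward P (natural_projection r a : _ -> measurableTypeR R) A].

Definition ac_with_L2_density (R : realType)
    (nu : probability (measurableTypeR R) R) : Prop :=
  nu `<< @lebesgue_measure R /\
  exists f : measurableTypeR R -> R,
    [/\ f \in Lfun (@lebesgue_measure R) 2%:E,
        forall x, 0 <= f x &
        forall A : set (measurableTypeR R), measurable A ->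
          nu A = (\int[@lebesgue_measure R]_(x in A) (f x)%:E)%E].

(* The IFS {l1 x, l2 x + 1}. *)
Definition ratios2 (R : realType) (l1 l2 : R) (j : 'I_2) : R :=
  if j == ord0 then l1 else l2.

Definition shifts2 (R : realType) (j : 'I_2) : R :=
  if j == ord0 then 0 else 1.

(* Main.v *)
Require Import Defs.
From Stdlib Require Import ZArith.
From mathcomp Require Import ssrZ zify ring lra measurable_realfun.

(** Let [x] and [y] be the two ratios and put [al = ln y / ln x], so that
    [y = x ^ al].  The weights [p = x ^ s] and [y ^ s] of the natural measure
    satisfy [p + p ^ al = 1]: they depend on [al] only.  Along a curve where
    [al] is constant the natural measures are therefore images of one fixed
    Bernoulli measure under coding maps that vary smoothly with [x], and the
    condition [x + y > 1] reads [p < x].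

    These coding maps are transversal.  Take two words with different first
    digits, let [f] be the difference of the points that they code and [D] the
    difference of the derivatives with respect to [ln x].  For
    [y <= x <= 0.668] and [x + y > 1] the numbers [f] and [D] are never both
    small ([jets_apart]).  This is a finite computation: the parameters [(x, al)]
    are cut into boxes, over each box the pairs of words are explored digit by
    digit, and a branch is closed once a combination [C f + D] or [C f - D] is
    bounded away from zero for all continuations.  A certificate records the
    decisions of the search and a checker in fixed-point interval arithmetic,
    proved correct here, replays them.  A second-order Taylor estimate that is
    uniform in the words turns this into an increment bound for [f]
    ([transversal]); the case [x < y] follows from the reflection of the line
    that exchanges the two maps.

    Transversality bounds by [O(e)] the measure of the [x] for which two given
    words with different first digits code points at distance less than [e].
    For a pair of words with the same first digit the distance is rescaled by
    [1 / x] or [1 / y].  As [p < x] and [1 - p < y], the sum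
    [p ^ 2 / x + (1 - p) ^ 2 / y] is less than 1, so this recursion converges and
    bounds the integral over a short interval of [x] of the probability that two
    random points lie within [e] of each other ([integral_energy]).  With [e] of
    order [2 ^ -n] the normalized probabilities [correlation n] have bounded
    integrals, hence by Fatou's lemma they tend to infinity for almost no [x]
    ([bad_params_section_null]).  Fubini's theorem and the Lipschitz maps
    [al |-> x ^ al] carry this from the curves to the plane ([bad_ratios_null]).

    Off this null set the averages [nu (ball z r) / (2 r)] are bounded in L2 along
    some radii that tend to zero ([integral_ball_avg_sq]).  This bounds the
    measure of an open set in terms of its length, whence absolute continuity,
    and Lebesgue differentiation with Fatou's lemma bounds the L2 norm of the
    density ([ac_with_L2_density_of_averages]). *)

Local Open Scope ring_scope.

(** * Replaying a separation search in fixed-point arithmetic *)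

(** The boxes bound [x], the exponent [a >= 1] (in units of [1 / 4096]), the
    ratio [z = x ^ (a - 1)] and [y = x z].  A function whose name ends in [up],
    [hi] or [1] bounds a real number from above, one in [dn], [lo] or [0] from
    below. *)
Section Checker.
Local Open Scope Z_scope.

(** Numbers are integer multiples of [2 ^ -26]. *)
Definition one : Z := 67108864.
Definition mul_dn (a b : Z) : Z := Z.shiftr (a * b) 26.
Definition mul_up (a b : Z) : Z := mul_dn a b + 1.
Definition inv_dn (a : Z) : Z := one * one / a.
Definition inv_up (a : Z) : Z := one * one / a + 1.

(** These bound [(r x ^ q) ^ (1 / 2 ^ k)], consuming one binary digit of [q]
    with each square root. *)
Fixpoint pow_up (x : Z) (k : nat) (q r : Z) : Z :=
  if k is k'.+1 then
    pow_up x k' (Z.div2 q) (Z.sqrt_up (r * (if Z.odd q then x else one)))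
  else ssrnat.iter (Z.to_nat q) (mul_up x) r.

Fixpoint pow_dn (x : Z) (k : nat) (q r : Z) : Z :=
  if k is k'.+1 then
    pow_dn x k' (Z.div2 q) (Z.sqrt (r * (if Z.odd q then x else one)))
  else ssrnat.iter (Z.to_nat q) (mul_dn x) r.

(** Tabulated powers; [lookup] computes the ones beyond the table afresh, so that
    its correctness does not depend on the length. *)
Definition powers (f : Z -> Z) : seq Z := traject f one 20.
Definition lookup (f : Z -> Z) (t : seq Z) (k : nat) : Z :=
  if onth t k is Some v then v else ssrnat.iter k f one.

(** Chord interpolation of a convex function from its values at the integers,
    extended with the given slope: an upper bound for that function. *)
Fixpoint interp (t : seq Z) (slope u : Z) : Z :=
  match t with
  | t0 :: ((t1 :: _) as t') =>
      if u <=? one then t0 + mul_up u (t1 - t0) else interp t' slope (u - one)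
  | t0 :: _ => t0 + mul_up u slope
  | nil => 0
  end.

(** Upper bounds over all words, with coded point [P] and derivative [D], of
    [c P + D] here and of [c P - D] in [sup_minus]; both suprema are convex
    in [c]. *)
Definition sup_plus (bP bD : Z) (t : seq Z) (c : Z) : Z :=
  if 0 <=? c then mul_up c bP + bD else interp t 0 (- c).
Definition sup_minus (bP : Z) (t : seq Z) (c : Z) : Z :=
  if c <=? 0 then 0 else interp t bP c.

(** Entry [k] bounds [D - k P].  Splitting off the first digit of a word gives
    [x (D - (k - 1) P)] or [- k + y (D + (a - k) P)], so that the table fills
    itself. *)
Fixpoint table_plus (x y a bP bD : Z) (k : nat) : seq Z :=
  if k is k'.+1 then
    let t := table_plus x y a bP bD k' in
    let c := - (Z.of_nat k * one) in
    rcons t (Z.max (mul_up x (last 0 t))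
                   (c + mul_up y (sup_plus bP bD t (c + a))))
  else [:: bD].

Fixpoint table_minus (x y a bP : Z) (k : nat) : seq Z :=
  if k is k'.+1 then
    let t := table_minus x y a bP k' in
    let c := Z.of_nat k * one in
    rcons t (Z.max (mul_up x (last 0 t)) (c + mul_up y (sup_minus bP t (c - a))))
  else [:: 0].

Record box := Box {
  bx0 : Z; bx1 : Z; by0 : Z; by1 : Z; bz0 : Z; bz1 : Z; ba0 : Z; ba1 : Z;
  bix0 : Z; bix1 : Z; biz0 : Z; biz1 : Z;
  tx0 : seq Z; tx1 : seq Z; tix0 : seq Z; tix1 : seq Z;
  tz0 : seq Z; tz1 : seq Z; tiz0 : seq Z; tiz1 : seq Z;
  bP : Z; bD : Z; tplus : seq Z; tminus : seq Z }.

Definition box_of (x0 x1 z0 z1 a0 a1 : Z) : box :=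
  let y0 := mul_dn x0 z0 in
  let y1 := mul_up x1 z1 in
  let P := inv_up (one - y1) in
  let D := Z.max (mul_up (mul_up y1 P) a1 * one / (one - y1) + 1)
                 (mul_up x1 P * one / (one - x1) + 1) in
  let ix0 := inv_dn x1 in let ix1 := inv_up x0 in
  let iz0 := inv_dn z1 in let iz1 := inv_up z0 in
  Box x0 x1 y0 y1 z0 z1 a0 a1 ix0 ix1 iz0 iz1
    (powers (mul_dn x0)) (powers (mul_up x1)) (powers (mul_dn ix0)) (powers (mul_up ix1))
    (powers (mul_dn z0)) (powers (mul_up z1)) (powers (mul_dn iz0)) (powers (mul_up iz1))
    P D (table_plus x1 y1 a1 P D 12) (table_minus x1 y1 a0 P 12).

Definition mk_box (x0 x1 q0 q1 : Z) : box :=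
  box_of x0 x1 (pow_dn x0 12 (q1 - 4096) one) (pow_up x1 12 (q0 - 4096) one)
    (q0 * 16384) (q1 * 16384).

Definition box_ok (b : box) : bool :=
  [&& 0 <? bx0 b, 0 <? bz0 b, bx1 b <? one & by1 b <? one].

(** Bounds of [x ^ n y ^ m = x ^ (n + m) z ^ m], the quotient of the contraction
    ratios of two prefixes whose letter counts differ by [(n, m)]; the exponents
    may be negative. *)
Definition cratio_hi (b : box) (n m : Z) : Z :=
  mul_up (if 0 <=? n + m then lookup (mul_up (bx1 b)) (tx1 b) (Z.to_nat (n + m))
          else lookup (mul_up (bix1 b)) (tix1 b) (Z.to_nat (- (n + m))))
         (if 0 <=? m then lookup (mul_up (bz1 b)) (tz1 b) (Z.to_nat m)
          else lookup (mul_up (biz1 b)) (tiz1 b) (Z.to_nat (- m))).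
Definition cratio_lo (b : box) (n m : Z) : Z :=
  mul_dn (if 0 <=? n + m then lookup (mul_dn (bx0 b)) (tx0 b) (Z.to_nat (n + m))
          else lookup (mul_dn (bix0 b)) (tix0 b) (Z.to_nat (- (n + m))))
         (if 0 <=? m then lookup (mul_dn (bz0 b)) (tz0 b) (Z.to_nat m)
          else lookup (mul_dn (biz0 b)) (tiz0 b) (Z.to_nat (- m))).

(** Bounds of [n + m a], the logarithm of that quotient in base [x]. *)
Definition log_ratio_lo (b : box) (n m : Z) : Z :=
  n * one + m * (if 0 <=? m then ba0 b else ba1 b).
Definition log_ratio_hi (b : box) (n m : Z) : Z :=
  n * one + m * (if 0 <=? m then ba1 b else ba0 b).

Definition scale (lo hi v : Z) : Z := if 0 <=? v then mul_up hi v else mul_up lo v.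

Definition slog_ratio_lo (b : box) (s : bool) (n m : Z) : Z :=
  if s then log_ratio_lo b n m else - log_ratio_hi b n m.
Definition slog_ratio_hi (b : box) (s : bool) (n m : Z) : Z :=
  if s then log_ratio_hi b n m else - log_ratio_lo b n m.

(** From a bound of a combination of the tails of two words to a bound of the
    same combination of the whole words: [path] lists the letters of the two
    prefixes (with [true] for the first word), innermost letter first, and [v]
    bounds the combination normalized by the ratio of the second prefix.
    [(i, j)] shifts the coefficient of the values when letters are put in front
    of the second word. *)
Fixpoint unwind (b : box) (s : bool) (c : Z) (path : seq (bool * bool))
    (i j n m v : Z) : Z :=
  match path with
  | nil => v
  | (true, false) :: p => unwind b s c p i j (n - 1) m v
  | (true, true) :: p =>
      let m := m - 1 in
      let e := c + slog_ratio_hi b s (i + n) (j + m) in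
      unwind b s c p i j n m
        (v + scale (cratio_lo b n m) (cratio_hi b n m) e)
  | (false, false) :: p => unwind b s c p (i - 1) j (n + 1) m (scale (bx0 b) (bx1 b) v)
  | (false, true) :: p =>
      let j := j - 1 in
      unwind b s c p i j n (m + 1) (scale (by0 b) (by1 b) v - (c + slog_ratio_lo b s i j))
  end.

(** A bound of the combination over all pairs of tails. *)
Definition leaf_bound (b : box) (s : bool) (c n m : Z) : Z :=
  if s then
    mul_up (cratio_hi b n m) (sup_plus (bP b) (bD b) (tplus b) (c + log_ratio_hi b n m))
    + sup_minus (bP b) (tminus b) (- c)
  else
    mul_up (cratio_hi b n m) (sup_minus (bP b) (tminus b) (c - log_ratio_lo b n m))
    + sup_plus (bP b) (bD b) (tplus b) (- c).

(** A closed branch is described by one code, which selects the sign of the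
    derivatives and the coefficient of the values. *)
Definition leaf_ok (b : box) (path : seq (bool * bool)) (n m k : Z) : bool :=
  let s := negb (k =? 3) in
  let c := (if k <=? 4 then 12 else 5 - k) * one in
  unwind b s c path 0 0 n m (leaf_bound b s c n m) <? 0.

(** Codes are the base 16 digits of the numbers in the stream, least significant
    first; the leading 1 of each number is a terminator. *)
Definition next_code (st : seq positive) : Z * seq positive :=
  let st := if st is xH :: rest then rest else st in
  let bit p := match p with
    | xH => (0, xH) | xO p => (0, p) | xI p => (1, p) end in
  if st is p :: rest then
    let (b0, p) := bit p in let (b1, p) := bit p in
    let (b2, p) := bit p in let (b3, p) := bit p in
    (b0 + 2 * b1 + 4 * b2 + 8 * b3, p :: rest)
  else (0, nil).

(** Code 0 extends by one letter the word whose prefix contracts less, which keeps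
    the quotient of the ratios bounded. *)
Fixpoint check_tree (fuel : nat) (b : box) (path : seq (bool * bool)) (n m : Z)
    (st : seq positive) : option (seq positive) :=
  if fuel is fuel'.+1 then
    let (k, st) := next_code st in
    if k =? 0 then
      if log_ratio_lo b n m <=? 0 then
        if check_tree fuel' b ((true, false) :: path) (n + 1) m st is Some st
        then check_tree fuel' b ((true, true) :: path) n (m + 1) st else None
      else
        if check_tree fuel' b ((false, false) :: path) (n - 1) m st is Some st
        then check_tree fuel' b ((false, true) :: path) n (m - 1) st else None
    else if leaf_ok b path n m k then Some st else None
  else None.

(** Codes 1 and 2 halve the box in [x] and in [a].  Any other code belongs to the
    search over the box, which starts from two words with first letters [true]
    and [false]. *)
Fixpoint check_cover (fuel : nat) (x0 x1 q0 q1 : Z) (st : seq positive) : option (seq positive) :=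
  if fuel is fuel'.+1 then
    let (k, st') := next_code st in
    if k =? 1 then
      let x := (x0 + x1) / 2 in
      if check_cover fuel' x0 x q0 q1 st' is Some st
      then check_cover fuel' x x1 q0 q1 st else None
    else if k =? 2 then
      let q := (q0 + q1) / 2 in
      if check_cover fuel' x0 x1 q0 q st' is Some st
      then check_cover fuel' x0 x1 q q1 st else None
    else
      let b := mk_box x0 x1 q0 q1 in
      if (4096 <=? q0) && (4096 <=? q1) && box_ok b then check_tree 60 b [:: (false, false); (true, true)] (-1) 1 st
      else None
  else None.
End Checker.

(** * The recorded search *)

(** Codes of the search over the box [1/2 <= x <= 0.668], [1 <= a <= 3], in
    preorder. *)
Definition codes : seq positive := [::
0x1635030500500060666450405005000601766350305005006007663503050050060012121288827121271271222;
0x1500060266645040500500060666430504050050006021666363500030500500060766363500030500500600266;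
0x1450400300003060060060027663350305033503000030500500600121266633030503050050006066635030500;
0x1026663350305033503000030500500060167633450400305033450400300003050060006077733450400305033;
0x1030030000306006006002121267633503050335030000305005000606763345040030503350300003050060006;
0x1305033503000030030000306006006006773335030030503335030030000306006000607773335030030503335;
0x1060060006067733450400305033350300300003060060006021777333345040030503350300003003050333350;
0x1677333303045300305353000003003050333530500300300003060060006067733450400305033450400300003;
0x1000030600600600777333345040030503350300003003050333350305033503000030030000306006006001212;
0x1003000030600600060777333346350004003050334504003000030030603333450400305033450400300003003;
0x1000306350305000060060021267733334540030030534540030000030030603333454003003053454003000003;
0x1000400300003003063350300305000333333450400305033503000030030503333503050350003003000030030;
0x1077635030500503333434445040040040030503344504004003000040030503333445040040030503345040030;
0x1030504003000003003063503050003333435300305040030030534530030000030030000306350305000060006;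
0x1000030030000306350305000060060021267635030500503333444454004003003054530000400300305343530;
0x1000030030000300306335030030500033333345040030503345040030000300305033335030503350300003003;
0x1063503050000600060776350305005033333345040030503345040030000300305033334504003050334504003;
0x1030000030030633503003050003333335300305353000030030030533353003053530000300300000300300003;
0x1306350305000060060012676350305005033333345400300305345400300003003003053335300305353000030;
0x1503003050003333333503003050333503003000030030503333350300305033350300300003003000030030000;
0x1333333450400300305033345040030030000300305033333450400300305033350300300003003000030030633;
0x1030503333345040030030503334504003003000030030000300300003063503050000600600277635030500503;
0x1300305033345040030030000300300003003063350300305000333333345040030030503334504003003000030;
0x1000306350305000060006077635030500503333333450400300305033345040030030000300305033333450400;
0x1305000333333345400300300305334540030030000300300305333353003003053353003000030030000030030;
0x1003003003053345400300300003003003053333454003003003053345400300300003003000003003063350300;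
0x1300300305333353003003053530000300300000300300003063503050000600060167635030500503333333454;
0x1300300305333353003003053353003000030030000030030633503003050003333333530030030533530030000;
0x1533530030000300300000300300003063503050000600060267635030500503333333530030030533530030000;
0x1533530030000300300000300306335030030500033333335300300305335300300003003003053333530030030;
0x1306350305000060006067635030500503333333454003003003053345400300300003003003053333530030030;
0x1503003050003333333530030030533530030000300300305333353003003053353003000030030000030030000;
0x1635030500503333333530030030533530030000300300305333353003003053353003000030030000030030633;
0x1633503003050003333335300305353000030030030533530503003000003003000030635030500006000602167;
0x1003063503050000600060676350305005033333353003053530000300300305333530030550030030000030030;
0x1353003050300300305335305030030000030030635030500033333530503003003053353050300300000300300;
0x1535300003003003053335300305353000030030000030030000306350305000060006012676350305005033333;
0x1003053353003000030030030533335300300305353000030030000030030633503003050003333333530030030;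
0x1030533335300300305335300300003003000003003000030635030500006000606763503050050333333353003;
0x1454003003003053353003000030030000030030633503003050003333333454003003003053353003000030030;
0x1300300003063503050000600060167635030500503333333454003003003053345400300300003003003053333;
0x1300305353000030030000030030633503003050003333335300305353000030030030533353003050300300000;
0x1000030030000030030000306350305000060006067635030500503333333530030030535300003003003053335;
0x1300300003003000003003063350300305000333333353003003053353003000030030030533335300300305353;
0x1635030500006000602167635030500503333333454003003003053353003000030030030533335300300305335;
0x1677333344540030504003003053454003000003003063503050003333454003003053454003000003003000030;
0x1000601267733334540030030534540030000030030603333454003003053454003000003003000030600600060;
0x1300306335030030500033333353003053530000300300305333530030503003000003003000030635030500006;
0x1000602676350305005033333344540040030030534540030000300300305333454003003053530000300300000;
0x1454004003003053453003000030030030533345400300305345400300003003000003003000030635030500006;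
0x1053445400400300003003003053334454004003003053454003000030030000030030633503003050003333334;
0x1003053335300305353000030030000030030000306350305000060006067635030500503333334454004003003;
0x1003053334540030030534540030000300300000300306335030030500033333345400300305345400300003003;
0x1533530030000030030000306350305000060006016763503050050333333445400400300305345400300003003;
0x1030500503333334540030030535300003003003053353050300300000300306350305000333335305030030030;
0x1500033333345400300305353000030030030533353003050300300000300300003063503050000600060267635;
0x1763503050050333333454003003053454003000030030030533353003053530000300300000300306335030030;
0x1030633503003050003333335300305353000030030030533530503003000003003000030635030500006000606;
0x1030030000306006000602167635030500503333334540030030535300003003003053335300305030030000030;
0x1030535300000300300003060060006067733334540030030534540030000030030503333454003003053530000;
0x1033334540030030534540030000030030000306006000602126773333454003003053530000030030503333530;
0x1030030603333454003003053454003000003003000030600600060677333345400300305345400300000300306;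
0x1050003333353003003053353003000003003000030635030500006000601267733334540030030534540030000;
0x1335300305030030000030030000306350305000060006067733333530503003003053353003000003003063503;
0x1030030533345400300305353000030030000030030633503003050003333334540030030535300003003003053;
0x1000300300003063503050000600060167635030500503333334444040540040040030030534454004003000030;
0x1003063503050000600060677333335300300305335300300000300306350305000333335300300305335300300;
0x1300003003003053335300305030030000030030635030500033333353003050300300305335300300000300300;
0x1300306033334540030030534540030000030030000306006000601676350305005033333344540040030030535;
0x1343530030504003003053454003000003003000030635030500006000602677333345400300305345400300000;
0x1006067733334344454004004003003053454003000040030030534353003050400300000300306350305000333;
0x1305040030030534540030000030030635030500033334540030030534540030000030030000306350305000060;
0x1303050333030000300003060060006067733450400305033450400300003060060006012167733334345400300;
0x1000601677333333333303003003003003000305305003333333333303003003003003003003000300003050333;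
0x1300003060060006067733350300305033350300300003060060006026763345040030503345040030000306006;
0x1333353003053530000030030503333530030535300000300300003060060006021267733350400305033350400;
0x1030030535300000300300003060060006012677333353003050030030503335305003003000030600600060677;
0x1003053454003000003003000030635030500006000602677333345400300305345400300000300305033334540;
0x1030534540030000030030000306006000606773333454003003053454003000003003063503050003333454003;
0x1050333353003053530000030030000306006000601677333345400300305345400300000300306033334540030;
0x1300000300306033334540030030534540030000030030000306006000602677333345400300305353000003003;
0x1003053454003000003003060333345400300305353000003003000030600600060677333345400300305345400;
0x1600600060126773333454003003053530000030030503333530030500300300003060060006016773333454003;
0x1534540030000030030000306006000606773333530030535300000300305033335300305353000003003000030;
0x1345400300305353000003003000030600600060677333345400300305345400300000300306033334540030030;
0x1060676333403050334030000305033503000030500500060216773333454003003053454003000003003050333;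
0x1400300003060060006067633450400305033450400300003050060006012126663350305033503000030500500;
0x1335305003300030000306006000601267633450400305033450400300003060060006067733450400305033450;
0x1050333353003053530000030030000306006000602677333303045300305003333333030030030003000030503;
0x1530030535300000300305033335300305353000003003000030600600060677333345400300305353000003003;
0x1060677333504003050333504003000030600600060677333503003050333503003000030600600060216773333;
0x1040030000305006000602167733334540030030535300000300305033335300305353000003003000030600600;
0x1335040030503335040030000306006000602126763354003050335030000305006000606763345040030503345;
0x1003330300003050333353003050030030000306006000606773335040030503335040030000306006000606773;
0x1335030030503335030030000306006000602677334504003050334504003000030600600060167733335300305;
0x1006016663503050050006066635030500500060128821216773335030030503335030030000306006000606773;
0x1664305034300050050006066635030500500060666450305005000601281666350305005000606664503050050;
0x1267633450400305033450400300003050060006012666363500030500500060666363530000305005000602126;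
0x1335040030503335033333300300030000300003060060006026763345040030503345040030000306006000601;
0x1600060267633450400305033450400300003060060006016773335040030503335040030000306006000606773;
0x1030000305005000601677333504003050334504003000030600600060677333504003050333504003000030600;
0x1334503400030000306006000606763345040030503345033343000300003000030600600060267633503050335;
0x1440040030003000030000306006000602666330503050050006066635350003050050006021676334504003050;
0x1050335030000305006000606763333444003000305033444440040040003000030503333444003000305033344;
0x1006066635030500500060121267060666450405005000606664504050050006028121281676334503340300003;
0x1050050006067633503050335030000305005000602666350305005000606664503050050006016663503050050;
0x1602666350305005000606664503050050006016663503050050006066645030500500060121666363350300003;
0x1430005005000606663430030503343003000500500060212816663635000305005000606663635000305005000;
0x1664504050050006021666350305005000606663503050050006016663330030535000305005000602666430503;
0x1271666350305005000606664503050050006016663503050050006066645030500500060126665405005000606;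
0x1006028166645030500500060666530500500060166633050305005000606664503050050006012670601281281;
0x1666334300300305033334030030030005005000608128166645034300050050006066643050334300300050050;
0x1888826186706027167060]%positive.

(** In units of [2 ^ -26], 33554432 is 1/2 and 44828722 is just above 0.668; in
    units of [1 / 4096], 4096 and 12288 are 1 and 3. *)
Lemma codes_ok : isSome (check_cover 40 33554432 44828722 4096 12288 codes).
Proof. vm_cast_no_check (erefl true). Qed.

(** * Real values of fixed-point numbers *)

Lemma one_pow : one = (2 ^ 26)%Z. Proof. by []. Qed.
Lemma one_gt0 : (0 < one)%Z. Proof. by []. Qed.

Opaque one.
Lemma div_lo (n c : Z) : (0 < c)%Z -> (n / c * c <= n)%Z.
Proof. by move=> c0; have := Z.mul_div_le n c c0; lia. Qed.
Lemma div_hi (n c : Z) : (0 < c)%Z -> (n <= (n / c + 1) * c)%Z.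
Proof. by move=> c0; have := Z.mul_succ_div_gt n c c0; lia. Qed.

Lemma mul_dnE a b : mul_dn a b = (a * b / one)%Z.
Proof. by rewrite /mul_dn Z.shiftr_div_pow2 // -one_pow. Qed.
Lemma mul_upE a b : mul_up a b = (a * b / one + 1)%Z.
Proof. by rewrite -mul_dnE. Qed.

Opaque mul_up mul_dn.

(** [zr] and [fx] are locked because conversion would otherwise unfold large
    integer constants into unary form. *)
HB.lock Definition zr (R : realType) (z : Z) : R := (int_of_Z z)%:~R.
HB.lock Definition fx (R : realType) (z : Z) : R := zr R z / zr R one.

Section Fixed.
Variable R : realType.
Notation zr := (@zr R).
Notation fx := (@fx R).

Lemma zrD a b : zr (a + b)%Z = zr a + zr b.
Proof. by rewrite !zr.unlock -intrD -rmorphD. Qed.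
Lemma zrN a : zr (- a)%Z = - zr a.
Proof. by rewrite !zr.unlock -mulrNz -rmorphN. Qed.
Lemma zrM a b : zr (a * b)%Z = zr a * zr b.
Proof. by rewrite !zr.unlock -intrM -rmorphM. Qed.
Lemma zrB a b : zr (a - b)%Z = zr a - zr b.
Proof. by rewrite -zrN -zrD. Qed.
Lemma zr_le a b : (a <= b)%Z -> zr a <= zr b.
Proof. by move=> ab; rewrite !zr.unlock ler_int; lia. Qed.
Lemma zr_lt a b : (a < b)%Z -> zr a < zr b.
Proof. by move=> ab; rewrite !zr.unlock ltr_int; lia. Qed.
Lemma zr0 : zr 0%Z = 0. Proof. by rewrite !zr.unlock. Qed.
Lemma zr1 : zr 1%Z = 1. Proof. by rewrite !zr.unlock. Qed.
Lemma zr2 : zr 2%Z = 2.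
Proof. by rewrite (_ : 2%Z = (1 + 1)%Z) // zrD zr1. Qed.
Lemma zr_nat n : zr (Z.of_nat n) = n%:R.
Proof. by rewrite !zr.unlock (_ : int_of_Z (Z.of_nat n) = n :> int) //; lia. Qed.
Lemma zr_one_gt0 : 0 < zr one. Proof. by rewrite -zr0; apply: zr_lt. Qed.
Lemma zr_oneV_gt0 : 0 < (zr one)^-1.
Proof. by rewrite invr_gt0; exact: zr_one_gt0. Qed.
Lemma zr_one_neq0 : zr one != 0. Proof. by rewrite (gt_eqF zr_one_gt0). Qed.

Lemma fxD a b : fx (a + b)%Z = fx a + fx b.
Proof. by rewrite !fx.unlock zrD mulrDl. Qed.
Lemma fxN a : fx (- a)%Z = - fx a.
Proof. by rewrite !fx.unlock zrN mulNr. Qed.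
Lemma fxB a b : fx (a - b)%Z = fx a - fx b.
Proof. by rewrite -fxN -fxD. Qed.
Lemma fxZ a b : fx (a * b)%Z = zr a * fx b.
Proof. by rewrite !fx.unlock zrM mulrA. Qed.
Lemma fx_le a b : (a <= b)%Z -> fx a <= fx b.
Proof. by move=> ab; rewrite !fx.unlock (ler_pM2r zr_oneV_gt0); exact: zr_le. Qed.
Lemma fx_lt a b : (a < b)%Z -> fx a < fx b.
Proof. by move=> ab; rewrite !fx.unlock (ltr_pM2r zr_oneV_gt0); exact: zr_lt. Qed.
Lemma fx0 : fx 0%Z = 0. Proof. by rewrite !fx.unlock zr0 mul0r. Qed.
Lemma fx_one : fx one = 1. Proof. by rewrite !fx.unlock (divff zr_one_neq0). Qed.
Lemma fx_ge0 a : (0 <= a)%Z -> 0 <= fx a.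
Proof. by rewrite -fx0; exact: fx_le. Qed.

Lemma fxMM a b : fx a * fx b = zr (a * b)%Z / zr one / zr one.
Proof. by rewrite !fx.unlock zrM; move: (zr a) (zr b) (zr one)^-1 => p q r; ring. Qed.

Lemma fxM_le a b c : (a * b <= c * one)%Z -> fx a * fx b <= fx c.
Proof.
move=> h; rewrite fxMM fx.unlock (ler_pM2r zr_oneV_gt0) (ler_pdivrMr _ _ zr_one_gt0) -zrM; exact: zr_le.
Qed.

Lemma fx_leM a b c : (c * one <= a * b)%Z -> fx c <= fx a * fx b.
Proof.
move=> h; rewrite fxMM fx.unlock (ler_pM2r zr_oneV_gt0) (ler_pdivlMr _ _ zr_one_gt0) -zrM; exact: zr_le.
Qed.

Lemma fx_mul_dn a b : fx (mul_dn a b) <= fx a * fx b.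
Proof. by apply: fx_leM; rewrite mul_dnE; apply: div_lo one_gt0. Qed.

Lemma fx_mul_up a b : fx a * fx b <= fx (mul_up a b).
Proof. by apply: fxM_le; rewrite mul_upE; apply: div_hi one_gt0. Qed.

Lemma fxM_le1 a b : (a * b <= one * one)%Z -> fx a * fx b <= 1.
Proof. by rewrite -fx_one; exact: fxM_le. Qed.
Lemma fxM_ge1 a b : (one * one <= a * b)%Z -> 1 <= fx a * fx b.
Proof. by rewrite -fx_one; exact: fx_leM. Qed.

Lemma fx_inv_up a : (0 < a)%Z -> 1 <= fx a * fx (inv_up a).
Proof. by move=> a0; apply: fxM_ge1; rewrite Z.mul_comm; exact: div_hi. Qed.

Lemma fx_inv_dn a : (0 < a)%Z -> fx a * fx (inv_dn a) <= 1.
Proof. by move=> a0; apply: fxM_le1; rewrite Z.mul_comm; exact: div_lo. Qed.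

Lemma fx_sqrt a b : (0 <= a * b)%Z -> fx (Z.sqrt (a * b)) ^+ 2 <= fx a * fx b.
Proof.
move=> ab; rewrite expr2 !fxMM !(ler_pM2r zr_oneV_gt0); apply: zr_le.
by case: (Z.sqrt_spec (a * b) ab).
Qed.

Lemma fx_sqrt_up a b : (0 <= a * b)%Z -> fx a * fx b <= fx (Z.sqrt_up (a * b)) ^+ 2.
Proof.
move=> ab; rewrite expr2 !fxMM !(ler_pM2r zr_oneV_gt0); apply: zr_le.
have [->//|ab0] : (a * b = 0 \/ 0 < a * b)%Z by lia.
by case: (Z.sqrt_up_spec (a * b) ab0).
Qed.

(** Multiplication of an upper bound by an uncertain nonnegative factor has to
    take the larger factor for a nonnegative bound and the smaller one
    otherwise. *)
Lemma fx_scale lo hi v (t w : R) : fx lo <= t <= fx hi -> 0 <= t -> w <= fx v ->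
  t * w <= fx (scale lo hi v).
Proof.
move=> /andP[lot thi] t0 wv; rewrite /scale.
have tv : t * w <= t * fx v by rewrite ler_wpM2l.
case: (Z.leb_spec 0 v) => v0; apply: (le_trans tv); apply: le_trans (fx_mul_up _ _).
  by rewrite ler_wpM2r // fx_ge0.
by rewrite ler_wnM2r // -fx0; apply: fx_le; lia.
Qed.

End Fixed.


Section Pow.
Variable R : realType.
Notation fx := (@fx R).
Notation zr := (@zr R).

Lemma fx_iter_up x t r s n : 0 <= fx x -> expR (- t) <= fx x -> expR (- s) <= fx r ->
  expR (- (s + n%:R * t)) <= fx (ssrnat.iter n (mul_up x) r).
Proof.
move=> x0 tx sr; elim: n => [|n IH] /=; first by rewrite mul0r addr0.
apply: le_trans (fx_mul_up _ _ _).
rewrite (_ : - _ = - t + - (s + n%:R * t)) ?expRD; last by rewrite -natr1; ring.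
by apply: ler_pM => //; exact: expR_ge0.
Qed.

Lemma fx_iter_dn x t r s n : (0 <= x)%Z -> (0 <= r)%Z ->
    fx x <= expR (- t) -> fx r <= expR (- s) ->
  (0 <= ssrnat.iter n (mul_dn x) r)%Z /\
  fx (ssrnat.iter n (mul_dn x) r) <= expR (- (s + n%:R * t)).
Proof.
move=> x0 r0 tx sr; elim: n => [|n [IH0 IH]] /=; first by rewrite mul0r addr0.
split.
  by rewrite mul_dnE; apply: Z.div_pos; [lia|exact: one_gt0].
apply: le_trans (fx_mul_dn _ _ _) _.
rewrite (_ : - _ = - t + - (s + n%:R * t)) ?expRD; last by rewrite -natr1; ring.
by apply: ler_pM => //; exact: fx_ge0.
Qed.

Lemma expR_half (t : R) : expR (- (t / 2)) ^+ 2 = expR (- t).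
Proof. by rewrite expr2 -expRD; congr expR; field. Qed.

Lemma expR_le_sqr (t : R) v : 0 <= v -> expR (- t) <= v ^+ 2 -> expR (- (t / 2)) <= v.
Proof. by move=> v0; rewrite -expR_half ler_sqr ?nnegrE ?expR_ge0. Qed.
Lemma expR_ge_sqr (t : R) v : 0 <= v -> v ^+ 2 <= expR (- t) -> v <= expR (- (t / 2)).
Proof. by move=> v0; rewrite -expR_half ler_sqr ?nnegrE ?expR_ge0. Qed.

Lemma zr_div2 q : zr q = 2 * zr (Z.div2 q) + (Z.odd q)%:R.
Proof.
rewrite {1}(Z.div2_odd q) zrD zrM zr2; congr (_ + _).
by case: Z.odd; rewrite /= ?zr0 ?zr1.
Qed.

Lemma zr_to_nat q : (0 <= q)%Z -> (Z.to_nat q)%:R = zr q :> R.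
Proof. by move=> q0; rewrite -zr_nat Znat.Z2Nat.id. Qed.

Lemma fx_pow_up x t k q r s : (0 <= x)%Z -> (0 <= r)%Z -> (0 <= q)%Z ->
    expR (- t) <= fx x -> expR (- s) <= fx r ->
  expR (- ((s + zr q * t) / 2 ^+ k)) <= fx (pow_up x k q r).
Proof.
move=> x0 + + tx; elim: k q r s => [|k IH] q r s r0 q0 sr /=.
  by rewrite expr0 divr1 -zr_to_nat//; apply: fx_iter_up => //; exact: fx_ge0.
set y := if Z.odd q then x else one.
have y0 : (0 <= y)%Z by rewrite /y; case: Z.odd => //.
have ty : expR (- ((Z.odd q)%:R * t)) <= fx y.
  by rewrite /y; case: Z.odd; rewrite ?mul1r// mul0r oppr0 expR0 fx_one.
have -> : (s + zr q * t) / 2 ^+ k.+1 =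
    ((s + (Z.odd q)%:R * t) / 2 + zr (Z.div2 q) * t) / 2 ^+ k :> R.
  by rewrite (zr_div2 q) exprS invfM; field; rewrite expf_neq0.
apply: IH.
- exact: Z.sqrt_up_nonneg.
- by rewrite Z.div2_nonneg.
- apply: expR_le_sqr; first by apply: fx_ge0; exact: Z.sqrt_up_nonneg.
  apply: le_trans (@fx_sqrt_up R _ _ _); last by lia.
  by rewrite opprD expRD; apply: ler_pM => //; exact: expR_ge0.
Qed.

Lemma fx_pow_dn x t k q r s : (0 <= x)%Z -> (0 <= r)%Z -> (0 <= q)%Z ->
    fx x <= expR (- t) -> fx r <= expR (- s) ->
  (0 <= pow_dn x k q r)%Z /\
  fx (pow_dn x k q r) <= expR (- ((s + zr q * t) / 2 ^+ k)).
Proof.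
move=> x0 + + tx; elim: k q r s => [|k IH] q r s r0 q0 sr /=.
  by rewrite expr0 divr1 -zr_to_nat//; exact: fx_iter_dn.
set y := if Z.odd q then x else one.
have y0 : (0 <= y)%Z by rewrite /y; case: Z.odd => //.
have ty : fx y <= expR (- ((Z.odd q)%:R * t)).
  by rewrite /y; case: Z.odd; rewrite ?mul1r// mul0r oppr0 expR0 fx_one.
have -> : (s + zr q * t) / 2 ^+ k.+1 =
    ((s + (Z.odd q)%:R * t) / 2 + zr (Z.div2 q) * t) / 2 ^+ k :> R.
  by rewrite (zr_div2 q) exprS invfM; field; rewrite expf_neq0.
apply: IH.
- exact: Z.sqrt_nonneg.
- by rewrite Z.div2_nonneg.
- apply: expR_ge_sqr; first by apply: fx_ge0; exact: Z.sqrt_nonneg.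
  apply: le_trans (@fx_sqrt R _ _ _) _; first by lia.
  by rewrite opprD expRD; apply: ler_pM => //; exact: fx_ge0.
Qed.

End Pow.

Lemma lookupE f k : lookup f (powers f) k = ssrnat.iter k f one.
Proof.
rewrite /lookup /powers; case E : onth => [v|//].
rewrite -(@onth_nth _ one _ _ _ E) nth_traject //.
by have := onthTE (traject f one 20) k; rewrite E size_traject => <-.
Qed.

(** * Derivatives of coded points and support functions *)


Section Orbit.
Variable R : realType.
Notation fx := (@fx R).
Notation zr := (@zr R).

(** The point coded by a word and its derivative with respect to [ln x] along the
    curve [y = x ^ a], where letters contribute the derivatives 1 and [a]. *)
Definition jet_step (x y a : R) (d : bool) (q : R * R) : R * R :=
  if d then (1 + y * q.1, y * (q.2 + a * q.1)) else (x * q.1, x * (q.2 + q.1)).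
Definition jet (x y a : R) (w : seq bool) : R * R := foldr (jet_step x y a) (0, 0) w.
Arguments jet : simpl never.
Lemma jet_cons x y a d w : jet x y a (d :: w) = jet_step x y a d (jet x y a w).
Proof. by []. Qed.
Lemma jet_nil x y a : jet x y a [::] = (0, 0).
Proof. by []. Qed.

Section Jets.
Variables (x y a : R).
Hypotheses (x01 : 0 < x < 1) (y01 : 0 < y < 1) (a0 : 0 <= a).
Notation jet := (jet x y a).

Lemma jet_ge0 w : 0 <= (jet w).1 /\ 0 <= (jet w).2.
Proof.
have /andP[/ltW x0 _] := x01; have /andP[/ltW y0 _] := y01.
elim: w => [|d w [IH1 IH2]]; rewrite ?jet_nil ?jet_cons //= /jet_step; case: d => /=.
  by rewrite addr_ge0 ?mulr_ge0 ?addr_ge0 ?mulr_ge0.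
by rewrite ?mulr_ge0 ?addr_ge0.
Qed.

(** Two upper bounds that the two maps preserve bound all words. *)
Lemma jet_le (M D : R) : 1 + y * M <= M -> x * (D + M) <= D -> y * (D + a * M) <= D ->
  0 <= M -> 0 <= D -> forall w, (jet w).1 <= M /\ (jet w).2 <= D.
Proof.
have /andP[x0 x1] := x01; have /andP[y0 _] := y01.
move=> h1 h2 h3 M0 D0; elim=> [|d w [IH1 IH2]]; rewrite ?jet_nil ?jet_cons //= /jet_step; case: d => /=.
  split; first nra.
  apply: le_trans h3; rewrite ler_wpM2l ?lerD// ?ler_wpM2l//; lra.
split; first nra.
by apply: le_trans h2; rewrite ler_wpM2l ?lerD//; lra.
Qed.
End Jets.

Lemma interpP (t : seq Z) slope u (P E : R) : (0 < size t)%nat ->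
  (forall k, (leq k.+1 (size t)) -> k%:R * P + E <= fx (nth 0%Z t k)) ->
  P <= fx slope -> (0 <= u)%Z -> fx u * P + E <= fx (interp t slope u).
Proof.
elim: t u E => [//|t0 [|t1 t] IH] u E _ tP Ps u0.
  rewrite /= fxD addrC lerD//; first by have := tP 0%nat erefl; rewrite mul0r add0r.
  apply: le_trans (fx_mul_up _ _ _); rewrite ler_wpM2l//; exact: fx_ge0.
rewrite [interp _ _ _]/=; case: (Z.leb_spec u one) => u1.
  have H0 := tP 0%nat erefl; have H1 := tP 1%nat erefl.
  rewrite /= mul0r mul1r add0r in H0 H1.
  rewrite fxD.
  have H2 := fx_mul_up R u (t1 - t0).
  rewrite fxB in H2.
  have u0' : 0 <= fx u by exact: fx_ge0.
  have u1' : fx u <= 1 by rewrite -(@fx_one R); apply: fx_le.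
  by nra.
have -> : fx u * P + E = fx (u - one) * P + (P + E) by rewrite fxB fx_one; ring.
apply: IH => //; last by lia.
by move=> k ks; have := tP k.+1 ks; rewrite /= -natr1; lra.
Qed.

Section Tables.
Variables (x y a : R).
Hypotheses (x01 : 0 < x < 1) (y01 : 0 < y < 1) (a0 : 0 <= a).
Notation jet := (jet x y a).
Variables (bP bD : Z).
Hypotheses (jP : forall w, (jet w).1 <= fx bP) (jD : forall w, (jet w).2 <= fx bD).

Definition plus_table t := (leq 1 (size t)) /\
  forall w k, leq k.+1 (size t) -> - k%:R * (jet w).1 + (jet w).2 <= fx (nth 0%Z t k).
Definition minus_table t := (leq 1 (size t)) /\
  forall w k, leq k.+1 (size t) -> k%:R * (jet w).1 - (jet w).2 <= fx (nth 0%Z t k).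

Lemma sup_plusP t c w : plus_table t ->
  fx c * (jet w).1 + (jet w).2 <= fx (sup_plus bP bD t c).
Proof.
move=> [t0 tP]; have [j1 j2] := jet_ge0 x01 y01 a0 w.
rewrite /sup_plus; case: (Z.leb_spec 0 c) => c0.
  rewrite fxD lerD//; apply: le_trans (fx_mul_up _ _ _).
  by rewrite ler_wpM2l ?fx_ge0.
have -> : fx c * (jet w).1 = fx (- c) * - (jet w).1 by rewrite fxN; ring.
apply: interpP => //; [|by rewrite fx0; lra|lia].
by move=> k ks; have := tP w k ks; lra.
Qed.

Lemma sup_minusP t c w : minus_table t ->
  fx c * (jet w).1 - (jet w).2 <= fx (sup_minus bP t c).
Proof.
move=> [t0 tP]; have [j1 j2] := jet_ge0 x01 y01 a0 w.
rewrite /sup_minus; case: (Z.leb_spec c 0) => c0.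
  rewrite fx0; have : fx c <= 0 by rewrite -(@fx0 R); apply: fx_le.
  by nra.
apply: interpP => //; last by lia.
by move=> k ks; have := tP w k ks; lra.
Qed.

Lemma sup_plus_ge0 t c : plus_table t -> 0 <= fx (sup_plus bP bD t c).
Proof. by move=> /(sup_plusP c [::]); rewrite jet_nil /= mulr0 addr0. Qed.
Lemma sup_minus_ge0 t c : minus_table t -> 0 <= fx (sup_minus bP t c).
Proof. by move=> /(sup_minusP c [::]); rewrite jet_nil /= mulr0 subr0. Qed.

Lemma fx_natZ k : fx (Z.of_nat k * one) = k%:R.
Proof. by rewrite fxZ fx_one mulr1 zr_nat. Qed.

Lemma le_mul_up t v X' : 0 <= t -> t <= fx X' -> 0 <= fx v -> t * fx v <= fx (mul_up X' v).
Proof.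
by move=> t0 tX v0; apply: le_trans (fx_mul_up _ _ _); rewrite ler_wpM2r.
Qed.

Lemma nth_rcons_cases (t : seq Z) v k (Q : Z -> Prop) :
  (leq k.+1 (size t) -> Q (nth 0%Z t k)) -> (k = size t -> Q v) ->
  leq k.+1 (size (rcons t v)) -> Q (nth 0%Z (rcons t v) k).
Proof.
move=> h1 h2; rewrite size_rcons ltnS leq_eqVlt nth_rcons => /orP[/eqP kt|kt].
  by rewrite kt ltnn eqxx; exact: h2.
by rewrite kt; exact: h1.
Qed.

Lemma fx_maxl u v w : w <= fx u -> w <= fx (Z.max u v).
Proof. by move=> h; apply: (le_trans h); apply: fx_le; lia. Qed.
Lemma fx_maxr u v w : w <= fx v -> w <= fx (Z.max u v).
Proof. by move=> h; apply: (le_trans h); apply: fx_le; lia. Qed.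

Lemma last_nth_pred (t : seq Z) : (0 < size t)%nat -> last 0%Z t = nth 0%Z t (size t).-1.
Proof. by move=> t0; rewrite nth_last. Qed.

Variables (X Y : Z).
Hypotheses (xX : x <= fx X) (yY : y <= fx Y).

Lemma table_plusP A k : a <= fx A ->
  size (table_plus X Y A bP bD k) = k.+1 /\ plus_table (table_plus X Y A bP bD k).
Proof.
move=> aA; elim: k => [|k [ts tP]] /=.
  by split=> //; split=> // w [|//] _ /=; rewrite mulNr mul0r oppr0 add0r.
set t := table_plus _ _ _ _ _ k in ts tP *; set c := (- _)%Z; set v := Z.max _ _.
split; first by rewrite size_rcons ts.
split; first by rewrite size_rcons.
move=> w i; have /andP[x0 _] := x01; have /andP[y0 _] := y01.
apply: (@nth_rcons_cases t v i (fun z => - i%:R * (jet w).1 + (jet w).2 <= fx z)); first by move=> ik; apply: (tP.2).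
rewrite ts => ->.
have l0 : 0 <= fx (last 0%Z t).
  by have := tP.2 [::] k; rewrite last_nth_pred ts// jet_nil /= mulr0 addr0; apply.
case: w => [|[] w]; rewrite ?jet_nil ?jet_cons /= /jet_step /=.
- by rewrite mulr0 addr0; apply: fx_maxl; apply: le_trans (fx_mul_up _ _ _); rewrite mulr_ge0 //; exact: le_trans (ltW x0) xX.
- have [j1 j2] := jet_ge0 x01 y01 a0 w.
  have h1 := sup_plusP (c + A) w tP; have h0 := sup_plus_ge0 (c + A) tP.
  apply: fx_maxr; rewrite fxD.
  have h2 : y * fx (sup_plus bP bD t (c + A)) <= fx (mul_up Y (sup_plus bP bD t (c + A))).
    by apply: le_mul_up => //; lra.
  have ec : fx c = - k.+1%:R by rewrite /c fxN; have := fx_natZ k.+1 => ->.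
  rewrite -/c ec; rewrite fxD ec in h1.
  have h3 := ler_wpM2l (ltW y0) h1.
  have h4 : y * (a * (jet w).1) <= y * (fx A * (jet w).1).
    by rewrite (ler_pM2l y0) ler_wpM2r.
  by lra.
- have [j1 j2] := jet_ge0 x01 y01 a0 w.
  apply: fx_maxl; have h1 : x * fx (last 0%Z t) <= fx (mul_up X (last 0%Z t)).
    by apply: le_mul_up => //; lra.
  apply: le_trans h1; have := tP.2 w k; rewrite last_nth_pred ts// => /(_ (leqnn _)) h.
  have h2 := ler_wpM2l (ltW x0) h.
  by rewrite -natr1; lra.
Qed.

Lemma table_minusS A k : table_minus X Y A bP k.+1 =
  let t := table_minus X Y A bP k in
  let c := (Z.of_nat k.+1 * one)%Z in
  rcons t (Z.max (mul_up X (last 0%Z t)) (c + mul_up Y (sup_minus bP t (c - A)))%Z).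
Proof. by []. Qed.

Lemma table_minusP A k : fx A <= a ->
  size (table_minus X Y A bP k) = k.+1 /\ minus_table (table_minus X Y A bP k).
Proof.
move=> aA; elim: k => [|k [ts tP]].
  split=> //; split=> // w [|//] _ /=; rewrite mul0r add0r fx0.
  by have [j1 j2] := jet_ge0 x01 y01 a0 w; lra.
rewrite table_minusS; set t := table_minus _ _ _ _ k in ts tP *.
set c := (_ * one)%Z; cbv zeta; set v := Z.max _ _.
split; first by rewrite size_rcons ts.
split; first by rewrite size_rcons.
move=> w i; have /andP[x0 _] := x01; have /andP[y0 _] := y01.
apply: (@nth_rcons_cases t v i (fun z => i%:R * (jet w).1 - (jet w).2 <= fx z)); first by move=> ik; apply: (tP.2).
rewrite ts => ->.
have l0 : 0 <= fx (last 0%Z t).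
  by have := tP.2 [::] k; rewrite last_nth_pred ts// jet_nil /= mulr0 subr0; apply.
case: w => [|[] w]; rewrite ?jet_nil ?jet_cons /= /jet_step /=.
- by rewrite mulr0 subr0; apply: fx_maxl; apply: le_trans (fx_mul_up _ _ _); rewrite mulr_ge0 //; exact: le_trans (ltW x0) xX.
- have [j1 j2] := jet_ge0 x01 y01 a0 w.
  have h1 := sup_minusP (c - A) w tP; have h0 := sup_minus_ge0 (c - A) tP.
  apply: fx_maxr; rewrite fxD.
  have h2 : y * fx (sup_minus bP t (c - A)) <= fx (mul_up Y (sup_minus bP t (c - A))).
    by apply: le_mul_up => //; lra.
  have ec : fx c = k.+1%:R by have := fx_natZ k.+1 => <-.
  rewrite -/c ec; rewrite fxB ec in h1.
  have h3 := ler_wpM2l (ltW y0) h1.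
  have h4 : y * (fx A * (jet w).1) <= y * (a * (jet w).1).
    by rewrite (ler_pM2l y0) ler_wpM2r.
  by lra.
- have [j1 j2] := jet_ge0 x01 y01 a0 w.
  apply: fx_maxl; have h1 : x * fx (last 0%Z t) <= fx (mul_up X (last 0%Z t)).
    by apply: le_mul_up => //; lra.
  apply: le_trans h1; have := tP.2 w k; rewrite last_nth_pred ts// => /(_ (leqnn _)) h.
  have h2 := ler_wpM2l (ltW x0) h.
  by rewrite -natr1; lra.
Qed.

End Tables.
End Orbit.

(** * Correctness of the search *)


Section Sound.
Variable R : realType.
Notation fx := (@fx R).
Notation zr := (@zr R).

Definition sgn (s : bool) : R := if s then 1 else -1.

(** What the bounds stored in a box mean for the parameters
    [x = expR (- t)], [y = expR (- (a * t))]. *)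
Record valid (b : box) (t a : R) : Prop := Valid {
  v_t : 0 < t; v_a1 : 1 <= a;
  v_x : fx (bx0 b) <= expR (- t) <= fx (bx1 b);
  v_y : fx (by0 b) <= expR (- (a * t)) <= fx (by1 b);
  v_z : fx (bz0 b) <= expR (- ((a - 1) * t)) <= fx (bz1 b);
  v_a : fx (ba0 b) <= a <= fx (ba1 b);
  v_ix : fx (bix0 b) <= expR t <= fx (bix1 b);
  v_iz : fx (biz0 b) <= expR ((a - 1) * t) <= fx (biz1 b);
  v_pos : [/\ (0 <= bx0 b)%Z, (0 <= bz0 b)%Z, (0 <= bix0 b)%Z & (0 <= biz0 b)%Z];
  v_tx : [/\ tx0 b = powers (mul_dn (bx0 b)), tx1 b = powers (mul_up (bx1 b)),
    tix0 b = powers (mul_dn (bix0 b)) & tix1 b = powers (mul_up (bix1 b))];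
  v_tz : [/\ tz0 b = powers (mul_dn (bz0 b)), tz1 b = powers (mul_up (bz1 b)),
    tiz0 b = powers (mul_dn (biz0 b)) & tiz1 b = powers (mul_up (biz1 b))];
  v_P : forall w, (jet (expR (- t)) (expR (- (a * t))) a w).1 <= fx (bP b);
  v_D : forall w, (jet (expR (- t)) (expR (- (a * t))) a w).2 <= fx (bD b);
  v_plus : plus_table (expR (- t)) (expR (- (a * t))) a (tplus b);
  v_minus : minus_table (expR (- t)) (expR (- (a * t))) a (tminus b) }.

Lemma pow_hi X IX (u : R) k : expR (- u) <= fx X -> expR u <= fx IX ->
  expR (- (zr k * u)) <=
  fx (if (0 <=? k)%Z then lookup (mul_up X) (powers (mul_up X)) (Z.to_nat k)
      else lookup (mul_up IX) (powers (mul_up IX)) (Z.to_nat (- k))).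
Proof.
move=> uX uI; case: (Z.leb_spec 0 k) => k0; rewrite lookupE.
  rewrite -(@zr_to_nat R k)// -[X in - X]add0r.
  apply: fx_iter_up => //; first exact: le_trans (expR_ge0 _) uX.
  by rewrite oppr0 expR0 fx_one.
have -> : - (zr k * u) = - (0 + (Z.to_nat (- k))%:R * - u) :> R.
  by rewrite zr_to_nat ?zrN; [ring|lia].
apply: fx_iter_up; rewrite ?opprK//; first exact: le_trans (expR_ge0 _) uI.
by rewrite oppr0 expR0 fx_one.
Qed.

Lemma pow_lo X IX (u : R) k : (0 <= X)%Z -> (0 <= IX)%Z ->
  fx X <= expR (- u) -> fx IX <= expR u ->
  let v := if (0 <=? k)%Z then lookup (mul_dn X) (powers (mul_dn X)) (Z.to_nat k)
      else lookup (mul_dn IX) (powers (mul_dn IX)) (Z.to_nat (- k)) in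
  (0 <= v)%Z /\ fx v <= expR (- (zr k * u)).
Proof.
move=> X0 I0 uX uI; case: (Z.leb_spec 0 k) => k0 /=; rewrite lookupE.
  rewrite -(@zr_to_nat R k)// -[X in - X]add0r.
  apply: fx_iter_dn => //.
  by rewrite oppr0 expR0 fx_one.
have -> : - (zr k * u) = - (0 + (Z.to_nat (- k))%:R * - u) :> R.
  by rewrite zr_to_nat ?zrN; [ring|lia].
apply: fx_iter_dn; rewrite ?opprK//.
by rewrite oppr0 expR0 fx_one.
Qed.

Section Valid.
Variables (b : box) (t a : R).
Hypothesis vb : valid b t a.
Let x := expR (- t).
Let y := expR (- (a * t)).

Definition log_ratio (n m : Z) : R := zr n + zr m * a.
Definition cratio (n m : Z) : R := expR (- (log_ratio n m * t)).

Lemma cratioE n m : cratio n m = expR (- (zr (n + m) * t)) * expR (- (zr m * ((a - 1) * t))).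
Proof. by rewrite -expRD /cratio /log_ratio zrD; congr expR; ring. Qed.

Lemma cratio_hiP n m : cratio n m <= fx (cratio_hi b n m).
Proof.
case: vb => t0 a1 /andP[_ x1] _ /andP[_ z1] _ /andP[_ ix1] /andP[_ iz1] _ [_ Tx _ Tix] [_ Tz _ Tiz] _ _ _ _.
rewrite cratioE /cratio_hi; apply: le_trans (fx_mul_up _ _ _).
by rewrite Tx Tix Tz Tiz; apply: ler_pM; rewrite ?expR_ge0//; apply: pow_hi.
Qed.

Lemma cratio_loP n m : fx (cratio_lo b n m) <= cratio n m.
Proof.
case: vb => t0 a1 /andP[x1 _] _ /andP[z1 _] _ /andP[ix1 _] /andP[iz1 _] [? ? ? ?] [Tx _ Tix _] [Tz _ Tiz _] _ _ _ _.
rewrite cratioE /cratio_lo; apply: le_trans (fx_mul_dn _ _ _) _.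
rewrite Tx Tix Tz Tiz.
have [h1 h2] := @pow_lo (bx0 b) (bix0 b) t (n + m)%Z ltac:(done) ltac:(done) x1 ix1.
have [h3 h4] := @pow_lo (bz0 b) (biz0 b) ((a - 1) * t) m ltac:(done) ltac:(done) z1 iz1.
by apply: ler_pM => //; exact: fx_ge0.
Qed.

Lemma cratio_gt0 n m : 0 < cratio n m. Proof. exact: expR_gt0. Qed.

Lemma log_ratioP n m : fx (log_ratio_lo b n m) <= log_ratio n m <= fx (log_ratio_hi b n m).
Proof.
case: vb => _ _ _ _ _ /andP[a0 a1] _ _ _ _ _ _ _ _ _.
rewrite /log_ratio_lo /log_ratio_hi /log_ratio !fxD !fxZ fx_one mulr1 !lerD2l.
case: (Z.leb_spec 0 m) => m0.
  by rewrite !ler_wpM2l// -(@zr0 R); exact: zr_le.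
by rewrite !ler_wnM2l// -(@zr0 R); apply: zr_le; lia.
Qed.

Lemma slog_ratioP s n m : fx (slog_ratio_lo b s n m) <= sgn s * log_ratio n m <= fx (slog_ratio_hi b s n m).
Proof.
have /andP[h1 h2] := log_ratioP n m; rewrite /slog_ratio_lo /slog_ratio_hi /sgn; case: s; rewrite ?fxN; lra.
Qed.

(** The combination with coefficient [C] and sign [s] of the jets of two words,
    divided by the ratio of the prefix of the second word and expressed in the
    tails, up to a constant: prefixing by a word of logarithmic ratio [l] adds [l] times the value
    to the derivative. *)
Definition tail_form (C : R) (s : bool) (n m : Z) (q r : R * R) : R :=
  cratio n m * (C * q.1 + sgn s * (q.2 + log_ratio n m * q.1)) - (C * r.1 + sgn s * r.2).

Fixpoint extend (p : seq (bool * bool)) (q r : R * R) : (R * R) * (R * R) :=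
  match p with
  | nil => (q, r)
  | (true, d) :: p => extend p (jet_step x y a d q) r
  | (false, d) :: p => extend p q (jet_step x y a d r)
  end.

Fixpoint net (p : seq (bool * bool)) : Z * Z :=
  match p with
  | nil => (0, 0)
  | (s, d) :: p => let: (n, m) := net p in
     let e := if s then 1 else -1 in if d then (n, m + e) else (n + e, m)
  end%Z.

Fixpoint shift_of (p : seq (bool * bool)) (i j : Z) : Z * Z :=
  match p with
  | nil => (i, j)
  | (true, _) :: p => shift_of p i j
  | (false, false) :: p => shift_of p (i - 1) j
  | (false, true) :: p => shift_of p i (j - 1)
  end%Z.

Lemma log_ratioD n m n' m' : log_ratio (n + n') (m + m') = log_ratio n m + log_ratio n' m'.
Proof. by rewrite /log_ratio !zrD; ring. Qed.
Lemma cratio_n n m : cratio (n + 1) m = cratio n m * x.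
Proof. by rewrite /cratio /x -expRD /log_ratio zrD zr1; congr expR; ring. Qed.
Lemma cratio_m n m : cratio n (m + 1) = cratio n m * y.
Proof. by rewrite /cratio /y -expRD /log_ratio zrD zr1; congr expR; ring. Qed.
Lemma log_ratio_n n m : log_ratio (n + 1) m = log_ratio n m + 1.
Proof. by rewrite /log_ratio zrD zr1; ring. Qed.
Lemma log_ratio_m n m : log_ratio n (m + 1) = log_ratio n m + a.
Proof. by rewrite /log_ratio zrD zr1; ring. Qed.

(** Each letter changes [tail_form] by an affine map.  A letter of the first word
    adds a constant, whose factor is the quotient of the prefix ratios; a letter
    of the second word rescales the form and shifts its coefficient, because the
    derivative of that word absorbs the logarithmic ratio of the letter. *)
Lemma unwindP s c p i j n m v q r : net p = (n, m) ->
  tail_form (fx c + sgn s * log_ratio i j) s n m q r <= fx v ->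
  tail_form (fx c + sgn s * log_ratio (shift_of p i j).1 (shift_of p i j).2) s 0 0
    (extend p q r).1 (extend p q r).2 <= fx (unwind b s c p i j n m v).
Proof.
elim: p i j n m v q r => [|[sd d] p IH] i j n m v q r; first by move=> -[<- <-].
rewrite [net _]/=; case E: (net p) => [n' m'].
case: sd; case: d => -[<- <-] {n m} hv; rewrite [shift_of _ _ _]/= [extend _ _ _]/= [unwind _ _ _ _ _ _ _ _ _]/=.
- rewrite Z.add_simpl_r; apply: IH => //.
  set e := (c + _)%Z; rewrite fxD.
  have he : fx c + sgn s * log_ratio i j + sgn s * log_ratio n' m' <= fx e.
    by rewrite /e fxD; have /andP[_] := slog_ratioP s (i + n') (j + m'); rewrite log_ratioD; lra.
  have hr : fx (cratio_lo b n' m') <= cratio n' m' <= fx (cratio_hi b n' m').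
    by rewrite cratio_loP cratio_hiP.
  have h := fx_scale hr (ltW (cratio_gt0 _ _)) he.
  move: hv h; rewrite /tail_form /jet_step /= cratio_m log_ratio_m.
  lra.
- rewrite Z.add_simpl_r; apply: IH => //.
  move: hv; rewrite /tail_form /jet_step /= cratio_n log_ratio_n; lra.
- have [m1 em] : exists m1, m' = (m1 + 1)%Z by exists (m' - 1)%Z; lia.
  have [j1 ej] : exists j1, j = (j1 + 1)%Z by exists (j - 1)%Z; lia.
  subst m' j; move: hv; rewrite !Z.add_simpl_r.
  rewrite (_ : (m1 + 1 + -1 = m1)%Z); last by lia.
  move=> hv; apply: IH; first by rewrite E.
  rewrite fxB fxD.
  have h := fx_scale (v_y vb) (expR_ge0 _) hv.
  have /andP[hl _] := slog_ratioP s i j1.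
  move: h hl; rewrite /tail_form /jet_step /= cratio_m !log_ratio_m -/y.
  lra.
- have [m1 em] : exists m1, n' = (m1 + 1)%Z by exists (n' - 1)%Z; lia.
  have [j1 ej] : exists j1, i = (j1 + 1)%Z by exists (i - 1)%Z; lia.
  subst n' i; move: hv; rewrite !Z.add_simpl_r.
  rewrite (_ : (m1 + 1 + -1 = m1)%Z); last by lia.
  move=> hv; apply: IH; first by rewrite E.
  have h := fx_scale (v_x vb) (expR_ge0 _) hv.
  move: h; rewrite /tail_form /jet_step /= cratio_n !log_ratio_n -/x.
  lra.
Qed.

Lemma leaf_boundP s c n m v w :
  tail_form (fx c) s n m (jet x y a v) (jet x y a w) <= fx (leaf_bound b s c n m).
Proof.
have [? a1 /andP[_ hx] /andP[_ hy] _ _ _ _ _ _ _ hP hD tp tm] := vb.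
have a0 : 0 <= a by lra.
have x01 : 0 < x < 1 by rewrite expR_gt0 expR_lt1; lra.
have y01 : 0 < y < 1 by rewrite expR_gt0 expR_lt1; nra.
have [j1 j2] := jet_ge0 x01 y01 a0 v.
have hr := cratio_hiP n m; have r0 := cratio_gt0 n m.
have /andP[wl wh] := log_ratioP n m.
rewrite /tail_form /leaf_bound /sgn; case: s; rewrite fxD.
- have h1 := sup_minusP x01 y01 a0 hP (- c) w tm.
  have h2 := sup_plusP x01 y01 a0 hP hD (c + log_ratio_hi b n m) v tp.
  have h0 := sup_plus_ge0 x01 y01 a0 hP hD (c + log_ratio_hi b n m) tp.
  have h3 := le_mul_up (ltW r0) hr h0.
  rewrite fxN in h1; rewrite fxD in h2.
  have h4 : cratio n m * (fx c * (jet x y a v).1 + 1 * ((jet x y a v).2 + log_ratio n m * (jet x y a v).1))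
     <= cratio n m * fx (sup_plus (bP b) (bD b) (tplus b) (c + log_ratio_hi b n m)).
    rewrite ler_wpM2l ?(ltW r0)//; apply: le_trans h2.
    have : log_ratio n m * (jet x y a v).1 <= fx (log_ratio_hi b n m) * (jet x y a v).1 by rewrite ler_wpM2r.
    lra.
  lra.
- have h1 := sup_plusP x01 y01 a0 hP hD (- c) w tp.
  have h2 := sup_minusP x01 y01 a0 hP (c - log_ratio_lo b n m) v tm.
  have h0 := sup_minus_ge0 x01 y01 a0 hP (c - log_ratio_lo b n m) tm.
  have h3 := le_mul_up (ltW r0) hr h0.
  rewrite fxN in h1; rewrite fxB in h2.
  have h4 : cratio n m * (fx c * (jet x y a v).1 + -1 * ((jet x y a v).2 + log_ratio n m * (jet x y a v).1))
     <= cratio n m * fx (sup_minus (bP b) (tminus b) (c - log_ratio_lo b n m)).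
    rewrite ler_wpM2l ?(ltW r0)//; apply: le_trans h2.
    have : fx (log_ratio_lo b n m) * (jet x y a v).1 <= log_ratio n m * (jet x y a v).1 by rewrite ler_wpM2r.
    lra.
  lra.
Qed.

(** The empty word has the same jet as the word [[:: false]], so every jet can be
    split at a first letter. *)
Lemma jet_split w : exists d w', jet x y a w = jet_step x y a d (jet x y a w').
Proof.
case: w => [|d w]; last by exists d, w.
by exists false, [::]; rewrite jet_nil /jet_step /= add0r mulr0.
Qed.

Lemma log_ratio00 : log_ratio 0 0 = 0. Proof. by rewrite /log_ratio zr0; ring. Qed.
Lemma cratio00 : cratio 0 0 = 1. Proof. by rewrite /cratio log_ratio00 mul0r oppr0 expR0. Qed.
End Valid.

(** The search is finite, hence one bound [K] of the coefficients serves all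
    parameters of the box. *)
Lemma check_treeP fuel b p n m st st' : net p = (n, m) ->
  check_tree fuel b p n m st = Some st' ->
  exists K : R, forall t a, valid b t a -> forall v w,
    let x := expR (- t) in let y := expR (- (a * t)) in
    let qr := extend t a p (jet x y a v) (jet x y a w) in
    exists2 C, `|C| <= K & exists s, C * (qr.1.1 - qr.2.1) + sgn s * (qr.1.2 - qr.2.2) <= fx (-1).
Proof.
elim: fuel p n m st st' => [//|fuel IH] p n m st st' np /=.
case: (next_code st) => k {}st.
case: ifP => _.
  case: ifP => _.
    case E1: check_tree => [st1|//] E2.
    have e1 : net ((true, false) :: p) = (n + 1, m)%Z by rewrite /= np.
    have [K1 h1] := IH _ _ _ _ _ e1 E1.
    have e2 : net ((true, true) :: p) = (n, m + 1)%Z by rewrite /= np.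
    have [taylor_const h2] := IH _ _ _ _ _ e2 E2.
    exists (Num.max K1 taylor_const) => t a va v w.
    have [d [v' ev]] := jet_split t a v; rewrite ev {ev}.
    case: d.
      have /= [C CK hC] := h2 _ _ va v' w.
      by exists C => //; rewrite le_max CK orbT.
    have /= [C CK hC] := h1 _ _ va v' w.
    by exists C => //; rewrite le_max CK.
  case E1: check_tree => [st1|//] E2.
  have e1 : net ((false, false) :: p) = (n - 1, m)%Z by rewrite /= np.
  have [K1 h1] := IH _ _ _ _ _ e1 E1.
  have e2 : net ((false, true) :: p) = (n, m - 1)%Z by rewrite /= np.
  have [taylor_const h2] := IH _ _ _ _ _ e2 E2.
  exists (Num.max K1 taylor_const) => t a va v w.
  have [d [w' ew]] := jet_split t a w; rewrite ew {ew}.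
  case: d.
    have /= [C CK hC] := h2 _ _ va v w'.
    by exists C => //; rewrite le_max CK orbT.
  have /= [C CK hC] := h1 _ _ va v w'.
  by exists C => //; rewrite le_max CK.
case: ifP => // + _.
rewrite /leaf_ok; set s := ~~ _; set c := (_ * one)%Z => /Z.ltb_spec0 hl.
set ij := shift_of p 0 0.
exists (`|fx c| + (`|zr ij.1| + `|zr ij.2| * fx (ba1 b))) => t a va v w.
have h := leaf_boundP va s c n m v w.
rewrite -[X in tail_form _ _ X]addr0 -(mulr0 (sgn s)) -(log_ratio00 a) in h.
have {h} := unwindP va np h.
rewrite -/ij /tail_form cratio00 log_ratio00 => h.
exists (fx c + sgn s * log_ratio a ij.1 ij.2).
  rewrite (le_trans (ler_normD _ _))// lerD2l normrM.
  have -> : `|sgn s| = 1 by rewrite /sgn; case: (s); rewrite ?normrN normr1.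
  rewrite mul1r /log_ratio (le_trans (ler_normD _ _))// lerD2l normrM ler_wpM2l//.
  case: va => _ a1 _ _ _ /andP[_ aa] *; rewrite ger0_norm//; lra.
exists s; apply: (@le_trans _ _ (fx (unwind b s c p 0 0 n m (leaf_bound b s c n m)))).
  by move: h; lra.
by apply: fx_le; lia.
Qed.
End Sound.

Opaque table_plus table_minus.

Lemma inv_dn_ge0 X : (0 < X)%Z -> (0 <= inv_dn X)%Z.
Proof. by move=> X0; apply: Z.div_pos. Qed.
Lemma inv_up_ge0 X : (0 < X)%Z -> (0 <= inv_up X)%Z.
Proof. by move=> X0; apply: Z.add_nonneg_nonneg => //; apply: Z.div_pos. Qed.
Opaque inv_up inv_dn.

Section Cover.
Variable R : realType.
Notation fx := (@fx R).
Notation zr := (@zr R).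

Lemma zr_4096 : zr 4096 * fx 16384 = 1.
Proof. by rewrite -fxZ (_ : (4096 * 16384)%Z = one) ?fx_one. Qed.

Lemma zr_4096E : zr 4096 = 2 ^+ 12.
Proof.
have z2 : zr 2 = 2 by rewrite (_ : 2%Z = (1 + 1)%Z) // zrD zr1.
by rewrite -[4096%Z]/(2*2*2*2*2*2*2*2*2*2*2*2)%Z !zrM z2; ring.
Qed.

Lemma fx_neg_lt X (u : R) : 0 < u -> u <= fx X -> (0 < X)%Z.
Proof.
move=> u0 uX; rewrite Z.lt_nge => /(@fx_le R); rewrite fx0 => h.
by have := lt_le_trans u0 (le_trans uX h); rewrite ltxx.
Qed.

(** The bounds [M = 1 / (1 - y)] of the values and [D] of the derivatives, rounded
    upwards, satisfy the hypotheses of [jet_le]. *)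
Lemma box_ofP x0 x1 z0 z1 a0 a1 t a : 0 < t -> 1 <= a ->
  fx x0 <= expR (- t) <= fx x1 -> fx a0 <= a <= fx a1 ->
  fx z0 <= expR (- ((a - 1) * t)) <= fx z1 -> (0 <= a1)%Z ->
  box_ok (box_of x0 x1 z0 z1 a0 a1) -> valid (box_of x0 x1 z0 z1 a0 a1) t a.
Proof.
move=> t0 a1' /andP[hx0 hx1] /andP[ha0 ha1] /andP[hz0 hz1] a1z.
set y0 := mul_dn x0 z0; set y1 := mul_up x1 z1.
rewrite /box_ok -/y0 -/y1 => /and4P[/= /Z.ltb_spec0 x00 /Z.ltb_spec0 z00 /Z.ltb_spec0 x1l /Z.ltb_spec0 y1l].
have y1d : (0 < one - y1)%Z by exact: (Z.lt_0_sub _ _).2.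
have x1d : (0 < one - x1)%Z by exact: (Z.lt_0_sub _ _).2.
have x1p : (0 < x1)%Z by apply: fx_neg_lt hx1; exact: expR_gt0.
have z1p : (0 < z1)%Z by apply: fx_neg_lt hz1; exact: expR_gt0.
have ey : expR (- (a * t)) = expR (- t) * expR (- ((a - 1) * t)).
  by rewrite -expRD; congr expR; ring.
have x0p : 0 < fx x0 by rewrite -(@fx0 R); apply: fx_lt.
have z0p : 0 < fx z0 by rewrite -(@fx0 R); apply: fx_lt.
have hy1 : expR (- (a * t)) <= fx y1.
  by rewrite ey; apply: le_trans (fx_mul_up _ _ _); apply: ler_pM; rewrite ?expR_ge0.
have hy0 : fx y0 <= expR (- (a * t)).
  by rewrite ey; apply: le_trans (fx_mul_dn _ _ _) _; apply: ler_pM => //; exact: ltW.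
have inv_lo X u : (0 < X)%Z -> expR (- u) <= fx X -> fx (inv_dn X) <= expR u.
  move=> X0 uX; have h := @fx_inv_dn R X X0.
  have : expR (- u) * fx (inv_dn X) <= 1.
    apply: le_trans h; rewrite ler_wpM2r//; apply: fx_ge0; exact: inv_dn_ge0.
  by rewrite expRN mulrC ler_pdivrMr ?expR_gt0// mul1r.
have inv_hi X u : (0 < X)%Z -> fx X <= expR (- u) -> expR u <= fx (inv_up X).
  move=> X0 uX; have h := @fx_inv_up R X X0.
  have : 1 <= expR (- u) * fx (inv_up X).
    apply: (le_trans h); rewrite ler_wpM2r//; apply: fx_ge0.
    exact: inv_up_ge0.
  by rewrite expRN mulrC ler_pdivlMr ?expR_gt0// mul1r.
have P1 : 1 <= fx (one - y1) * fx (inv_up (one - y1)) by apply: fx_inv_up.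
have Y1 : fx y1 < 1 by rewrite -(@fx_one R); exact: fx_lt.
have X1 : fx x1 < 1 by rewrite -(@fx_one R); exact: fx_lt.
rewrite fxB fx_one in P1.
set P := inv_up (one - y1) in P1 *.
set D := Z.max (mul_up (mul_up y1 P) a1 * one / (one - y1) + 1)
           (mul_up x1 P * one / (one - x1) + 1).
have P0 : 0 < fx P by rewrite -(pmulr_rgt0 _ (_ : 0 < 1 - fx y1)) ?subr_gt0//; lra.
have D1 : fx y1 * fx P * fx a1 <= fx D * (1 - fx y1).
  apply: le_trans (_ : fx (mul_up (mul_up y1 P) a1) <= _).
    apply: le_trans (fx_mul_up _ _ _); rewrite ler_wpM2r ?fx_mul_up//.
    by apply: fx_ge0.
  rewrite -fx_one -fxB; apply: le_trans (_ : fx (mul_up (mul_up y1 P) a1 * one / (one - y1) + 1) * fx (one - y1) <= _).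
    by apply: fx_leM; exact: div_hi.
  by rewrite ler_wpM2r//; [apply: fx_ge0; exact: Z.lt_le_incl|apply: fx_le; exact: Z.le_max_l].
have D2 : fx x1 * fx P <= fx D * (1 - fx x1).
  apply: le_trans (fx_mul_up _ _ _) _.
  rewrite -fx_one -fxB; apply: le_trans (_ : fx (mul_up x1 P * one / (one - x1) + 1) * fx (one - x1) <= _).
    by apply: fx_leM; exact: div_hi.
  by rewrite ler_wpM2r//; [apply: fx_ge0; exact: Z.lt_le_incl|apply: fx_le; exact: Z.le_max_r].
have x10 : 0 <= fx x1 by exact: le_trans (expR_ge0 _) hx1.
have y10 : 0 <= fx y1 by exact: le_trans (expR_ge0 _) hy1.
have D0 : 0 <= fx D.
  rewrite -(pmulr_lge0 _ (_ : 0 < 1 - fx x1)) ?subr_gt0//; apply: le_trans D2.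
  by rewrite mulr_ge0// ltW.
have xl : expR (- t) < 1 by exact: le_lt_trans hx1 X1.
have yl : expR (- (a * t)) < 1 by exact: le_lt_trans hy1 Y1.
have x01 : 0 < expR (- t) < 1 by rewrite expR_gt0.
have y01 : 0 < expR (- (a * t)) < 1 by rewrite expR_gt0.
have ag : 0 <= a by lra.
have aq := ha1.
have J w : (jet (expR (- t)) (expR (- (a * t))) a w).1 <= fx P /\
           (jet (expR (- t)) (expR (- (a * t))) a w).2 <= fx D.
  apply: jet_le => //; last exact: ltW.
  - have := ler_wpM2r (ltW P0) hy1; lra.
  - have h := ler_wpM2r (ltW P0) hx1; have h' := ler_wpM2r D0 hx1; lra.
  - have h' := ler_wpM2r D0 hy1.
    have h : expR (- (a * t)) * (a * fx P) <= fx y1 * (fx a1 * fx P).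
      apply: ler_pM => //; [by rewrite mulr_ge0// ltW|].
      by rewrite ler_wpM2r// ltW.
    lra.
have tp := (table_plusP x01 y01 ag (fun w => (J w).1) (fun w => (J w).2) hx1 hy1 12 aq).2.
have tm := (table_minusP x01 y01 ag (fun w => (J w).1) hx1 hy1 12 ha0).2.
apply: Valid; rewrite /box_of; cbn [bx0 bx1 by0 by1 bz0 bz1 ba0 ba1 bix0 bix1 biz0 biz1
  tx0 tx1 tix0 tix1 tz0 tz1 tiz0 tiz1 bP bD tplus tminus].
- exact: t0.
- exact: a1'.
- by rewrite hx0 hx1.
- by rewrite hy0 hy1.
- by rewrite hz0 hz1.
- by rewrite ha0 ha1.
- by rewrite inv_lo// inv_hi.
- by rewrite inv_lo// inv_hi.
- by split; (try exact: Z.lt_le_incl); exact: inv_dn_ge0.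
- by [].
- by [].
- by move=> w; exact: (J w).1.
- by move=> w; exact: (J w).2.
- exact: tp.
- exact: tm.
Qed.

Lemma mk_boxP x0 x1 q0 q1 t a : 0 < t -> 1 <= a ->
  fx x0 <= expR (- t) <= fx x1 -> zr q0 / zr 4096 <= a <= zr q1 / zr 4096 ->
  (4096 <=? q0)%Z && (4096 <=? q1)%Z && box_ok (mk_box x0 x1 q0 q1) ->
  valid (mk_box x0 x1 q0 q1) t a.
Proof.
move=> t0 a1 hx /andP[ha0 ha1] /andP[/andP[/Z.leb_spec0 q0g /Z.leb_spec0 q1g]] ok.
have w0 : 0 < zr 4096 by rewrite zr_4096E exprn_gt0.
have zE q : zr q / zr 4096 = fx (q * 16384).
  by rewrite fxZ; apply: (mulfI (lt0r_neq0 w0)); rewrite mulrCA divff ?lt0r_neq0// mulrCA zr_4096.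
have divE q : zr (q - 4096) * t / zr 4096 = (zr q / zr 4096 - 1) * t.
  by rewrite zrB; move: w0; move: (zr 4096) => w w0; field; rewrite gt_eqF.
have one0 : expR (- 0) = fx one by rewrite oppr0 expR0 fx_one.
have one_ge0 : (0 <= one)%Z by exact: Z.lt_le_incl one_gt0.
have x0z : (0 <= x0)%Z by case/and4P: ok => /Z.ltb_spec0 h _ _ _; exact: Z.lt_le_incl h.
have [hx0 hx1] := andP hx.
have x1z : (0 <= x1)%Z.
  by apply: Z.lt_le_incl; apply: fx_neg_lt hx1; exact: expR_gt0.
apply: box_ofP => //; [by rewrite -!zE ha0| |lia].
apply/andP; split.
  have [|||_ h] := @fx_pow_dn R x0 t 12 (q1 - 4096) one 0 x0z one_ge0.
  - lia.
  - exact: hx0.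
  - by rewrite one0.
  apply: (le_trans h); rewrite ler_expR lerN2 add0r -zr_4096E divE.
  by rewrite ler_wpM2r ?lerB// ltW.
have h := @fx_pow_up R x1 t 12 (q0 - 4096) one 0 x1z one_ge0 _ hx1 _.
apply: le_trans (h _ _); [|lia|by rewrite one0].
rewrite ler_expR lerN2 add0r -zr_4096E divE.
by rewrite ler_wpM2r ?lerB// ltW.
Qed.

Definition apart (K t a : R) := forall v w,
  let x := expR (- t) in let y := expR (- (a * t)) in
  let q := jet x y a (true :: v) in let r := jet x y a (false :: w) in
  exists2 C, `|C| <= K & exists s, C * (q.1 - r.1) + sgn R s * (q.2 - r.2) <= fx (-1).

Lemma apart_le K K' t a : K <= K' -> apart K t a -> apart K' t a.
Proof. by move=> KK h v w; have [C CK hC] := h v w; exists C => //; exact: le_trans KK. Qed.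

Opaque mk_box box_ok check_tree.

Lemma check_coverP fuel x0 x1 q0 q1 st st' :
  check_cover fuel x0 x1 q0 q1 st = Some st' ->
  exists K : R, forall t a : R, 0 < t -> 1 <= a -> fx x0 <= expR (- t) <= fx x1 ->
    zr q0 / zr 4096 <= a <= zr q1 / zr 4096 -> apart K t a.
Proof.
elim: fuel x0 x1 q0 q1 st st' => [//|fuel IH] x0 x1 q0 q1 st st' /=.
case: (next_code st) => k st2; case: ifP => _.
  case E1: check_cover => [st1|//] E2.
  have [K1 h1] := IH _ _ _ _ _ _ E1; have [taylor_const h2] := IH _ _ _ _ _ _ E2.
  exists (Num.max K1 taylor_const) => t a t0 a1 /andP[hx0 hx1] ha.
  have [hm|hm] := leP (expR (- t)) (fx ((x0 + x1) / 2)).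
    by apply: apart_le (h1 _ _ _ _ _ _) => //; rewrite ?le_max ?lexx// hx0.
  by apply: apart_le (h2 _ _ _ _ _ _) => //; rewrite ?le_max ?lexx ?orbT// hx1 ltW.
case: ifP => _.
  case E1: check_cover => [st1|//] E2.
  have [K1 h1] := IH _ _ _ _ _ _ E1; have [taylor_const h2] := IH _ _ _ _ _ _ E2.
  exists (Num.max K1 taylor_const) => t a t0 a1 hx /andP[ha0 ha1].
  have [hm|hm] := leP a (zr ((q0 + q1) / 2) / zr 4096).
    by apply: apart_le (h1 _ _ _ _ _ _) => //; rewrite ?le_max ?lexx// ha0.
  by apply: apart_le (h2 _ _ _ _ _ _) => //; rewrite ?le_max ?lexx ?orbT// ha1 ltW.
have np : net [:: (false, false); (true, true)] = (-1, 1)%Z by [].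
case: ifP => // ok /(check_treeP R np) [K hK].
exists K => t a t0 a1 hx ha v w.
have vb := mk_boxP t0 a1 hx ha ok.
by have := hK t a vb v w.
Qed.
End Cover.

Opaque codes.

Lemma fxM1 (R : realType) (m n : Z) : (m * n = one)%Z -> zr R m * fx R n = 1.
Proof. by move=> mn; rewrite -fxZ mn fx_one. Qed.

(** If [C f + D <= - d] or [C f - D <= - d] with [|C| <= K], then [|f|] or [|D|]
    is at least [d / (K + 1)]. The exponent is at most 3 because
    [0.668 + 0.668 ^ 3 < 1], so the certified box contains all parameters. *)
Lemma jets_apart (R : realType) : exists2 eps : R, 0 < eps &
  forall t a, 0 < t -> 1 <= a -> let x := expR (- t) in let y := expR (- (a * t)) in
    x <= 668%:R / 1000%:R -> 1 < x + y -> forall v w,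
    let q := jet x y a (true :: v) in let r := jet x y a (false :: w) in
    eps <= `|q.1 - r.1| \/ eps <= `|q.2 - r.2|.
Proof.
have := codes_ok; case E : check_cover => [st|//] _.
have [K {E} hK] := check_coverP R E.
have e0 : 0 < fx R 1 by rewrite -(@fx0 R); exact: fx_lt.
exists (fx R 1 / (Num.max K 0 + 1)).
  by rewrite divr_gt0// ltr_wpDl// le_max lexx orbT.
move=> t a t0 a1 x y xl xy v w q r.
have z2 := zr2 R.
have z3 : zr R 3 = 3 by rewrite (_ : 3%Z = (1 + 2)%Z)// zrD zr1 z2; ring.
have half : fx R 33554432 = 2^-1.
  by have := @fxM1 R 2 33554432 erefl; rewrite z2 => h; lra.
have hi : 668%:R / 1000%:R <= fx R 44828722.
  have : fx R (668 * one) <= fx R (1000 * 44828722) by apply: fx_le.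
  rewrite !fxZ fx_one mulr1 -[668%Z]/(Z.of_nat 668) -[1000%Z]/(Z.of_nat 1000) !zr_nat.
  lra.
have x0 : 0 < x by exact: expR_gt0.
have yx : y <= x by rewrite ler_expR lerN2 ler_peMl// ltW.
have a3 : a <= 3.
  rewrite leNgt; apply/negP => a3.
  have : y <= x ^+ 3.
    by rewrite -expRM_natl ler_expR mulrN lerN2 ler_wpM2r// ltW.
  have h2 : x * x <= (668%:R / 1000%:R) * (668%:R / 1000%:R) by apply: ler_pM => //; exact: ltW.
  have h3 : x ^+ 3 <= (668%:R / 1000%:R) * ((668%:R / 1000%:R) * (668%:R / 1000%:R)).
    by rewrite exprS expr2; apply: ler_pM => //; rewrite ?mulr_ge0 ?ltW.
  lra.
have [||C CK [s hC]] := hK t a t0 a1 _ _ v w.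
- by rewrite half -/x (le_trans xl hi) andbT; lra.
- have w0 : 0 < zr R 4096 by rewrite zr_4096E exprn_gt0.
  rewrite divff ?gt_eqF// a1 /= (_ : 12288%Z = (3 * 4096)%Z)// zrM z3 mulfK ?gt_eqF//.
have K0 : 0 <= K by exact: le_trans CK.
rewrite max_l//; set e := _ / _.
have [h1|h1] := leP e `|q.1 - r.1|; first by left.
have [h2|h2] := leP e `|q.2 - r.2|; first by right.
have eE : e * (K + 1) = fx R 1 by rewrite divfK// gt_eqF// ltr_wpDl.
have h3 : `|C * (q.1 - r.1)| <= K * e by rewrite normrM ler_pM// ltW.
have h4 : `|sgn R s * (q.2 - r.2)| < e.
  by rewrite normrM /sgn; case: (s); rewrite ?normrN normr1 mul1r.
move: hC; rewrite -/x -/y -/q -/r (_ : (-1)%Z = (- (1))%Z)// fxN -eE.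
move: h3 h4; rewrite ler_norml ltr_norml => /andP[+ _] /andP[+ _]; lra.
Qed.

(** * Second-order expansion along a curve *)

Section Taylor.
Variable R : realType.
Implicit Types (t a : R) (w : seq bool).

Lemma expN_lip (L t t' : R) : 0 <= L -> 0 <= t -> 0 <= t' ->
  `|expR (- (L * t')) - expR (- (L * t))| <= L * `|t' - t|.
Proof.
move=> L0; wlog tt : t t' / t <= t'.
  move=> h t0 t'0; have [|/ltW] := leP t t'; first by move=> /h; exact.
  by move=> /h; rewrite distrC [`|t' - t|]distrC; exact.
move=> t0 t'0.
have A1 : expR (- (L * t)) <= 1 by rewrite expR_le1; nra.
have h : expR (- (L * t)) * (1 - L * (t' - t)) <= expR (- (L * t')).
  rewrite (_ : - (L * t') = - (L * t) + - (L * (t' - t))); last by ring.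
  by rewrite expRD ler_pM2l ?expR_gt0// expR_ge1Dx.
have h2 : expR (- (L * t')) <= expR (- (L * t)) by rewrite ler_expR lerN2 ler_wpM2l.
rewrite (ger0_norm (_ : 0 <= t' - t)) ?subr_ge0// ler0_norm ?subr_le0//.
have : expR (- (L * t)) * (L * (t' - t)) <= L * (t' - t).
  by rewrite ler_piMl// mulr_ge0// subr_ge0.
lra.
Qed.

Lemma expN_taylor (L t t' : R) : 0 <= L -> 0 <= t -> 0 <= t' ->
  `|expR (- (L * t')) - expR (- (L * t)) + L * (t' - t) * expR (- (L * t))|
    <= L ^+ 2 * (t' - t) ^+ 2.
Proof.
move=> L0 t0 t'0; set d := t' - t; set A := expR (- (L * t)); set B := expR (- (L * t')).
have h1 : A * (1 - L * d) <= B.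
  rewrite /B (_ : - (L * t') = - (L * t) + - (L * d)); last by rewrite /d; ring.
  by rewrite expRD ler_pM2l ?expR_gt0// expR_ge1Dx.
have h2 : B * (1 + L * d) <= A.
  rewrite /A (_ : - (L * t) = - (L * t') + L * d); last by rewrite /d; ring.
  by rewrite expRD ler_pM2l ?expR_gt0// expR_ge1Dx.
rewrite ger0_norm; last by lra.
have h3 : B - A + L * d * A <= L * d * (A - B) by lra.
apply: (le_trans h3); apply: (le_trans (ler_norm _)).
rewrite !normrM (ger0_norm L0) [`|A - B|]distrC.
have h4 := expN_lip L0 t0 t'0; rewrite -/A -/B -/d in h4.
have -> : L ^+ 2 * d ^+ 2 = L * `|d| * (L * `|d|) by rewrite -(real_normK (num_real d)); ring.
by rewrite ler_wpM2l// mulr_ge0.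
Qed.

Let rho : R := 668%:R / 1000%:R.

Section Curve.
Variable a : R.
Hypothesis a1 : 1 <= a.
Definition curve_jet t w := jet (expR (- t)) (expR (- (a * t))) a w.
Definition small_ratios t := 0 < t /\ expR (- t) <= rho.

Lemma small_ratios_y t : small_ratios t -> expR (- (a * t)) <= rho.
Proof.
by move=> [t0 h]; apply: le_trans h; rewrite ler_expR lerN2 ler_peMl// ltW.
Qed.

Lemma curve_jet_bnd t w : small_ratios t -> 0 <= (curve_jet t w).1 <= 4 /\ 0 <= (curve_jet t w).2 <= 9 * a.
Proof.
move=> st; have [t0 xr] := st; have yr := small_ratios_y st.
have x0 := expR_gt0 (- t); have y0 := expR_gt0 (- (a * t)).
have x01 : 0 < expR (- t) < 1 by rewrite x0 /=; move: xr; rewrite /rho; lra.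
have y01 : 0 < expR (- (a * t)) < 1 by rewrite y0 /=; move: yr; rewrite /rho; lra.
have a0 : 0 <= a by exact: le_trans ler01 a1.
have [h1 h2] := jet_ge0 x01 y01 a0 w.
have [h3 h4] : (curve_jet t w).1 <= 4 /\ (curve_jet t w).2 <= 9 * a.
  have a1' := a1; move: xr yr; rewrite /rho => xr yr.
  apply: jet_le => //; nra.
by rewrite h1 h2 h3 h4.
Qed.

Definition taylor_const := 40 * a ^+ 2.

(** The remainder obeys a recursion along the word: prefixing a letter with
    ratio [expR (- (L t))] multiplies it by that ratio, at most 0.668, and adds an
    error of order [a ^ 2 (t' - t) ^ 2].  The constant of the geometric series is
    independent of the word. *)
Lemma curve_jet_taylor t t' w : small_ratios t -> small_ratios t' ->
  `|(curve_jet t' w).1 - (curve_jet t w).1 + (t' - t) * (curve_jet t w).2| <= taylor_const * (t' - t) ^+ 2.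
Proof.
move=> st st'; have [t0 xr] := st; have [t'0 xr'] := st'.
have yr' := small_ratios_y st'; set d := t' - t.
have d0 : 0 <= d ^+ 2 by exact: sqr_ge0.
have a1' := a1; elim: w => [|b w IH].
  by rewrite /curve_jet !jet_nil /= subrr mulr0 addr0 normr0 mulr_ge0// /taylor_const mulr_ge0// sqr_ge0.
have [/andP[P0 P4] /andP[D0 D9]] := curve_jet_bnd w st.
have key (L : R) : 0 <= L <= a -> expR (- (L * t')) <= rho ->
  `|expR (- (L * t')) * ((curve_jet t' w).1 - (curve_jet t w).1 + d * (curve_jet t w).2) +
    (curve_jet t w).1 * (expR (- (L * t')) - expR (- (L * t)) + L * d * expR (- (L * t))) -
    d * (curve_jet t w).2 * (expR (- (L * t')) - expR (- (L * t)))| <= taylor_const * d ^+ 2.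
  move=> /andP[L0 La] lr.
  have e1 := expN_taylor L0 (ltW t0) (ltW t'0).
  have e2 := expN_lip L0 (ltW t0) (ltW t'0).
  rewrite -/d in e1 e2.
  apply: (le_trans (ler_normB _ _)); apply: (le_trans (lerD (ler_normD _ _) (lexx _))).
  rewrite !normrM (ger0_norm (expR_ge0 _)) (ger0_norm P0) (ger0_norm D0).
  have f1 : expR (- (L * t')) * `|(curve_jet t' w).1 - (curve_jet t w).1 + d * (curve_jet t w).2| <= rho * (taylor_const * d ^+ 2).
    by apply: ler_pM => //; exact: expR_ge0.
  have L2 : L ^+ 2 <= a ^+ 2 by rewrite ler_sqr ?nnegrE//; lra.
  have f2 : (curve_jet t w).1 * `|expR (- (L * t')) - expR (- (L * t)) + L * d * expR (- (L * t))| <= 4 * (a ^+ 2 * d ^+ 2).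
    apply: ler_pM => //; apply: (le_trans e1); exact: ler_wpM2r.
  have f3 : `|d| * (curve_jet t w).2 * `|expR (- (L * t')) - expR (- (L * t))| <= 9 * (a ^+ 2 * d ^+ 2).
    have -> : 9 * (a ^+ 2 * d ^+ 2) = `|d| * (9 * a) * (a * `|d|).
      by rewrite -(real_normK (num_real d)); ring.
    apply: ler_pM => //; rewrite ?mulr_ge0//; first by rewrite ler_wpM2l.
    by apply: (le_trans e2); rewrite ler_wpM2r.
  have A0 : 0 <= a ^+ 2 * d ^+ 2 by rewrite mulr_ge0// sqr_ge0.
  move: f1 f2 f3; rewrite /taylor_const /rho.
  set u := _ * `|_|; set v := _ * `|_|; set w0 := _ * `|_|.
  lra.
rewrite /curve_jet !jet_cons -/(curve_jet t w) -/(curve_jet t' w) /jet_step; case: b => /=.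
  have h := key a _ yr'; rewrite lexx (le_trans ler01 a1) in h.
  by apply: le_trans (h erefl); rewrite le_eqVlt; apply/orP; left; apply/eqP; congr `|_|; ring.
have := key 1; rewrite a1 ler01 !mul1r => /(_ erefl xr') h.
by apply: le_trans h; rewrite le_eqVlt; apply/orP; left; apply/eqP; congr `|_|; ring.
Qed.

End Curve.
End Taylor.

(** * Transversality of the coding maps *)

Section Transversality.
Variable R : realType.
Let rho : R := 668%:R / 1000%:R.

Definition gap (a t : R) v w : R := (curve_jet a t (true :: v)).1 - (curve_jet a t (false :: w)).1.

(** Where [|gap| < e], the derivative of the gap is at least [e]; the second-order
    remainder is at most half of the linear term for [|t' - t| <= eta]. *)
Lemma gap_transversal (a : R) : 1 <= a -> exists e c eta : R, [/\ 0 < e, 0 < c, 0 < eta &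
  forall t t', small_ratios t -> small_ratios t' -> 1 < expR (- t) + expR (- (a * t)) ->
   `|t' - t| <= eta -> forall v w, `|gap a t v w| < e ->
   c * `|t' - t| <= `|gap a t' v w - gap a t v w| ].
Proof.
move=> a1; have [e e0 he] := jets_apart R.
have K0 : 0 < taylor_const a by rewrite /taylor_const mulr_gt0// exprn_gt0//; lra.
exists e, (e / 2), (e / (4 * taylor_const a)); split=> //; [lra|by rewrite divr_gt0//; lra|].
move=> t t' st st' xy ht v w hg.
have [t0 xr] := st.
have [|hD] := he t a t0 a1 xr xy v w; first by rewrite leNgt hg.
have h1 := curve_jet_taylor a1 (true :: v) st st'.
have h2 := curve_jet_taylor a1 (false :: w) st st'.
rewrite -/(curve_jet a t (true :: v)) -/(curve_jet a t (false :: w)) in hD.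
set d := t' - t in ht h1 h2 *.
set D := (curve_jet a t (true :: v)).2 - (curve_jet a t (false :: w)).2 in hD.
have h3 : `|gap a t' v w - gap a t v w + d * D| <= 2 * taylor_const a * d ^+ 2.
  rewrite (_ : _ + _ = ((curve_jet a t' (true :: v)).1 - (curve_jet a t (true :: v)).1 + d * (curve_jet a t (true :: v)).2) - ((curve_jet a t' (false :: w)).1 - (curve_jet a t (false :: w)).1 + d * (curve_jet a t (false :: w)).2)); last by rewrite /gap /D; ring.
  by apply: (le_trans (ler_normB _ _)); lra.
have h4 : `|d| * e <= `|d * D| by rewrite normrM ler_wpM2l.
have h5 : `|d * D| <= `|gap a t' v w - gap a t v w + d * D| + `|gap a t' v w - gap a t v w|.
  rewrite -[X in `|X| <= _](addrK (gap a t' v w - gap a t v w)) addrC [d * D + _]addrC.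
  by rewrite addrC (le_trans (ler_normB _ _)).
have h6 : 2 * taylor_const a * d ^+ 2 <= e / 2 * `|d|.
  rewrite -(real_normK (num_real d)) expr2 mulrA ler_wpM2r//.
  rewrite (_ : 2 * taylor_const a * `|d| = `|d| * (4 * taylor_const a) / 2); last by field.
  by rewrite ler_pM2r// -ler_pdivlMr// mulr_gt0.
clear -h3 h4 h5 h6 hD; lra.
Qed.

Definition yratio (al x : R) : R := expR (al * ln x).
(** The base point is the fixed point of the map of larger ratio.  With this
    choice the reflection of the line that exchanges the two maps also exchanges
    the base points. *)
Definition base_point (al x : R) : R := if 1 <= al then 0 else expR (- ln (1 - yratio al x)).
Definition word_point (al x : R) (w : seq bool) : R :=
  foldr (fun (d : bool) z => if d then 1 + yratio al x * z else x * z) (base_point al x) w.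
Definition region (al x : R) : bool :=
  [&& 0 < x, x <= rho, yratio al x <= rho & 1 < x + yratio al x].

Lemma region_ge al x : region al x -> 1 / 4 <= x <= 3 / 4 /\ 1 / 4 <= yratio al x <= 3 / 4.
Proof. by case/and4P; rewrite /rho => h1 h2 h3 h4; split; apply/andP; split; lra. Qed.

Lemma ln_lip (x x' : R) : 1 / 4 <= x <= 1 -> 1 / 4 <= x' <= 1 ->
  `|x' - x| <= `|ln x' - ln x| <= 4 * `|x' - x|.
Proof.
wlog xx : x x' / x <= x'.
  move=> h hx hx'; have [|/ltW] := leP x x'; first by move=> /h; exact.
  by move=> /h; rewrite distrC [`|ln _ - _|]distrC; exact.
move=> /andP[x1 x2] /andP[x3 x4]; have x0 : 0 < x by lra. have x'0 : 0 < x' by lra.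
have h1 : 1 + (ln x' - ln x) <= x' / x.
  by apply: le_trans (expR_ge1Dx _) _; rewrite expRD expRN !lnK.
have h2 : 1 + (ln x - ln x') <= x / x'.
  by apply: le_trans (expR_ge1Dx _) _; rewrite expRD expRN !lnK.
have ll : ln x <= ln x' by rewrite ler_ln.
rewrite ger0_norm ?subr_ge0// ger0_norm ?subr_ge0//.
move: h1 h2; rewrite !ler_pdivlMr// => h1 h2.
apply/andP; split; nra.
Qed.

Lemma word_point_ge1 al x w : 0 < x -> 1 <= al -> word_point al x w = (curve_jet al (- ln x) w).1.
Proof.
move=> x0 al1; have ex : expR (- - ln x) = x by rewrite opprK lnK.
have ey : expR (- (al * - ln x)) = yratio al x by rewrite mulrN opprK.
elim: w => [|d w IH]; first by rewrite /word_point /base_point /= al1.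
rewrite /curve_jet jet_cons -/(curve_jet _ _ _) /jet_step ex ey /= -/(word_point al x w) IH.
by case: d.
Qed.

(** The affine map that sends the fixed points 0 and [1 / (1 - y)] to each other
    conjugates the system with ratios [x], [y] to that with ratios [y], [x]. *)
Lemma word_point_lt1 al x w : 0 < al -> al < 1 -> 0 < x -> yratio al x < 1 ->
  word_point al x w = (1 - (1 - x) * (curve_jet al^-1 (- (al * ln x)) (map negb w)).1) / (1 - yratio al x).
Proof.
move=> al0 al1 x0 y1; have ey : expR (- - (al * ln x)) = yratio al x by rewrite opprK.
have ex : expR (- (al^-1 * - (al * ln x))) = x.
  by rewrite mulrN opprK mulKf ?gt_eqF// lnK.
have ny : 1 - yratio al x != 0 by rewrite gt_eqF// subr_gt0.
elim: w => [|d w IH].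
  by rewrite /word_point /base_point /curve_jet jet_nil /= leNgt al1 /= expRN lnK ?mulr0 ?subr0 ?mul1r// posrE subr_gt0.
rewrite [map _ _]/= /curve_jet jet_cons -/(curve_jet _ _ _) /jet_step ex ey /= -/(word_point al x w) IH.
by case: d => /=; field.
Qed.

Lemma ln_small z : 0 < z -> z <= rho -> ln z < 0.
Proof. by rewrite /rho => z0 zr; rewrite ln_lt0// z0; lra. Qed.

Lemma transversal_ge1 (al : R) : 1 <= al -> exists e c eta : R, [/\ 0 < e, 0 < c, 0 < eta &
  forall x x', region al x -> region al x' -> `|x' - x| <= eta ->
  forall v w, let f z := word_point al z (true :: v) - word_point al z (false :: w) in
   `|f x| < e -> c * `|x' - x| <= `|f x' - f x| ].
Proof.
move=> al1; have [e [c [eta [e0 c0 eta0 h]]]] := gap_transversal al1.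
exists e, c, (eta / 4); split=> //; first by rewrite divr_gt0.
move=> x x' rx rx' xx v w f.
have [/andP[hx1 hx2] _] := region_ge rx; have [/andP[hx'1 hx'2] _] := region_ge rx'.
have x0 : 0 < x by case/and4P: rx. have x'0 : 0 < x' by case/and4P: rx'.
have fE z : 0 < z -> f z = gap al (- ln z) v w.
  by move=> z0; rewrite /f !word_point_ge1.
have /andP[l1 l2] : `|x' - x| <= `|ln x' - ln x| <= 4 * `|x' - x|.
  by apply: ln_lip; apply/andP; split; lra.
have tt : `|- ln x' - - ln x| = `|ln x' - ln x| by rewrite -opprD normrN.
have sm z : region al z -> small_ratios (- ln z).
  case/and4P => z0 zr _ _; split; last by rewrite opprK lnK.
  by rewrite oppr_gt0 ln_small.
rewrite !fE// => hf.
have := h _ _ (sm _ rx) (sm _ rx') _ _ v w hf.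
rewrite tt !opprK lnK// mulrN opprK => hh; apply: le_trans (hh _ _).
- by rewrite ler_wpM2l// ltW.
- by case/and4P: rx.
- by apply: le_trans l2 _; rewrite mulrC -ler_pdivlMr.
Qed.

(** The factor [(1 - x) / (1 - y)] comes from the change of scale in
    [word_point_lt1]. *)
Lemma factor_lip (x x' y y' : R) : 1 / 4 <= x <= 3 / 4 ->
  1 / 4 <= y <= 3 / 4 -> 1 / 4 <= y' <= 3 / 4 -> `|y' - y| <= 4 * `|x' - x| ->
  `|(1 - x') / (1 - y') - (1 - x) / (1 - y)| <= 80 * `|x' - x|.
Proof.
move=> /andP[x1 x2] /andP[y1 y2] /andP[y3 y4] hy.
have d1 : 1 / 4 <= 1 - y by lra. have d2 : 1 / 4 <= 1 - y' by lra.
have p1 : 0 < 1 - y by lra. have p2 : 0 < 1 - y' by lra.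
have -> : (1 - x') / (1 - y') - (1 - x) / (1 - y) =
    ((x - x') * (1 - y) + (1 - x) * (y' - y)) / ((1 - y) * (1 - y')).
  by field; rewrite !gt_eqF.
have d3 : 1 / 16 <= (1 - y) * (1 - y').
  by rewrite (_ : 1 / 16 = 1 / 4 * (1 / 4)); [apply: ler_pM => //; lra|field].
rewrite normrM normfV (gtr0_norm (mulr_gt0 p1 p2)) ler_pdivrMr ?mulr_gt0//.
have d4 : `|(x - x') * (1 - y) + (1 - x) * (y' - y)| <= 5 * `|x' - x|.
  apply: (le_trans (ler_normD _ _)); rewrite !normrM [`|x - x'|]distrC.
  rewrite (gtr0_norm p1) (ger0_norm (_ : 0 <= 1 - x)); last by lra.
  have f1 : `|x' - x| * (1 - y) <= `|x' - x| by rewrite ler_piMr//; lra.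
  have f2 : (1 - x) * `|y' - y| <= `|y' - y| by rewrite ler_piMl//; lra.
  clear -hy f1 f2; lra.
apply: (le_trans d4); rewrite -mulrA mulrCA -{1}(mulr1 5) -mulrA.
have := normr_ge0 (x' - x); set d := `|_| => dd.
have := ler_wpM2l dd d3; clear; lra.
Qed.

(** [F] is small, so the variation of [g] perturbs the increment of [F] only
    little. *)
Lemma product_increment (g g' F F' d c e : R) : 0 <= d -> 1 / 4 <= g' ->
  `|g' - g| <= 80 * d -> `|F| <= 4 * e -> c * d <= `|F' - F| -> e <= c / 8 / 8 / 40 ->
  c / 8 * d <= `|g' * F' - g * F|.
Proof.
move=> d0 g0 hg hF hc ec.
have h3 : 1 / 4 * `|F' - F| <= `|g' * (F' - F)|.
  rewrite normrM; apply: ler_wpM2r => //.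
  by apply: le_trans g0 _; exact: ler_norm.
have h4 : `|(g' - g) * F| <= (80 * d) * (4 * e) by rewrite normrM; apply: ler_pM.
have h5 : `|g' * (F' - F)| <= `|g' * F' - g * F| + `|(g' - g) * F|.
  have -> : g' * (F' - F) = (g' * F' - g * F) - (g' - g) * F by ring.
  exact: ler_normB.
have := ler_wpM2r d0 ec; clear -hc h3 h4 h5; lra.
Qed.

Lemma transversal_lt1 (al : R) : 0 < al -> al < 1 -> exists e c eta : R, [/\ 0 < e, 0 < c, 0 < eta &
  forall x x', region al x -> region al x' -> `|x' - x| <= eta ->
  forall v w, let f z := word_point al z (true :: v) - word_point al z (false :: w) in
   `|f x| < e -> c * `|x' - x| <= `|f x' - f x| ].
Proof.
move=> al0 al1; have b1 : 1 <= al^-1 by rewrite invf_ge1// ltW.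
have [e [c [eta [e0 c0 eta0 h]]]] := gap_transversal b1.
have cal : 0 < c * al by rewrite mulr_gt0.
(* As [G >= 1/4] below, the first bound forces [|F x| < e]; the second is the
   smallness required by [product_increment]. *)
pose e' := Num.min (e / 4) (c * al / 8 / 8 / 40).
have e'0 : 0 < e' by rewrite lt_min !divr_gt0.
exists e', (c * al / 8), (eta / 4); split=> //; [by rewrite divr_gt0|by rewrite divr_gt0|].
move=> x x' rx rx' xx v w f.
have [hx hy] := region_ge rx; have [hx' hy'] := region_ge rx'.
have x0 : 0 < x by case/and4P: rx. have x'0 : 0 < x' by case/and4P: rx'.
pose G z := (1 - z) / (1 - yratio al z).
pose F z := gap al^-1 (- (al * ln z)) (map negb w) (map negb v).
have y1 z : region al z -> 0 < 1 - yratio al z.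
  by move=> rz; have [_ /andP[_ h4]] := region_ge rz; lra.
have fE z : region al z -> f z = G z * F z.
  move=> rz; have yz := y1 _ rz; have z0 : 0 < z by case/and4P: rz.
  have yz' : yratio al z < 1 by rewrite -subr_gt0.
  rewrite /f !word_point_lt1// /G /F /gap /=; move: (gt_eqF yz); set u := 1 - yratio al z => u0.
  by field; rewrite u0.
have lnx : `|x' - x| <= `|ln x' - ln x| <= 4 * `|x' - x|.
  by move: hx hx' => /andP[? ?] /andP[? ?]; apply: ln_lip; apply/andP; split; lra.
have /andP[l1 l2] := lnx.
have tt : `|- (al * ln x') - - (al * ln x)| = al * `|ln x' - ln x|.
  by rewrite -opprD normrN -mulrBr normrM gtr0_norm.
have tl : al * `|ln x' - ln x| <= 4 * `|x' - x|.
  by apply: le_trans l2; rewrite ler_piMl// ltW.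
have sm z : region al z -> small_ratios (- (al * ln z)).
  move=> /and4P[z0 zr yr _]; split; last by rewrite opprK.
  by rewrite oppr_gt0 pmulr_rlt0// ln_small.
have xyx : expR (- - (al * ln x)) + expR (- (al^-1 * - (al * ln x))) = yratio al x + x.
  by rewrite opprK mulrN opprK mulKf ?gt_eqF// lnK.
have G1 z : region al z -> 1 / 4 <= G z.
  move=> rz; have [/andP[_ h2] /andP[h3 _]] := region_ge rz.
  by rewrite /G ler_pdivlMr ?y1//; lra.
rewrite !fE// => hf.
have F1 : `|F x| <= 4 * e'.
  have g1 := G1 _ rx; rewrite -ler_pdivrMl//.
  apply: le_trans (ltW hf); rewrite normrM; apply: ler_wpM2r => //.
  by apply: le_trans (le_trans g1 (ler_norm _)); rewrite mul1r.
have F2 : `|F x| < e.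
  apply: lt_le_trans (_ : 4 * e' <= e); last first.
    by rewrite mulrC -ler_pdivlMr// ge_min lexx.
  have g1 := G1 _ rx; rewrite -ltr_pdivrMl//.
  apply: le_lt_trans hf; rewrite normrM; apply: ler_wpM2r => //.
  by apply: le_trans (le_trans g1 (ler_norm _)); rewrite mul1r.
have h1 : c * (al * `|ln x' - ln x|) <= `|F x' - F x|.
  rewrite -tt; apply: (h _ _ (sm _ rx) (sm _ rx') _ _ (map negb w) (map negb v) F2).
    by rewrite xyx addrC; case/and4P: rx.
  by rewrite tt; apply: (le_trans tl); rewrite mulrC -ler_pdivlMr.
apply: (@product_increment _ _ _ _ _ _ e') => //.
- exact: G1.
- apply: factor_lip => //.
  have := expN_lip (L := 1) (t := - (al * ln x)) (t' := - (al * ln x')) ler01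
    (ltW (sm _ rx).1) (ltW (sm _ rx').1).
  by rewrite !mul1r tt !opprK => h2; exact: le_trans h2 tl.
- by apply: le_trans h1; rewrite -mulrA ler_wpM2l ?(ltW c0)// ler_wpM2l// ltW.
- by rewrite ge_min lexx orbT.
Qed.

(** The constants depend on the curve [al] but not on the words. *)
Lemma transversal (al : R) : 0 < al -> exists e c eta : R, [/\ 0 < e, 0 < c, 0 < eta &
  forall x x', region al x -> region al x' -> `|x' - x| <= eta ->
  forall v w, let f z := word_point al z (true :: v) - word_point al z (false :: w) in
   `|f x| < e -> c * `|x' - x| <= `|f x' - f x| ].
Proof.
move=> al0; have [al1|al1] := leP 1 al; first exact: transversal_ge1.
exact: transversal_lt1.
Qed.
End Transversality.

(** * Averages over words and energies *)

Local Open Scope classical_set_scope.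
Local Open Scope ring_scope.

Section Averages.
Variable R : realType.
Implicit Types (p : R) (F G : seq bool -> R).

(** The expectation of [F] over words of length [N] with independent letters that
    are [false] with probability [p]. *)
Fixpoint word_avg p (N : nat) F : R :=
  if N is N'.+1 then p * word_avg p N' (fun w => F (false :: w)) +
    (1 - p) * word_avg p N' (fun w => F (true :: w))
  else F [::].

Lemma word_avg_le p N F G : 0 <= p <= 1 -> (forall w, F w <= G w) -> word_avg p N F <= word_avg p N G.
Proof.
move=> /andP[p0 p1]; elim: N F G => [|N IH] F G FG /=; first exact: FG.
by rewrite lerD// ler_wpM2l ?subr_ge0// IH.
Qed.

Lemma word_avg_cst p N c : word_avg p N (fun=> c) = c.
Proof. by elim: N => //= N ->; ring. Qed.

Lemma word_avg_ge0 p N F : 0 <= p <= 1 -> (forall w, 0 <= F w) -> 0 <= word_avg p N F.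
Proof. by move=> p01 F0; rewrite -(word_avg_cst p N 0); exact: word_avg_le. Qed.

Lemma word_avg_lin p N a b F G :
  word_avg p N (fun w => a * F w + b * G w) = a * word_avg p N F + b * word_avg p N G.
Proof. by elim: N F G => //= N IH F G; rewrite !IH; ring. Qed.

Lemma measurable_word_avg d (T : measurableType d) (p : T -> R) N (F : seq bool -> T -> R) :
  measurable_fun setT p -> (forall w, measurable_fun setT (F w)) ->
  measurable_fun setT (fun z => word_avg (p z) N (F^~ z)).
Proof.
move=> mp; elim: N F => [|N IH] F mF /=; first exact: mF.
apply: measurable_funD; apply: measurable_funM => //; try exact: IH.
exact: measurable_funB.
Qed.

Lemma integral_word_avg_le d (T : measurableType d) (mu : measure T R) (D : set T) p N
    (F : seq bool -> T -> R) (B : seq bool -> R) : measurable D -> 0 <= p <= 1 ->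
  (forall w, measurable_fun setT (F w)) -> (forall w z, 0 <= F w z) ->
  (forall w, (\int[mu]_(z in D) (F w z)%:E <= (B w)%:E)%E) ->
  (\int[mu]_(z in D) (word_avg p N (F^~ z))%:E <= (word_avg p N B)%:E)%E.
Proof.
move=> mD p01; have /andP[p0 p1] := p01; elim: N F B => [|N IH] F B mF F0 FB /=; first exact: FB.
have mW b : measurable_fun setT (fun z => word_avg p N (fun w => F (b :: w) z)).
  by apply: measurable_word_avg.
have W0 b z : 0 <= word_avg p N (fun w => F (b :: w) z) by apply: word_avg_ge0.
under eq_integral do rewrite EFinD !EFinM.
rewrite ge0_integralD//; last 4 first.
- by move=> z _; rewrite -EFinM lee_fin mulr_ge0.
- by apply: measurable_funTS; apply/measurable_EFinP/measurable_funM.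
- by move=> z _; rewrite -EFinM lee_fin mulr_ge0 ?subr_ge0.
- by apply: measurable_funTS; apply/measurable_EFinP/measurable_funM.
rewrite !ge0_integralZl_EFin ?subr_ge0//; try (by move=> z _; rewrite lee_fin);
  try (by apply: measurable_funTS; apply/measurable_EFinP).
rewrite [leRHS]EFinD [X in (_ <= X + _)%E]EFinM [X in (_ <= _ + X)%E]EFinM.
by rewrite leeD// lee_wpmul2l ?lee_fin ?subr_ge0//; apply: IH.
Qed.

End Averages.

Section Energy.
Variable R : realType.
Notation RR := (measurableTypeR R).
Notation mu := (@lebesgue_measure R).

Definition close_pair (al x e : R) (v w : seq bool) : R :=
  if `|word_point al x v - word_point al x w| < e then 1 else 0.
(** The probability that two independent random words of length [N] code points
    at distance less than [e]. *)
Definition energy (p al x : R) (N : nat) (e : R) : R :=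
  word_avg p N (fun v => word_avg p N (fun w => close_pair al x e v w)).

Lemma measurable_word_point w : measurable_fun setT (fun z : RR * RR => word_point z.2 z.1 w).
Proof.
have my : measurable_fun setT (fun z : RR * RR => yratio z.2 z.1).
  apply: measurableT_comp; first exact: measurable_expR.
  apply: measurable_funM => //.
  by apply: measurableT_comp => //; exact: measurable_ln.
elim: w => [|b w IH] /=.
  rewrite /word_point /base_point /=; apply: measurable_fun_ifT => //.
    by apply: measurable_fun_ler.
  apply: measurableT_comp; first exact: measurable_expR.
  apply: measurableT_comp; first exact: oppr_measurable.
  apply: measurableT_comp; first exact: measurable_ln.
  exact: measurable_funB.
case: b; last exact: measurable_funM.
by apply: measurable_funD => //; exact: measurable_funM.
Qed.

Lemma measurable_close_pair e v w : measurable_fun setT (fun z : RR * RR => close_pair z.2 z.1 e v w).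
Proof.
apply: measurable_fun_ifT => //; apply: measurable_fun_ltr => //.
apply: measurableT_comp; first exact: normr_measurable.
by apply: measurable_funB; exact: measurable_word_point.
Qed.

Lemma measurable_close_pair1 al e v w : measurable_fun setT (fun x : RR => close_pair al x e v w).
Proof. exact: (measurable_fun_pair1 al (measurable_close_pair e v w)). Qed.

Lemma close_pair_ge0 al x e v w : 0 <= close_pair al x e v w.
Proof. by rewrite /close_pair; case: ifP. Qed.

Lemma measurable_energy (p : RR -> R) N e : measurable_fun setT p ->
  measurable_fun setT (fun z : RR * RR => energy (p z.2) z.2 z.1 N e).
Proof.
move=> mp; have mp2 : measurable_fun setT (fun z : RR * RR => p z.2) by exact: measurableT_comp.
apply: (@measurable_word_avg R _ _ (fun z : RR * RR => p z.2) N (fun v z => word_avg (p z.2) N (fun w => close_pair z.2 z.1 e v w))) => // v.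
by apply: (@measurable_word_avg R _ _ (fun z : RR * RR => p z.2) N (fun w z => close_pair z.2 z.1 e v w)) => // w; exact: measurable_close_pair.
Qed.

Lemma measurable_energy1 p al N e : measurable_fun setT (fun x : RR => energy p al x N e).
Proof.
apply: (@measurable_word_avg R _ _ (fun=> p) N (fun v (x : RR) => word_avg p N (fun w => close_pair al x e v w))) => // v.
by apply: (@measurable_word_avg R _ _ (fun=> p) N (fun w (x : RR) => close_pair al x e v w)) => // w; exact: measurable_close_pair1.
Qed.

Lemma energy_ge0 p al x N e : 0 <= p <= 1 -> 0 <= energy p al x N e.
Proof. by move=> p01; do 2 (apply: word_avg_ge0 => // ?); exact: close_pair_ge0. Qed.

Lemma close_pair_sym al x e v w : close_pair al x e v w = close_pair al x e w v.
Proof. by rewrite /close_pair distrC. Qed.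

(** Removing a common first letter divides the distance by its ratio. *)
Lemma close_pair_scale (al x c e : R) v w (b : bool) : 0 < c -> c <= (if b then yratio al x else x) ->
  close_pair al x e (b :: v) (b :: w) <= close_pair al x (e / c) v w.
Proof.
move=> c0 cx; rewrite /close_pair; case: ifP => h; case: ifP => // /negP h'; exfalso; apply: h'.
rewrite ltr_pdivlMr//; apply: le_lt_trans h.
have -> : word_point al x (b :: v) - word_point al x (b :: w) = (if b then yratio al x else x) * (word_point al x v - word_point al x w).
  by rewrite /=; case: (b); ring.
rewrite normrM mulrC ler_wpM2r//; apply: le_trans cx _; exact: ler_norm.
Qed.

End Energy.

(** * Integrals of energies over a short interval *)

Section EnergyBound.
Variable R : realType.
Notation RR := (measurableTypeR R).
Notation mu := (@lebesgue_measure R).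

Lemma integral_lin_le d (T : measurableType d) (m : measure T R) (D : set T)
    (a b A B : R) (f g : T -> R) : measurable D -> 0 <= a -> 0 <= b ->
  measurable_fun setT f -> measurable_fun setT g ->
  (forall z, 0 <= f z) -> (forall z, 0 <= g z) ->
  (\int[m]_(z in D) (f z)%:E <= A%:E)%E -> (\int[m]_(z in D) (g z)%:E <= B%:E)%E ->
  (\int[m]_(z in D) (a * f z + b * g z)%:E <= (a * A + b * B)%:E)%E.
Proof.
move=> mD a0 b0 mf mg f0 g0 fA gB.
under eq_integral do rewrite EFinD !EFinM.
rewrite ge0_integralD//; last 4 first.
- by move=> z _; rewrite -EFinM lee_fin mulr_ge0.
- by apply: measurable_funTS; apply/measurable_EFinP/measurable_funM.
- by move=> z _; rewrite -EFinM lee_fin mulr_ge0.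
- by apply: measurable_funTS; apply/measurable_EFinP/measurable_funM.
rewrite !ge0_integralZl_EFin//; try (by move=> z _; rewrite lee_fin);
  try (by apply: measurable_funTS; apply/measurable_EFinP).
by rewrite EFinD !EFinM leeD// lee_wpmul2l ?lee_fin.
Qed.

Section Window.
Variables (al e0 c eta : R) (J : set R).
Hypotheses (e00 : 0 < e0) (c0 : 0 < c) (eta0 : 0 < eta).
Hypothesis transv : forall x x', region al x -> region al x' -> `|x' - x| <= eta ->
  forall v w, let f z := word_point al z (true :: v) - word_point al z (false :: w) in
   `|f x| < e0 -> c * `|x' - x| <= `|f x' - f x|.
Hypotheses (mJ : measurable (J : set RR)) (Jr : forall x, J x -> region al x)
  (Jd : forall x x', J x -> J x' -> `|x' - x| <= eta).

Let C : R := 2 * (2 / c + eta / e0).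

Lemma cross_const_ge0 : 0 <= C.
Proof. by rewrite mulr_ge0// addr_ge0// divr_ge0// ltW. Qed.

(** If [x0] is one parameter in [J] at which the points are [e]-close, all others
    lie within distance [2 e / c] of it by transversality.  For [e >= e0], where
    that does not apply, the length of [J] suffices: [eta <= (eta / e0) e]. *)
Lemma integral_cross e v w : 0 <= e ->
  (\int[mu]_(x in J) (close_pair al x e (true :: v) (false :: w))%:E <= (C * e)%:E)%E.
Proof.
move=> e_ge0; pose f z := word_point al z (true :: v) - word_point al z (false :: w).
have Ce : 0 <= C * e by rewrite mulr_ge0// cross_const_ge0.
have [[x0 [Jx0 fx0]]|no] := pselect (exists x, J x /\ `|f x| < e); last first.
  rewrite integral0_eq ?lee_fin// => x Jx; rewrite /close_pair ifF//.
  by apply/negP => h; apply: no; exists x.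
pose r := (2 / c + eta / e0) * e.
have r0 : 0 <= r by rewrite mulr_ge0// addr_ge0// divr_ge0// ltW.
have near0 x : J x -> `|f x| < e -> `|x - x0| <= r.
  move=> Jx fx; have [ee|ee] := ltP e e0.
    have h := transv (Jr Jx0) (Jr Jx) (Jd Jx0 Jx) (v := v) (w := w) (lt_trans fx0 ee).
    have h2 : `|f x - f x0| <= 2 * e.
      by apply: (le_trans (ler_normB _ _)); rewrite mulr2n mulrDl mul1r lerD// ltW.
    have h3 : `|x - x0| <= 2 / c * e.
      rewrite mulrAC ler_pdivlMr// mulrC; exact: le_trans h h2.
    by apply: (le_trans h3); rewrite /r (mulrDl (2 / c)) lerDl mulr_ge0// divr_ge0// ltW.
  have h := Jd Jx0 Jx; apply: (le_trans h).
  rewrite /r (mulrDl (2 / c)); apply: (@le_trans _ _ (eta / e0 * e)); last first.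
    by rewrite lerDr mulr_ge0// divr_ge0// ltW.
  by rewrite mulrAC ler_pdivlMr// ler_wpM2l// ltW.
pose I : set RR := [set` `[x0 - r, x0 + r]%R].
have mI : measurable I by exact: measurable_itv.
apply: (@le_trans _ _ (\int[mu]_(x in J) (\1_I x)%:E)%E).
  apply: ge0_le_integral => //.
  - by move=> x _; rewrite lee_fin close_pair_ge0.
  - apply: measurable_funTS; apply/measurable_EFinP; exact: measurable_close_pair1.
  - by apply/measurable_EFinP; exact: measurable_indic.
  - move=> x Jx; rewrite lee_fin /close_pair; case: ifP => // /(near0 _ Jx).
    by rewrite ler_distl => h; rewrite indicE mem_set//= /I /= in_itv /=.
rewrite integral_indic//; apply: (@le_trans _ _ (mu I)).
  apply: le_measure; rewrite ?inE//; exact: measurableI.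
rewrite lebesgue_measure_itv /= lte_fin; case: ifP => _; last by rewrite lee_fin.
rewrite -EFinB lee_fin /C /r; lra.
Qed.

Variables (p ell cx cy : R).
Hypotheses (p01 : 0 <= p <= 1) (Jell : (mu J <= ell%:E)%E) (ell0 : 0 <= ell).
Hypotheses (cx0 : 0 < cx) (cy0 : 0 < cy).
Hypotheses (Jx : forall x, J x -> cx <= x) (Jy : forall x, J x -> cy <= yratio al x).
Let th : R := p ^+ 2 / cx + (1 - p) ^+ 2 / cy.
Hypothesis th1 : th < 1.

Let cross b x N e := word_avg p N (fun v => word_avg p N (fun w => close_pair al x e (b :: v) (~~ b :: w))).

Lemma measurable_cross b N e : measurable_fun setT (fun x : RR => cross b x N e).
Proof.
apply: (@measurable_word_avg R _ _ (fun=> p) N (fun v (x : RR) => word_avg p N (fun w => close_pair al x e (b :: v) (~~ b :: w)))) => // v.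
by apply: (@measurable_word_avg R _ _ (fun=> p) N (fun w (x : RR) => close_pair al x e (b :: v) (~~ b :: w))) => // w; exact: measurable_close_pair1.
Qed.

Lemma cross_ge0 b x N e : 0 <= cross b x N e.
Proof. by do 2 (apply: word_avg_ge0 => // ?); exact: close_pair_ge0. Qed.

Lemma integral_crossN b N e : 0 <= e -> (\int[mu]_(x in J) (cross b x N e)%:E <= (C * e)%:E)%E.
Proof.
move=> e_ge0; rewrite -(word_avg_cst p N (C * e)).
apply: (@integral_word_avg_le R _ RR mu J p N (fun v (x : RR) => word_avg p N (fun w => close_pair al x e (b :: v) (~~ b :: w)))) => //.
- move=> v; apply: (@measurable_word_avg R _ _ (fun=> p) N (fun w (x : RR) => close_pair al x e (b :: v) (~~ b :: w))) => // w; exact: measurable_close_pair1.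
- by move=> v z; apply: word_avg_ge0 => // w; exact: close_pair_ge0.
move=> v; rewrite -(word_avg_cst p N (C * e)); apply: (@integral_word_avg_le R _ RR mu J p N (fun w (x : RR) => close_pair al x e (b :: v) (~~ b :: w))) => //.
- by move=> w; exact: measurable_close_pair1.
- by move=> w z; exact: close_pair_ge0.
move=> w; case: b => /=; first exact: integral_cross.
under eq_integral do rewrite close_pair_sym.
exact: integral_cross.
Qed.

Lemma energy_step x N e : J x ->
  energy p al x N.+1 e <=
  1 * (p ^+ 2 * energy p al x N (e / cx) + (1 - p) ^+ 2 * energy p al x N (e / cy)) +
  1 * (p * (1 - p) * cross false x N e + (1 - p) * p * cross true x N e).
Proof.
move=> Jx'; rewrite /energy /= !word_avg_lin.
have /andP[p0 p1] := p01; have q0 : 0 <= 1 - p by rewrite subr_ge0.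
set a1 := word_avg p N (fun v => word_avg p N (fun w => close_pair al x e (false :: v) (false :: w))).
set a2 := word_avg p N (fun v => word_avg p N (fun w => close_pair al x e (true :: v) (true :: w))).
have h1 : a1 <= word_avg p N (fun v => word_avg p N (close_pair al x (e / cx) v)).
  by do 2 (apply: word_avg_le => // ?); apply: close_pair_scale => //; exact: Jx.
have h2 : a2 <= word_avg p N (fun v => word_avg p N (close_pair al x (e / cy) v)).
  by do 2 (apply: word_avg_le => // ?); apply: close_pair_scale => //; exact: Jy.
have h3 := ler_wpM2l (sqr_ge0 p) h1; have h4 := ler_wpM2l (sqr_ge0 (1 - p)) h2.
rewrite /cross /=; lra.
Qed.

Let K : R := C / (1 - th).

Lemma energy_const_ge0 : 0 <= K. Proof. by rewrite divr_ge0 ?cross_const_ge0// subr_ge0 ltW. Qed.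

(** Let [A N e] be the bound.  By [energy_step],
    [A (N + 1) e <= p ^ 2 A N (e / cx) + (1 - p) ^ 2 A N (e / cy) + C e].  The part
    linear in [e] is multiplied by [th < 1] at each step, and the part that is
    constant in [e] by [p ^ 2 + (1 - p) ^ 2]. *)
Lemma integral_energy N e : 0 <= e ->
  (\int[mu]_(x in J) (energy p al x N e)%:E <=
     (K * e + ell * (p ^+ 2 + (1 - p) ^+ 2) ^+ N)%:E)%E.
Proof.
have /andP[p0 p1] := p01; have q0 : 0 <= 1 - p by rewrite subr_ge0.
elim: N e => [|N IH] e e_ge0.
  apply: (@le_trans _ _ (\int[mu]_(x in J) (cst 1%:E x))%E).
    apply: ge0_le_integral => //.
    - by move=> x _; rewrite lee_fin close_pair_ge0.
    - apply: measurable_funTS; apply/measurable_EFinP; exact: measurable_energy1.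
    - by move=> x _; rewrite lee_fin /energy /= /close_pair; case: ifP.
  rewrite integral_cst// mul1e expr0 mulr1; apply: (le_trans Jell).
  by rewrite lee_fin lerDr mulr_ge0// energy_const_ge0.
set m := p ^+ 2 + _ in IH *.
have mE N' e' : measurable_fun setT (fun x : RR => energy p al x N' e') by exact: measurable_energy1.
have mC b : measurable_fun setT (fun x : RR => cross b x N e) by exact: measurable_cross.
pose g1 x := p ^+ 2 * energy p al x N (e / cx) + (1 - p) ^+ 2 * energy p al x N (e / cy).
pose g2 x := p * (1 - p) * cross false x N e + (1 - p) * p * cross true x N e.
have mg1 : measurable_fun setT (g1 : RR -> R).
  by apply: measurable_funD; apply: measurable_funM.
have mg2 : measurable_fun setT (g2 : RR -> R).
  by apply: measurable_funD; apply: measurable_funM.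
have E0 N' x e' : 0 <= energy p al x N' e' by exact: energy_ge0.
have g10 x : 0 <= g1 x by rewrite addr_ge0// mulr_ge0// sqr_ge0.
have g20 x : 0 <= g2 x by rewrite addr_ge0// mulr_ge0 ?mulr_ge0 ?cross_ge0.
apply: (@le_trans _ _ (\int[mu]_(x in J) (1 * g1 x + 1 * g2 x)%:E)%E).
  apply: ge0_le_integral => //.
  - by move=> x _; rewrite lee_fin.
  - by apply: measurable_funTS; apply/measurable_EFinP.
  - by apply: measurable_funTS; apply/measurable_EFinP; apply: measurable_funD; apply: measurable_funM.
  - by move=> x Jx'; rewrite lee_fin; exact: energy_step.
have i1 := IH _ (divr_ge0 e_ge0 (ltW cx0)); have i2 := IH _ (divr_ge0 e_ge0 (ltW cy0)).
have I1 := integral_lin_le mJ (sqr_ge0 p) (sqr_ge0 (1 - p)) (mE _ _) (mE _ _) (E0 _^~ _) (E0 _^~ _) i1 i2.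
have I2 := integral_lin_le mJ (mulr_ge0 p0 q0) (mulr_ge0 q0 p0) (mC false) (mC true)
  (cross_ge0 _ ^~ _ ^~ _) (cross_ge0 _ ^~ _ ^~ _) (integral_crossN false N e_ge0) (integral_crossN true N e_ge0).
have I3 := integral_lin_le mJ ler01 ler01 mg1 mg2 g10 g20 I1 I2.
apply: (le_trans I3); rewrite lee_fin !mul1r.
have h1 : p ^+ 2 * (K * (e / cx) + ell * m ^+ N) + (1 - p) ^+ 2 * (K * (e / cy) + ell * m ^+ N) =
   K * th * e + ell * m ^+ N.+1 by rewrite [m ^+ N.+1]exprS; move: (m ^+ N) => mN; rewrite /th /m; ring.
rewrite h1.
have h2 : (p * (1 - p)) * (C * e) + (1 - p) * p * (C * e) <= C * e.
  have hq : p * (1 - p) + (1 - p) * p <= 1.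
    by have := sqr_ge0 p; have := sqr_ge0 (1 - p); rewrite !expr2 => ? ?; lra.
  by have := ler_wpM2r (mulr_ge0 cross_const_ge0 e_ge0) hq; rewrite mul1r mulrDl.
have h3 : C = K * (1 - th) by rewrite /K divfK// subr_eq0 eq_sym lt_eqF.
have h4 : C * e = K * e - K * th * e by rewrite {1}h3; ring.
by rewrite h4 in h2 *; lra.
Qed.

End Window.
End EnergyBound.

(** * Parameters with divergent correlations *)

Section Null.
Variable R : realType.
Notation RR := (measurableTypeR R).
Notation mu := (@lebesgue_measure R).

Lemma limn_einf_le (u : (\bar R)^nat) (c : \bar R) : (forall n, (u n <= c)%E) -> (limn_einf u <= c)%E.
Proof.
move=> uc; apply: (le_trans (limn_einf_sup u)); rewrite /limn_esup limf_esupE.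
apply: (@le_trans _ _ (ereal_sup [set u n | n in setT])).
  by apply: ereal_inf_lbound; exists setT => //; exact: filterT.
by apply: ge_ereal_sup => _ [n _ <-].
Qed.

(** By Fatou's lemma the integral of the infinite lower limit over [D] is at most
    [c]. *)
Lemma null_of_bounded_integrals d (T : measurableType d) (m : measure T R) (D : set T)
    (f : nat -> T -> R) (c : R) : measurable D ->
  (forall n, measurable_fun setT (f n)) -> (forall n x, 0 <= f n x) ->
  (forall n, (\int[m]_(x in D) (f n x)%:E <= c%:E)%E) ->
  (forall x, D x -> forall k : nat, exists n0 : nat, forall n, (n0 <= n)%nat -> k%:R < f n x) ->
  m D = 0%E.
Proof.
move=> mD mf f0 fc Doo.
have mf' n : measurable_fun D (fun x => (f n x)%:E).
  by apply: measurable_funTS; apply/measurable_EFinP.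
have f0' n x : D x -> (0 <= (f n x)%:E)%E by rewrite lee_fin.
have : (\int[m]_(x in D) limn_einf (fun n => (f n x)%:E) <= c%:E)%E.
  apply: le_trans (fatou m mD mf' f0') _; exact: limn_einf_le.
rewrite (eq_integral (cst +oo%E)); last first.
  move=> x; rewrite inE => Dx; apply: (cvg_limn_einf_sup _).1.
  apply/cvgeyPge => A.
  have [n0 hn] := Doo x Dx (Num.truncn `|A|).+1.
  exists n0 => // n /= n0n; rewrite lee_fin; apply: le_trans (ltW (hn n n0n)).
  by apply: (le_trans (ler_norm A)); rewrite ltW// truncnS_gt.
rewrite integral_cst//.
have [->//|m0] := eqVneq (m D) 0%E.
by rewrite gt0_mulye ?leye_eq// lt0e m0 measure_ge0.
Qed.

(** The solution [q] of [q + q ^ al = 1], written as a supremum in order to be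
    monotone in [al], hence measurable. *)
Definition weight (al : R) : R :=
  sup [set q : R | 0 <= q <= 1 /\ q + expR (al * ln q) <= 1].

Lemma weight_set (al : R) : has_sup [set q : R | 0 <= q <= 1 /\ q + expR (al * ln q) <= 1].
Proof.
split; last by exists 1 => q [/andP[]].
by exists 0; rewrite /= lexx ler01 ln0// mulr0 expR0 add0r.
Qed.

Lemma weight01 al : 0 <= weight al <= 1.
Proof.
apply/andP; split.
  by apply: sup_upper_bound (weight_set al) _ _; rewrite /= lexx ler01 ln0// mulr0 expR0 add0r.
by apply: sup_le_ub; [exact: (weight_set al).1|move=> q [/andP[]]].
Qed.

Lemma measurable_weight : measurable_fun setT (weight : RR -> R).
Proof.
apply: nondecreasing_measurable => // a b ab.
apply: le_sup; [|exact: (weight_set a).1|exact: weight_set].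
move=> q [q01 hq]; exists q; split => //; split => //; have /andP[q0 q1] := q01.
by apply: le_trans hq; rewrite lerD2l ler_expR ler_wnM2r// ln_le0.
Qed.

Lemma weightE al q : 0 < al -> 0 < q < 1 -> q + expR (al * ln q) = 1 -> weight al = q.
Proof.
move=> al0 /andP[q0 q1] hq; apply/eqP; rewrite eq_le; apply/andP; split; last first.
  by apply: sup_upper_bound (weight_set al) _ _; rewrite /= ltW// ltW// hq.
apply: sup_le_ub; first exact: (weight_set al).1.
move=> r [/andP[r0 r1] hr]; rewrite leNgt; apply/negP => qr.
have r00 : 0 < r by exact: lt_trans qr.
have : expR (al * ln q) < expR (al * ln r) by rewrite ltr_expR ltr_pM2l// ltr_ln.
lra.
Qed.

(** The scale [2 ^ -n] is reached by words of length [2 n + 4], as the ratios are at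
    most 0.668 and [0.668 ^ 2 < 1 / 2]. *)
Definition correlation (n : nat) (al x : R) : R :=
  2 ^+ n * energy (weight al) al x (2 * n + 4) (4 / 2 ^+ n).

Lemma measurable_correlation n : measurable_fun setT (fun z : RR * RR => correlation n z.2 z.1).
Proof. by apply: measurable_funM => //; apply: measurable_energy; exact: measurable_weight. Qed.

Lemma measurable_correlation1 n al : measurable_fun setT (fun x : RR => correlation n al x).
Proof. exact: (measurable_fun_pair1 al (measurable_correlation n)). Qed.

Lemma correlation_ge0 n al x : 0 <= correlation n al x.
Proof. by rewrite mulr_ge0// energy_ge0// weight01. Qed.

Definition correlation_diverges (al x : R) := forall k : nat, exists n0 : nat, forall n, (n0 <= n)%nat -> k%:R < correlation n al x.

Definition consistent_weight al := 0 < weight al /\ weight al + expR (al * ln (weight al)) = 1.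

(** The first component of a pair is [x], the second is the exponent [al]. *)
Definition bad_params : set (RR * RR) :=
  [set z | [/\ 0 < z.2, region z.2 z.1, consistent_weight z.2 & correlation_diverges z.2 z.1]].

Lemma measurable_region : measurable_fun setT (fun z : RR * RR => region z.2 z.1).
Proof.
have my : measurable_fun setT (fun z : RR * RR => yratio z.2 z.1).
  apply: measurableT_comp; first exact: measurable_expR.
  apply: measurable_funM => //.
  by apply: measurableT_comp => //; exact: measurable_ln.
rewrite /region; apply: measurable_and; first exact: measurable_fun_ltr.
apply: measurable_and; first exact: measurable_fun_ler.
apply: measurable_and; first exact: measurable_fun_ler.
by apply: measurable_fun_ltr => //; exact: measurable_funD.
Qed.

Lemma measurable_correlation_diverges : measurable ([set z | correlation_diverges z.2 z.1] : set (RR * RR)).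
Proof.
have -> : [set z : RR * RR | correlation_diverges z.2 z.1] =
  \bigcap_k \bigcup_n0 \bigcap_(n in [set n | (n0 <= n)%nat]) [set z | k%:R < correlation n z.2 z.1].
  by apply/seteqP; split => z h k => [_|];
   [have [n0 hn] := h k; exists n0 => // n; exact: hn|have [n0 _ hn] := h k I; exists n0 => n; exact: hn].
apply: bigcapT_measurable => k; apply: bigcupT_measurable => n0.
apply: bigcap_measurableType => n _.
rewrite -[X in measurable X]setTI.
have := @measurable_fun_ltr _ _ R setT (cst k%:R) _ (measurable_cst _) (measurable_correlation n).
by move=> /(_ measurableT [set true] I); rewrite /preimage /= => h; exact: h.
Qed.

Lemma measurable_bad_params : measurable bad_params.
Proof.
have bset (f : RR * RR -> bool) : measurable_fun setT f -> measurable [set z | f z].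
  by move=> mf; rewrite -[X in measurable X]setTI; exact: (mf measurableT [set true] I).
have mw : measurable_fun setT (fun z : RR * RR => weight z.2).
  by apply: measurableT_comp => //; exact: measurable_weight.
have -> : bad_params = [set z | 0 < z.2] `&` [set z | region z.2 z.1] `&` [set z | 0 < weight z.2] `&`
   [set z | weight z.2 + expR (z.2 * ln (weight z.2)) == 1] `&` [set z | correlation_diverges z.2 z.1].
  apply/seteqP; split => z /=; first by case=> ? ? [? /eqP ?] ?.
  by case=> -[[[? ?] ?] /eqP ?] ?.
apply: measurableI; last exact: measurable_correlation_diverges.
apply: measurableI.
  apply: measurableI; last by apply: bset; exact: measurable_fun_ltr.
  apply: measurableI; apply: bset; first exact: measurable_fun_ltr.
  exact: measurable_region.
apply: bset; apply: measurable_fun_eqr => //.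
apply: measurable_funD => //; apply: measurableT_comp; first exact: measurable_expR.
apply: measurable_funM => //.
by apply: measurableT_comp => //; exact: measurable_ln.
Qed.

End Null.

Section AlmostEverywhere.
Variable R : realType.
Notation RR := (measurableTypeR R).
Notation mu := (@lebesgue_measure R).
Let rho : R := 668%:R / 1000%:R.

(** The sum of the squares is at most 3/5, and [2 (3 / 5) ^ 2 < 1]: the
    contribution of equal words of length [2 n + 4] decays faster than
    [2 ^ -n]. *)
Lemma sumsq_bound (p : R) : p <= rho -> 1 - p <= rho ->
  0 <= p ^+ 2 + (1 - p) ^+ 2 <= 1 /\ 2 * (p ^+ 2 + (1 - p) ^+ 2) ^+ 2 <= 1.
Proof.
rewrite /rho => p1 p2; set m := _ + _.
have m0 : 0 <= m by rewrite addr_ge0// sqr_ge0.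
have m1 : m <= 3 / 5.
  have : 0 <= (668%:R / 1000%:R - p) * (668%:R / 1000%:R - (1 - p)) :> R by rewrite mulr_ge0 ?subr_ge0.
  rewrite /m; lra.
split; first by rewrite m0 /=; lra.
by clear -m0 m1; rewrite expr2; nra.
Qed.

(** A lower bound [cx > p] for [x] on [J] gives [cy = cx ^ al > 1 - p] for [y], and
    [p ^ 2 / cx + (1 - p) ^ 2 / cy < p + (1 - p)]. *)
Lemma integral_correlation (al p cx e0 c eta : R) (J : set RR) : 0 < al ->
  0 < p -> weight al = p -> p + expR (al * ln p) = 1 -> p < cx ->
  0 < e0 -> 0 < c -> 0 < eta ->
  (forall x x', region al x -> region al x' -> `|x' - x| <= eta ->
   forall v w, let f z := word_point al z (true :: v) - word_point al z (false :: w) in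
   `|f x| < e0 -> c * `|x' - x| <= `|f x' - f x|) ->
  measurable J -> (forall x, J x -> region al x /\ cx <= x) ->
  (forall x x', J x -> J x' -> `|x' - x| <= eta) ->
  exists B : R, forall n, (\int[mu]_(x in J) (correlation n al x)%:E <= B%:E)%E.
Proof.
move=> al0 p0 wp hp pcx e00 c0 eta0 tr mJ Jr Jd.
have [->|/set0P[x1 Jx1]] := eqVneq J set0.
  by exists 0 => n; rewrite integral_set0.
have qE : 1 - p = expR (al * ln p) by rewrite -hp addrC addKr.
have cx0 : 0 < cx by exact: lt_trans pcx.
have mono a b : 0 < a -> a <= b -> expR (al * ln a) <= expR (al * ln b).
  by move=> a0 ab; rewrite ler_expR ler_pM2l// ler_ln// posrE (lt_le_trans a0).
pose cy := expR (al * ln cx).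
have cy0 : 0 < cy by exact: expR_gt0.
have qcy : 1 - p < cy by rewrite qE ltr_expR ltr_pM2l// ltr_ln.
have q0 : 0 < 1 - p by rewrite qE expR_gt0.
have p01 : 0 <= p <= 1 by rewrite ltW//= -subr_ge0 ltW.
have Jx x : J x -> cx <= x by move=> /Jr[].
have Jy x : J x -> cy <= yratio al x by move=> /Jr[_ h]; exact: mono.
have [/and4P[_ x1r y1r _] cx1] := Jr _ Jx1.
have pr : p <= rho by apply: le_trans x1r; apply: le_trans cx1; exact: ltW.
have qr : 1 - p <= rho by apply: le_trans y1r; apply: le_trans (Jy _ Jx1); exact: ltW.
have [/andP[m0 m1] m2] := sumsq_bound pr qr.
have th1 : p ^+ 2 / cx + (1 - p) ^+ 2 / cy < 1.
  have h1 : p ^+ 2 / cx < p by rewrite expr2 ltr_pdivrMr// ltr_pM2l.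
  have h2 : (1 - p) ^+ 2 / cy < 1 - p by rewrite expr2 ltr_pdivrMr// ltr_pM2l.
  by have := ltrD h1 h2; rewrite [X in _ < X]addrC subrK.
have J1 : (mu J <= 1%:E)%E.
  apply: (@le_trans _ _ (mu ([set` `[0%R, 1%R]] : set RR))).
    apply: le_measure; [by rewrite inE|by rewrite inE; exact: measurable_itv|].
    move=> x /Jr[/region_ge[/andP[h1 h2] _] _] /=; rewrite in_itv /=.
    by apply/andP; split; lra.
  by rewrite lebesgue_measure_itv /= lte_fin ltr01 -EFinB subr0.
have KE := integral_energy e00 c0 eta0 tr mJ (fun x Jx => (Jr x Jx).1) Jd p01 J1 cx0 cy0 Jx Jy th1.
move: KE; set K := _ / (1 - _) => KE.
exists (K * 4 + 1) => n; rewrite /correlation wp.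
have n0 : 0 < 2 ^+ n :> R by rewrite exprn_gt0.
under eq_integral do rewrite EFinM.
rewrite ge0_integralZl_EFin//; last 2 first.
- by move=> x _; rewrite lee_fin energy_ge0.
- by apply: measurable_funTS; apply/measurable_EFinP; exact: measurable_energy1.
have := KE (2 * n + 4)%nat (4 / 2 ^+ n) (divr_ge0 (ler0n _ _) (ltW n0)).
move=> /(lee_wpmul2l (_ : (0 <= (2 ^+ n)%:E)%E)) h; apply: le_trans (h _) _.
  by rewrite lee_fin ltW.
rewrite -EFinM lee_fin mulrDr mul1r mulrCA mulrCA [X in X + _](_ : _ = K * 4); last first.
  by field; rewrite gt_eqF.
rewrite lerD2l exprD exprM mulrA -exprMn.
have e1 : (2 * (p ^+ 2 + (1 - p) ^+ 2) ^+ 2) ^+ n <= 1.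
  by apply: exprn_ile1 => //; rewrite mulr_ge0// exprn_ge0.
have e2 : (p ^+ 2 + (1 - p) ^+ 2) ^+ 4 <= 1 by apply: exprn_ile1.
rewrite -[leRHS]mulr1; apply: ler_pM => //; rewrite ?exprn_ge0// mulr_ge0// exprn_ge0//.
Qed.

(** The curve is cut into countably many intervals of length at most [eta] on which
    [x] exceeds [p] by at least [1 / (k + 1)]. *)
Lemma bad_params_section_null (al : R) : mu [set x : RR | bad_params (x, al)] = 0%E.
Proof.
have mb : measurable [set x : RR | bad_params (x, al)].
  rewrite -[X in measurable X]setTI.
  exact: (pair2_measurable al measurableT (@measurable_bad_params R)).
have [al0|al0] := ltP 0 al; last first.
  rewrite (_ : [set _ | _] = set0) ?measure0//.
  by apply/seteqP; split => x // -[/= h]; rewrite ltNge al0 in h.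
have [[p0 hp]|nw] := pselect (consistent_weight al); last first.
  rewrite (_ : [set _ | _] = set0) ?measure0//.
  by apply/seteqP; split => x // -[/= _ _ h]; exfalso.
set p := weight al in p0 hp.
have [e0 [c [eta [e00 c0 eta0 tr]]]] := transversal al0.
pose J (k i : nat) := [set x : RR | bad_params (x, al)] `&`
  [set x | p + k.+1%:R^-1 <= x] `&` [set` `[i%:R * eta, i.+1%:R * eta]%R].
have mJ k i : measurable (J k i).
  apply: measurableI; last exact: measurable_itv.
  apply: measurableI => //.
  by rewrite (_ : [set x | _] = [set` `[p + k.+1%:R^-1, +oo[%R]); [exact: measurable_itv|
     by apply/seteqP; split=> x /=; rewrite in_itv /= andbT].
have J0 k i : mu (J k i) = 0%E.
  have pk : p < p + k.+1%:R^-1 by rewrite ltrDl invr_gt0.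
  have [||B hB] := @integral_correlation al p _ e0 c eta (J k i) al0 p0 erefl hp pk e00 c0 eta0 tr (mJ k i).
  - by move=> x [[[/= _ rx _ _] /= px] _].
  - move=> x x' [_ /=]; rewrite in_itv /= => /andP[h1 h2] [_ /=]; rewrite in_itv /= => /andP[h3 h4].
    by rewrite ler_distl; move: h1 h2 h3 h4; rewrite -natr1 mulrDl mul1r => *; apply/andP; split; lra.
  apply: (@null_of_bounded_integrals R _ RR mu (J k i) (fun n (x : RR) => correlation n al x) B) => //.
  - by move=> n; exact: measurable_correlation1.
  - by move=> n x; exact: correlation_ge0.
  - by move=> x [[[/= _ _ _ dx] _] _].
have sub : [set x : RR | bad_params (x, al)] `<=` \bigcup_k \bigcup_i J k i.
  move=> x bx; have [/= _ rx _ _] := bx.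
  have /andP[x1 _] := (region_ge rx).1.
  have x0 : 0 < x by lra.
  have px : p < x.
    rewrite ltNge; apply/negP => xp.
    case/and4P : rx => _ _ _; rewrite -[X in X < _]hp ltNge => /negP; apply.
    by rewrite lerD// ler_expR ler_pM2l// ler_ln.
  pose k := (Num.truncn (x - p)^-1).
  exists k => //; exists (Num.truncn (x / eta)) => //; split.
    split => //=; rewrite addrC -lerBrDr -[leRHS]invrK lef_pV2 ?posrE ?ltr0n ?invr_gt0 ?subr_gt0//.
    by rewrite ltW// truncnS_gt.
  have /andP[h1 h2] := truncn_itv (divr_ge0 (ltW x0) (ltW eta0)).
  by rewrite /= in_itv /=; apply/andP; split; [rewrite -ler_pdivlMr|rewrite -ler_pdivrMr// ltW].
apply: measure_negligible => //; apply: negligibleS sub _.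
apply: negligible_bigcup => k; apply: negligible_bigcup => i.
by exists (J k i); split; [exact: mJ|exact: J0|].
Qed.

End AlmostEverywhere.

(** * From curves to the plane *)

Section LipschitzNull.
Variable R : realType.
Notation RR := (measurableTypeR R).
Notation mu := (@lebesgue_measure R).

(** A cover of [N] by intervals of small total length gives a cover of the image
    by intervals at most [2 L] times as long. *)
Lemma lipschitz_null (N A : set RR) (g : R -> R) (L : R) : 0 <= L -> mu N = 0%E ->
  (forall a b, N a -> N b -> `|g a - g b| <= L * `|a - b|) ->
  A `<=` g @` N -> measurable A -> mu A = 0%E.
Proof.
move=> L0 N0 gL AN mA; apply/eqP; rewrite eq_le measure_ge0 andbT.
apply/lee_addgt0Pr => e e0; rewrite add0e.
pose e' := e / (2 * L + 1).
have e'0 : 0 < e' by rewrite divr_gt0// ltr_wpDl// mulr_ge0.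
have /ereal_inf_lt[z [/= M' covN sMz ze]] : (mu N < e'%:E)%E by rewrite N0 lte_fin.
pose w n : \bar R := wlength idfun (M' n).
have ocM n : ocitv (M' n) by case: covN => /(_ n).
have w0 n : (0 <= w n)%E by exact: wlength_ge0.
pose I n : set RR := if pselect (exists a, N a /\ M' n a) is left h
  then [set` `[g (projT1 (cid h)) - L * fine (w n), g (projT1 (cid h)) + L * fine (w n)]%R] else set0.
have wfin n : w n \is a fin_num.
  rewrite /w; have /ocitvP[->|[[a b] /= ab ->]] := ocM n; first by rewrite wlength0.
  by rewrite (wlength_itv_bnd _ _ _ (ltW ab)).
have mI n : measurable (I n).
  by rewrite /I; case: pselect => h //; exact: measurable_itv.
have muI n : (mu (I n) <= (2 * L)%:E * w n)%E.
  rewrite /I; case: pselect => h; last by rewrite measure0 mule_ge0// lee_fin mulr_ge0.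
  rewrite lebesgue_measure_itv /= lte_fin -(fineK (wfin n)) -EFinM.
  case: ifP => _; last by rewrite lee_fin mulr_ge0 ?mulr_ge0// fine_ge0.
  by rewrite -EFinB lee_fin; lra.
have cov : A `<=` \bigcup_n I n.
  move=> y /AN[a Na <-]; have [_ /(_ _ Na)[n _ Mna]] := covN.
  exists n => //; rewrite /I; case: pselect => [h|[]]; last by exists a.
  case: cid => b /= [Nb Mnb]; rewrite /= in_itv /=.
  have : `|a - b| <= fine (w n).
    move: Mna Mnb; rewrite /w; have /ocitvP[->//|[[c d] /= cd ->]] := ocM n.
    rewrite (wlength_itv_bnd _ _ _ (ltW cd))/= !in_itv /= => /andP[? ?] /andP[? ?].
    by rewrite ler_norml; apply/andP; split; lra.
  move=> ab; have := gL _ _ Na Nb => /le_trans /(_ (ler_wpM2l L0 ab)).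
  by rewrite ler_distl.
apply: (@le_trans _ _ (\sum_(n <oo) mu (I n))%E).
  exact: (@measure_sigma_subadditive _ _ _ mu A I mI mA cov).
apply: (@le_trans _ _ (\sum_(n <oo) ((2 * L)%:E * w n))%E).
  by apply: lee_nneseries.
rewrite nneseriesZl//.
apply: (@le_trans _ _ ((2 * L)%:E * e'%:E)%E).
  have zw : (\sum_(n <oo) w n = z)%E by exact: sMz.
  by rewrite lee_wpmul2l ?lee_fin ?mulr_ge0// zw ltW.
rewrite -EFinM lee_fin /e' mulrA ler_pdivrMr ?ltr_wpDl ?mulr_ge0//.
rewrite [leRHS]mulrC ler_pM2r//; lra.
Qed.

End LipschitzNull.

Section Plane.
Variable R : realType.
Notation RR := (measurableTypeR R).
Notation mu := (@lebesgue_measure R).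

Lemma null_sections (A : set (RR * RR)) : measurable A ->
  {ae mu, forall x : RR, mu [set y : RR | A (x, y)] = 0%E} -> (mu \x mu)%E A = 0%E.
Proof.
move=> mA hA; rewrite /= /product_measure1.
rewrite (ae_eq_integral (cst 0%E)) ?integral0//.
  exact: measurable_fun_xsection.
apply: filterS hA => x hx _ /=; rewrite -[RHS]hx; congr (mu _).
by apply/seteqP; split => y; rewrite /xsection /= inE.
Qed.

Lemma null_swap (A : set (RR * RR)) : measurable A ->
  (forall y : RR, mu [set x : RR | A (x, y)] = 0%E) ->
  {ae mu, forall x : RR, mu [set y : RR | A (x, y)] = 0%E}.
Proof.
move=> mA hA.
have mf : measurable_fun setT (fun z : RR * RR => (\1_A z)%:E : \bar R).
  by apply/measurable_EFinP; exact: measurable_indic.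
have f0 z : (0 <= (\1_A z)%:E :> \bar R)%E by rewrite lee_fin.
have mX x : measurable [set y : RR | A (x, y)].
  by rewrite -[X in measurable X]setTI; exact: (pair1_measurable x measurableT mA).
have mY y : measurable [set x : RR | A (x, y)].
  by rewrite -[X in measurable X]setTI; exact: (pair2_measurable y measurableT mA).
have h := @fubini_tonelli _ _ _ _ _ mu mu _ mf f0.
have iX x : (\int[mu]_y (\1_A (x, y))%:E = mu [set y : RR | A (x, y)])%E.
  rewrite -[in RHS](setIT [set y : RR | A (x, y)]) -integral_indic//.
have iY y : (\int[mu]_x (\1_A (x, y))%:E = mu [set x : RR | A (x, y)])%E.
  rewrite -[in RHS](setIT [set x : RR | A (x, y)]) -integral_indic//.
have e1 : (\int[mu]_x mu [set y : RR | A (x, y)] = 0)%E.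
  transitivity (\int[mu]_x \int[mu]_y (\1_A (x, y))%:E)%E.
    by apply: eq_integral => x _; rewrite iX.
  rewrite h; under eq_integral do rewrite iY hA.
  exact: integral0.
have mg : measurable_fun setT (fun x : RR => mu [set y : RR | A (x, y)]).
  have := measurable_fun_xsection mu mA; congr (measurable_fun _ _).
  apply/funext => x /=; congr (mu _).
  by apply/seteqP; split => y; rewrite /xsection /= inE.
have : (\int[mu]_x `|mu [set y : RR | A (x, y)]| = 0)%E.
  by rewrite -[RHS]e1; apply: eq_integral => x _; rewrite gee0_abs.
move/(ae_eq_integral_abs mu measurableT mg); apply: filterS => x; exact.
Qed.

(** [- ln l.2 * expR (- ln (- ln l.1))] is [ln l.2 / ln l.1], written with
    functions that are measurable on the whole line. *)
Definition bad_ratios : set (RR * RR) :=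
  [set l | [/\ 0 < l.1 < 1, 0 < l.2 < 1 & bad_params (l.1, - ln l.2 * expR (- ln (- ln l.1)))]].

Lemma exponentE (x y : R) : 0 < x < 1 -> - ln y * expR (- ln (- ln x)) = ln y / ln x.
Proof.
move=> /andP[x0 x1]; have lx : 0 < - ln x by rewrite oppr_gt0 ln_lt0// x0.
by rewrite expRN lnK// invrN mulrNN.
Qed.

Lemma measurable_bad_ratios : measurable bad_ratios.
Proof.
have bset (f : RR * RR -> bool) : measurable_fun setT f -> measurable [set z | f z].
  by move=> mf; rewrite -[X in measurable X]setTI; exact: (mf measurableT [set true] I).
have ml (f : RR * RR -> R) : measurable_fun setT f -> measurable_fun setT (fun z => ln (f z)).
  by move=> mf; apply: measurableT_comp mf; exact: measurable_ln.
have mn (f : RR * RR -> R) : measurable_fun setT f -> measurable_fun setT (fun z => - f z).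
  by move=> mf; apply: measurableT_comp mf; exact: oppr_measurable.
have mm : measurable_fun setT (fun l : RR * RR => (l.1, - ln l.2 * expR (- ln (- ln l.1))) : RR * RR).
  apply: measurable_fun_pair => //; apply: measurable_funM.
    by apply: (mn); exact: ml.
  apply: measurableT_comp; first exact: measurable_expR.
  by apply: (mn); apply: (ml); apply: (mn); exact: ml.
rewrite (_ : bad_ratios = [set l | 0 < l.1 < 1] `&` [set l | 0 < l.2 < 1] `&`
   (fun l : RR * RR => (l.1, - ln l.2 * expR (- ln (- ln l.1))) : RR * RR) @^-1` (@bad_params R)); last first.
  by apply/seteqP; split => l; [case=> ? ? ?|case=> -[? ?] ?].
apply: measurableI.
  by apply: measurableI; apply: bset; apply: measurable_and; exact: measurable_fun_ltr.
by rewrite -[X in measurable X]setTI; apply: mm => //; exact: measurable_bad_params.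
Qed.

(** For fixed [x] the bad [y] are the image of the bad exponents under
    [al |-> x ^ al], which is Lipschitz on the positive half-line. *)
Lemma bad_ratios_null : (mu \x mu)%E bad_ratios = 0%E.
Proof.
apply: null_sections measurable_bad_ratios _.
apply: filterS (null_swap (@measurable_bad_params R) (@bad_params_section_null R)) => x hx.
have mX : measurable [set y : RR | bad_ratios (x, y)].
  by rewrite -[X in measurable X]setTI; exact: (pair1_measurable x measurableT measurable_bad_ratios).
have [/andP[x0 x1]|nx] := boolP (0 < x < 1); last first.
  rewrite (_ : [set _ | _] = set0) ?measure0//.
  by apply/seteqP; split => y // -[/= h]; exfalso; move/negP: nx; apply.
have lx : 0 < - ln x by rewrite oppr_gt0 ln_lt0// x0.
apply: (@lipschitz_null R _ _ (fun al => expR (- (- ln x * al))) (- ln x) (ltW lx) hx) => //.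
  by move=> a b /= [/= a0 _ _ _] [/= b0 _ _ _]; apply: expN_lip; exact: ltW.
move=> y /= [/= _ /andP[y0 _] hb]; exists (- ln y * expR (- ln (- ln x))) => //.
rewrite exponentE ?x0// mulNr opprK mulrC divfK ?lnK// lt_eqF// -oppr_gt0//.
Qed.

End Plane.

(** * Square-integrable densities from averages over balls *)

Section Density.
Variable R : realType.
Notation RR := (measurableTypeR R).
Notation mu := (@lebesgue_measure R).
Variables (nu : probability RR R).

Definition near_diag (r : R) : set (RR * RR) := [set z | `|z.1 - z.2| < r].

Lemma measurable_near_diag r : measurable (near_diag r).
Proof.
rewrite -[X in measurable X]setTI.
suff mf : measurable_fun setT (fun z : RR * RR => `|z.1 - z.2| < r).
  exact: (mf measurableT [set true] I).
apply: measurable_fun_ltr => //; apply: measurableT_comp; first exact: normr_measurable.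
exact: measurable_funB.
Qed.

Definition ball_avg (r x : R) : R := fine (nu (ball x r)) / (2 * r).

Lemma ball_section (m : set RR -> \bar R) r x : m (ball x r) = m (xsection (near_diag r) x).
Proof.
congr (m _); apply/seteqP; split => y; rewrite /xsection /near_diag /= inE /=.
  by rewrite -ball_normE.
by rewrite -ball_normE.
Qed.

Lemma measurable_ball_avg r : measurable_fun setT (ball_avg r : RR -> R).
Proof.
apply: measurable_funM => //; apply: measurableT_comp; first exact: fine_measurable.
have := measurable_fun_xsection nu (measurable_near_diag r).
by congr (measurable_fun _ _); apply/funext => x /=; rewrite -ball_section.
Qed.

Lemma nu_ball_fin r x : nu (ball x r) \is a fin_num.
Proof. by apply: fin_num_measure; apply: measurable_ball. Qed.

Lemma ball_avg_ge0 r x : 0 < r -> 0 <= ball_avg r x.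
Proof. by move=> r0; rewrite divr_ge0 ?fine_ge0// mulr_ge0// ltW. Qed.

(** Fubini's theorem for the set of pairs at distance less than [r]. *)
Lemma integral_ball_avg r (G : set RR) : 0 < r -> measurable G ->
  (\int[mu]_(x in G) (ball_avg r x)%:E =
   \int[nu]_z ((2 * r)^-1%:E * mu (G `&` ball z r)))%E.
Proof.
move=> r0 mG.
pose W : set (RR * RR) := (G `*` setT) `&` near_diag r.
have mW : measurable W.
  by apply: measurableI; [exact: measurableX|exact: measurable_near_diag].
have mf : measurable_fun setT (fun z : RR * RR => (\1_W z)%:E : \bar R).
  by apply/measurable_EFinP; exact: measurable_indic.
have f0 z : (0 <= (\1_W z)%:E :> \bar R)%E by rewrite lee_fin.
have h := @fubini_tonelli _ _ _ _ _ mu nu _ mf f0.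
have e1 : (\int[mu]_x \int[nu]_y (\1_W (x, y))%:E = \int[mu]_(x in G) nu (ball x r))%E.
  rewrite [RHS]integral_mkcond; apply: eq_integral => x _; rewrite patchE.
  have mX : measurable [set y : RR | W (x, y)].
    by rewrite -[X in measurable X]setTI; exact: (pair1_measurable x measurableT mW).
  transitivity (nu [set y : RR | W (x, y)]).
    by rewrite -[in RHS](setIT [set y : RR | W (x, y)]) -integral_indic.
  case: ifPn => [|]; rewrite ?inE ?notin_setE => Gx.
    rewrite ball_section; congr (nu _); apply/seteqP; split => y; rewrite /xsection /W /= inE /=.
      by case.
    by split.
  rewrite (_ : [set _ | _] = set0) ?measure0//.
  by apply/seteqP; split => y // -[[/= ]].
have e2 : (\int[nu]_y \int[mu]_x (\1_W (x, y))%:E = \int[nu]_z mu (G `&` ball z r))%E.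
  apply: eq_integral => z _.
  have mX : measurable [set x : RR | W (x, z)].
    by rewrite -[X in measurable X]setTI; exact: (pair2_measurable z measurableT mW).
  transitivity (mu [set x : RR | W (x, z)]).
    by rewrite -[in RHS](setIT [set x : RR | W (x, z)]) -integral_indic.
  congr (mu _); apply/seteqP; split => x; rewrite /W /near_diag /=.
    by case=> -[/= Gx _] h'; split => //; rewrite -ball_normE /= distrC.
  by case=> Gx; rewrite -ball_normE /= distrC.
have r2 : 0 <= (2 * r)^-1 by rewrite invr_ge0 mulr_ge0// ltW.
have mG' : measurable_fun setT (fun z : RR => mu (G `&` ball z r)).
  rewrite (_ : (fun _ => _) = mu \o ysection W); first exact: measurable_fun_ysection.
  apply/funext => z /=; congr (mu _); apply/seteqP; split => x; rewrite /ysection /W /near_diag /= inE /=.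
    by case=> Gx; rewrite -ball_normE /= distrC.
  by case=> -[/= Gx _] h'; split => //; rewrite -ball_normE /= distrC.
have mB : measurable_fun setT (fun x : RR => nu (ball x r)).
  rewrite (_ : (fun _ => _) = nu \o xsection (near_diag r)).
    by apply: measurable_fun_xsection; exact: measurable_near_diag.
  by apply/funext => x /=; rewrite ball_section.
rewrite ge0_integralZl//.
rewrite -e2 -h e1 -ge0_integralZl//; last exact: measurable_funTS.
by apply: eq_integral => x _; rewrite /ball_avg EFinM fineK ?nu_ball_fin// muleC.
Qed.

Section Bounded.
Variables (r : nat -> R) (c : R).
Hypotheses (r_gt0 : forall k, 0 < r k) (r_cvg : r @ \oo --> 0).
Hypothesis avg_sq : forall k, (\int[mu]_x (ball_avg (r k) x ^+ 2)%:E <= c%:E)%E.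

(** With [g] the ball average, [g <= d g ^ 2 / 2 + 1 / (2 d)] bounds the integral
    of [g] over [G].  By [integral_ball_avg] this integral is also the
    [nu]-integral of the proportion of [G] in balls around [z], which is 1 for
    small balls when [z] lies in the open set [G]. *)
Lemma nu_open_le (G : set RR) (d m : R) : open (G : set R) -> 0 < d -> (mu G <= m%:E)%E ->
  (nu G <= (d * c / 2 + m / (2 * d))%:E)%E.
Proof.
move=> oG d0 Gm.
have mG : measurable G by exact: open_measurable.
pose h k (z : RR) : \bar R := ((2 * r k)^-1%:E * mu (G `&` ball z (r k)))%E.
have r20 k : 0 < 2 * r k by rewrite mulr_gt0.
have h0 k z : (0 <= h k z)%E by rewrite mule_ge0// lee_fin invr_ge0 ltW.
have mh k : measurable_fun setT (h k).
  apply: measurable_funeM.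
  pose W : set (RR * RR) := (G `*` setT) `&` near_diag (r k).
  have mW : measurable W.
    by apply: measurableI; [exact: measurableX|exact: measurable_near_diag].
  rewrite (_ : (fun _ => _) = mu \o ysection W); first exact: measurable_fun_ysection.
  apply/funext => z /=; congr (mu _); apply/seteqP; split => x; rewrite /ysection /W /near_diag /= inE /=.
    by case=> Gx; rewrite -ball_normE /= distrC.
  by case=> -[/= Gx _] h'; split => //; rewrite -ball_normE /= distrC.
have hb k : (\int[nu]_(z in G) h k z <= (d * c / 2 + m / (2 * d))%:E)%E.
  apply: (@le_trans _ _ (\int[nu]_z h k z)%E).
    exact: (ge0_subset_integral nu mG measurableT (mh k) (fun z _ => h0 k z) (@subsetT _ _)).
  rewrite -integral_ball_avg//.
  apply: (@le_trans _ _ (\int[mu]_(x in G) ((d / 2)%:E * (ball_avg (r k) x ^+ 2)%:E + ((2 * d)^-1)%:E))%E).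
    apply: ge0_le_integral => //.
    - by move=> x _; rewrite lee_fin ball_avg_ge0.
    - by apply: measurable_funTS; apply/measurable_EFinP; exact: measurable_ball_avg.
    - apply: measurable_funTS; under eq_fun do rewrite -EFinM -EFinD; apply/measurable_EFinP.
      apply: measurable_funD => //; apply: measurable_funM => //.
      by apply: measurable_funX; exact: measurable_ball_avg.
    - move=> x _; rewrite -EFinM -EFinD lee_fin.
      have := sqr_ge0 (d * ball_avg (r k) x - 1) => hs.
      rewrite -subr_ge0 (_ : _ - _ = (d * ball_avg (r k) x - 1) ^+ 2 / (2 * d)).
        by rewrite divr_ge0// mulr_ge0// ltW.
      by field; rewrite gt_eqF.
  rewrite ge0_integralD//; last 3 first.
  - by move=> x _; rewrite -EFinM lee_fin mulr_ge0 ?sqr_ge0// divr_ge0// ltW.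
  - apply: measurable_funTS; under eq_fun do rewrite -EFinM; apply/measurable_EFinP.
    by apply: measurable_funM => //; apply: measurable_funX; exact: measurable_ball_avg.
  - by move=> x _; rewrite lee_fin invr_ge0 mulr_ge0// ltW.
  rewrite integral_cst// EFinD leeD//.
    rewrite ge0_integralZl//; last 3 first.
    - by apply: measurable_funTS; apply/measurable_EFinP; apply: measurable_funX; exact: measurable_ball_avg.
    - by move=> x _; rewrite lee_fin sqr_ge0.
    - by rewrite lee_fin divr_ge0// ltW.
    apply: (@le_trans _ _ ((d / 2)%:E * \int[mu]_x (ball_avg (r k) x ^+ 2)%:E)%E).
      apply: lee_wpmul2l; first by rewrite lee_fin divr_ge0// ltW.
      have ms : measurable_fun setT (fun x : RR => (ball_avg (r k) x ^+ 2)%:E).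
        by apply/measurable_EFinP; apply: measurable_funX; exact: measurable_ball_avg.
      apply: (ge0_subset_integral mu mG measurableT ms _ (@subsetT _ _)) => x _.
      by rewrite lee_fin sqr_ge0.
    apply: (@le_trans _ _ ((d / 2)%:E * c%:E)%E).
      by apply: lee_wpmul2l; [rewrite lee_fin divr_ge0// ltW|].
    by rewrite -EFinM lee_fin mulrAC.
  apply: (@le_trans _ _ ((2 * d)^-1%:E * m%:E)%E).
    by apply: lee_wpmul2l; [rewrite lee_fin invr_ge0 mulr_ge0// ltW|].
  by rewrite -EFinM lee_fin mulrC.
apply: (@le_trans _ _ (\int[nu]_(z in G) limn_einf (h^~ z))%E); last first.
  apply: le_trans (fatou nu mG _ _) _ => //.
    by move=> k; exact: measurable_funTS.
  exact: limn_einf_le.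
rewrite -[leLHS]mul1e -integral_cst//.
rewrite le_eqVlt; apply/orP; left; apply/eqP; apply: eq_integral => z; rewrite inE => Gz /=.
apply/esym; apply: (cvg_limn_einf_sup _).1.
apply: cvg_near_cst.
have /open_nbhs_nbhs/nbhs_ballP[e /= e0 eG] : open_nbhs (z : R) (G : set R) by [].
have /cvgrPdist_lt /(_ _ e0) := r_cvg.
apply: filterS => k; rewrite sub0r normrN ger0_norm ?(ltW (r_gt0 k))// => rke.
rewrite /h (_ : G `&` ball z (r k) = ball z (r k)); last first.
  by apply/setIidr => y /(le_ball (ltW rke)); exact: eG.
rewrite lebesgue_measure_ball ?(ltW (r_gt0 k))// -EFinM -(mulr_natl (r k)) mulVf//.
by rewrite gt_eqF.
Qed.

Lemma sq_bound_ge0 : 0 <= c.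
Proof.
rewrite -lee_fin; apply: le_trans (avg_sq 0%nat).
by apply: integral_ge0 => x _; rewrite lee_fin sqr_ge0.
Qed.

(** For a null set and an open neighbourhood of length at most [d ^ 2], [nu_open_le] gives
    a multiple of [d]. *)
Lemma nu_dominates : nu `<< mu.
Proof.
apply/null_content_dominatesP => A mA muA.
apply/eqP; rewrite eq_le measure_ge0 andbT; apply/lee_addgt0Pr => e e0; rewrite add0e.
pose d := e / (c + 1).
have c1 : 0 < c + 1 by apply: ltr_wpDl => //; exact: sq_bound_ge0.
have d0 : 0 < d by rewrite divr_gt0.
have d20 : 0 < d * d by rewrite mulr_gt0.
have muA' : (mu A < +oo)%E by rewrite muA ltry.
have [U [oU AU Ud]] := lebesgue_regularity_outer mA muA' d20.
have mU : measurable (U : set RR) by exact: open_measurable.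
have muU : (mu U <= (d * d)%:E)%E.
  apply: le_trans (ltW Ud); rewrite measureD//; last first.
    apply: (@le_lt_trans _ _ (mu A + mu (U `\` A))%E).
      by rewrite -{1}(setDUK AU) measureU2//; exact: measurableD.
    by rewrite muA add0e (lt_trans Ud) ?ltry.
  rewrite [X in (_ - X)%E](_ : _ = 0%E) ?sube0//.
  by apply/eqP; rewrite eq_le measure_ge0 andbT -muA le_measure ?inE//; apply: measurableI.
apply: (@le_trans _ _ (nu U)); first by rewrite le_measure ?inE.
apply: le_trans (nu_open_le oU d0 muU) _; rewrite lee_fin.
have -> : d * c / 2 + d * d / (2 * d) = (e / 2).
  rewrite /d; field; rewrite ?gt_eqF//.
by lra.
Qed.


Definition density (x : RR) : R := fine (Radon_Nikodym_SigmaFinite.f nu mu x).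

Lemma density_ge0 x : 0 <= density x.
Proof. by rewrite fine_ge0// Radon_Nikodym_SigmaFinite.f_ge0//; exact: nu_dominates. Qed.

Lemma densityE : EFin \o density = Radon_Nikodym_SigmaFinite.f nu mu.
Proof.
apply/funext => x /=; rewrite fineK// Radon_Nikodym_SigmaFinite.f_fin_num//.
exact: nu_dominates.
Qed.

Lemma integrable_density : mu.-integrable setT (EFin \o density).
Proof. by rewrite densityE; apply: Radon_Nikodym_SigmaFinite.f_integrable; exact: nu_dominates. Qed.

Lemma measurable_density : measurable_fun setT density.
Proof. by apply/measurable_EFinP; exact: (measurable_int mu integrable_density). Qed.

Lemma integral_density (A : set RR) : measurable A ->
  nu A = (\int[mu]_(x in A) (density x)%:E)%E.
Proof.
move=> mA; rewrite (Radon_Nikodym_SigmaFinite.f_integral nu_dominates mA).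
by rewrite -densityE.
Qed.

Lemma ball_avg_cvg_density : {ae mu, forall x : R, (ball_avg (r k) x)%:E @[k --> \oo] --> (density x)%:E}.
Proof.
have loc : locally_integrable setT (density : R -> R).
  by apply: open_integrable_locally; [exact: openT|exact: integrable_density].
apply: (@filterS _ _ (ae_filter_ringOfSetsType _) _ _ _ (lebesgue_differentiation loc)) => x fx.
pose E (x : R) k : set R := ball x (r k).
have hE y : nicely_shrinking y (E y).
  split; first by move=> k; exact: measurable_ball.
  exists (1, fun k => PosNum (r_gt0 k)); by split => //= k; rewrite ?mul1e // => z.
have := nice_lebesgue_differentiation hE loc fx.
apply: cvg_trans; apply: near_eq_cvg; apply: nearW => k.
rewrite /E -(@integral_density (ball x (r k))); last exact: measurable_ball.
have r2 : r k *+ 2 != 0 by rewrite mulrn_eq0 negb_or /= gt_eqF.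
rewrite lebesgue_measure_ball ?(ltW (r_gt0 k))//.
rewrite inver (negbTE r2) /ball_avg EFinM fineK ?nu_ball_fin// muleC mulr_natl.
by [].
Qed.

Lemma density_sq : (\int[mu]_x (density x ^+ 2)%:E <= c%:E)%E.
Proof.
have ms k : measurable_fun setT (fun x : RR => (ball_avg (r k) x ^+ 2)%:E).
  by apply/measurable_EFinP; apply: measurable_funX; exact: measurable_ball_avg.
apply: (@le_trans _ _ (\int[mu]_x limn_einf (fun k => (ball_avg (r k) x ^+ 2)%:E))%E); last first.
  apply: le_trans (fatou mu measurableT ms _) _ => //.
    by move=> k x _; rewrite lee_fin sqr_ge0.
  by apply: limn_einf_le.
rewrite le_eqVlt; apply/orP; left; apply/eqP.
apply: ae_eq_integral => //.
- by apply/measurable_EFinP; apply: measurable_funX; exact: measurable_density.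
- rewrite /limn_einf; apply: measurableT_comp; first exact: oppe_measurable.
  by apply: measurable_fun_limn_esup => k; apply: measurableT_comp.
apply: (@filterS _ _ (ae_filter_ringOfSetsType _) _ _ _ ball_avg_cvg_density) => x h _.
apply/esym; apply: (cvg_limn_einf_sup _).1.
have /fine_cvgP[_ h'] := h.
by apply: cvg_EFin; [exact: nearW|exact: (cvgM h' h')].
Qed.

Lemma ac_with_L2_density_of_averages : ac_with_L2_density nu.
Proof.
split; first exact: nu_dominates.
exists density; split; [|exact: density_ge0|exact: integral_density].
rewrite inE /=; apply/andP; split; rewrite inE /=; first exact: measurable_density.
apply: (@lty_poweRy _ _ 2) => //; rewrite poweR_Lnorm//.
apply: (@le_lt_trans _ _ c%:E); last by rewrite ltry.
apply: le_trans density_sq.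
rewrite le_eqVlt; apply/orP; left; apply/eqP; apply: eq_integral => x _ /=.
by rewrite powR_mulrn ?normr_ge0// real_normK// num_real.
Qed.
End Bounded.
End Density.

(** * Bernoulli measures and the natural projection *)

Section Coding.
Variable R : realType.
Variables (p : R) (q : 'I_2 -> R) (P : probability (symbolic 1) R).
Hypotheses (p01 : 0 <= p <= 1) (q0 : q ord0 = p) (q1 : q ord_max = 1 - p).
Hypothesis bernoulliP : is_bernoulli q P.

Definition letter (b : bool) : 'I_2 := if b then ord_max else ord0.
Definition code : seq bool -> seq 'I_2 := map letter.

Lemma letter_onto j : exists b, j = letter b.
Proof.
by case: j => [[|[|//]] h]; [exists false|exists true]; apply: val_inj.
Qed.

Lemma measurable_cylinder m (w : seq 'I_m.+1) : measurable (cylinder w : set (symbolic m)).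
Proof. by apply: sub_sigma_algebra; exists w. Qed.

Lemma cylinder_rcons (w : seq 'I_2) :
  cylinder w = cylinder (rcons w ord0) `|` cylinder (rcons w ord_max).
Proof.
apply/seteqP; split => om; rewrite /cylinder /= !size_rcons !mkseqS.
  move=> ->; have [[] ->] := letter_onto (om (size w)); [right|left]; by [].
by case=> /rcons_inj[].
Qed.

(** [F] stands for the indicator of the words whose cylinder meets [A]. *)
Lemma bernoulli_word_avg_prefix (A : set (symbolic 1)) N (w : seq 'I_2) (F : seq bool -> R) :
  measurable A -> (forall u, 0 <= F u) ->
  (forall u om, size u = N -> A om -> cylinder (w ++ code u) om -> 1 <= F u) ->
  (P (A `&` cylinder w) <= (\prod_(j <- w) q j * word_avg p N F)%:E)%E.
Proof.
move=> mA; have qge0 j : 0 <= q j.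
  by have /andP[p0 p1] := p01; have [[] ->] := letter_onto j; rewrite ?q0 ?q1 ?subr_ge0.
elim: N w F => [|N IH] w F F0 F1 /=.
  have [->|/set0P[om [Aom wom]]] := eqVneq (A `&` cylinder w) set0.
    by rewrite measure0 lee_fin mulr_ge0// prodr_ge0.
  apply: (@le_trans _ _ (P (cylinder w))).
    rewrite le_measure ?inE//; last exact: measurable_cylinder.
    by apply: measurableI => //; exact: measurable_cylinder.
  rewrite bernoulliP lee_fin ler_peMr ?prodr_ge0//.
  by apply: (F1 [::] om) => //; rewrite cats0.
rewrite (_ : A `&` cylinder w =
  (A `&` cylinder (rcons w ord0)) `|` (A `&` cylinder (rcons w ord_max))); last first.
  by rewrite -setIUr -cylinder_rcons.
have mC j : measurable (A `&` cylinder (rcons w j) : set (symbolic 1)).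
  by apply: measurableI => //; exact: measurable_cylinder.
apply: le_trans (measureU2 _ (mC _) (mC _)) _.
rewrite mulrDr EFinD leeD//.
  apply: le_trans (IH (rcons w ord0) (fun u => F (false :: u)) _ _) _.
  - by move=> u; exact: F0.
  - move=> u om su Aom h; apply: (F1 _ om) => //=; first by rewrite su.
    by rewrite -cat_rcons.
  - by rewrite lee_fin -cats1 big_cat big_seq1 /= q0 mulrA.
apply: le_trans (IH (rcons w ord_max) (fun u => F (true :: u)) _ _) _.
- by move=> u; exact: F0.
- move=> u om su Aom h; apply: (F1 _ om) => //=; first by rewrite su.
  by rewrite -cat_rcons.
- by rewrite lee_fin -cats1 big_cat big_seq1 /= q1 mulrA.
Qed.

Lemma bernoulli_word_avg (A : set (symbolic 1)) N (F : seq bool -> R) :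
  measurable A -> (forall u, 0 <= F u) ->
  (forall u om, size u = N -> A om -> cylinder (code u) om -> 1 <= F u) ->
  (P A <= (word_avg p N F)%:E)%E.
Proof.
move=> mA F0 F1; have := @bernoulli_word_avg_prefix A N [::] F mA F0 F1.
by rewrite big_nil mul1r (_ : cylinder [::] = setT) ?setIT//; apply/seteqP.
Qed.

End Coding.

Section Projection.
Variable R : realType.
Let rho : R := 668%:R / 1000%:R.
Notation RR := (measurableTypeR R).
Notation mu := (@lebesgue_measure R).
Let C : R := (1 - rho)^-1.
Variables (x y : R).
Hypotheses (x01 : 0 <= x <= rho) (y01 : 0 <= y <= rho).
Let f := ifs_map (ratios2 x y) (@shifts2 R).
Let s (om : symbolic 1) n := foldr f 0 (mkseq om n).
Let Pi := natural_projection (ratios2 x y) (@shifts2 R).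

Let rho01 : 0 < 1 - rho. Proof. by rewrite /rho; lra. Qed.
Let C_ge0 : 0 <= C. Proof. by rewrite invr_ge0 ltW. Qed.

Let ratio01 j : 0 <= ratios2 x y j <= rho.
Proof. by rewrite /ratios2; case: ifP. Qed.

Let f_int j z : 0 <= z <= C -> 0 <= f j z <= C.
Proof.
move=> /andP[z0 zC]; have /andP[r0 r1] := ratio01 j.
have a01 : 0 <= @shifts2 R j <= 1 by rewrite /shifts2; case: ifP; rewrite lexx ler01.
have /andP[a0 a1] := a01; apply/andP; split; first by rewrite addr_ge0// mulr_ge0.
have e : rho * C + 1 = C by rewrite /C; field; rewrite gt_eqF.
by rewrite -[leRHS]e lerD// ler_pM.
Qed.

Let foldr_int w z : 0 <= z <= C -> 0 <= foldr f z w <= C.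
Proof. by move=> hz; elim: w => //= j w IH; exact: f_int. Qed.

Let foldr_le w z z' : z <= z' -> foldr f z w <= foldr f z' w.
Proof.
move=> zz; elim: w => //= j w IH; rewrite /f /ifs_map lerD2r ler_wpM2l//.
by have /andP[] := ratio01 j.
Qed.

Lemma foldr_contract w z z' :
  `|foldr f z w - foldr f z' w| <= rho ^+ size w * `|z - z'|.
Proof.
elim: w => [|j w IH] /=; first by rewrite mul1r.
have -> : f j (foldr f z w) - f j (foldr f z' w) =
    ratios2 x y j * (foldr f z w - foldr f z' w) by rewrite /f /ifs_map; ring.
have /andP[r0 r1] := ratio01 j.
by rewrite normrM ger0_norm// exprS -mulrA ler_pM.
Qed.

(** The approximations that start at 0 increase, since both maps are increasing
    and send 0 to nonnegative numbers, and both maps preserve the interval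
    [[0, C]]. *)
Lemma natural_projection_cvg om : s om @ \oo --> Pi om.
Proof.
apply: (@nondecreasing_is_cvgn _ (s om)).
  apply/nondecreasing_seqP => n; rewrite /s mkseqS -cats1 foldr_cat /=.
  apply: foldr_le; rewrite /f /ifs_map mulr0 add0r /shifts2; by case: ifP; rewrite ?ler01.
exists C => _ [n _ <-]; have /andP[] // : 0 <= s om n <= C.
by apply: foldr_int; rewrite lexx.
Qed.

Lemma measurable_natural_projection : measurable_fun setT (Pi : symbolic 1 -> RR).
Proof.
apply: (@measurable_fun_cvg _ _ R setT (fun n om => s om n)); last first.
  by move=> om _; exact: natural_projection_cvg.
move=> n _ Y mY; rewrite setTI.
rewrite (_ : _ @^-1` _ = \bigcup_(w : seq 'I_2)
   (if (size w == n) && `[< Y (foldr f 0 w) >] then cylinder w else set0 : set (symbolic 1))).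
  apply: countable_bigcupT_measurable; first exact: countableP.
  by move=> w; case: ifP => // _; exact: measurable_cylinder.
apply/seteqP; split => om /=.
  move=> h; exists (mkseq om n) => //=; rewrite size_mkseq eqxx /=.
  by rewrite asboolT// /cylinder /= size_mkseq.
move=> [w _]; case: ifP => // /andP[/eqP sw /asboolP hw].
by rewrite /cylinder /= sw => e; rewrite /s e.
Qed.

(** Both points are images of points of [[0, C]] under the composition of maps
    given by [w]. *)
Lemma natural_projection_approx (om : symbolic 1) w z : 0 <= z <= C -> cylinder w om ->
  `|foldr f z w - Pi om| <= rho ^+ size w * C.
Proof.
move=> zC wom; have h : `|foldr f z w - s om n| @[n --> \oo] --> `|foldr f z w - Pi om|.
  by apply: cvg_norm; apply: cvgB; [exact: cvg_cst|exact: natural_projection_cvg].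
rewrite -(cvg_lim _ h)//; apply: limr_le; first by apply/cvg_ex; eexists; exact: h.
exists (size w) => // n /= wn; rewrite /s -(subnKC wn) /mkseq iotaD map_cat foldr_cat -/(mkseq om _) wom.
apply: le_trans (foldr_contract _ _ _) _; rewrite ler_wpM2l ?exprn_ge0//.
  by rewrite /rho; lra.
have /andP[z0 zC'] := zC.
have /andP[t0 t1] : 0 <= foldr f 0 [seq om i | i <- iota (0 + size w) (n - size w)] <= C.
  by apply: foldr_int; rewrite lexx.
by rewrite ler_norml; lra.
Qed.
End Projection.

(** * Natural measures with bounded correlations *)

Lemma geometric_tail (R : realType) (t : R) n :
  0 <= t -> 0 < 1 - t -> t ^+ 2 <= 2^-1 -> t ^+ 4 <= 1 - t ->
  t ^+ (2 * n + 4) * (1 - t)^-1 <= (2 ^+ n)^-1.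
Proof.
move=> t0 t1 t2 t4; rewrite exprD exprM -exprVn -[leRHS]mulr1 -mulrA.
apply: ler_pM; first by rewrite exprn_ge0 // exprn_ge0.
- by apply: mulr_ge0; [exact: exprn_ge0|rewrite invr_ge0 ltW].
- by apply: lerXn2r => //; rewrite nnegrE ?exprn_ge0// invr_ge0.
- by rewrite ler_pdivrMr// mul1r.
Qed.

Section Natural.
Variable R : realType.
Let rho : R := 668%:R / 1000%:R.
Notation RR := (measurableTypeR R).
Notation mu := (@lebesgue_measure R).
Variables (al x s : R) (P : probability (symbolic 1) R) (nu : probability RR R).
Let y := yratio al x.
Let p := x `^ s.
Hypotheses (reg : region al x) (al_gt0 : 0 < al).
Hypothesis dim : is_similarity_dimension (ratios2 x y) s.
Hypothesis bernoulliP : is_bernoulli (fun j => ratios2 x y j `^ s) P.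
Hypothesis nuE : forall A : set RR, measurable A ->
  nu A = pushforward P (natural_projection (ratios2 x y) (@shifts2 R) : _ -> RR) A.

Let x_gt0 : 0 < x. Proof. by case/and4P: reg. Qed.
Let y_gt0 : 0 < y. Proof. exact: expR_gt0. Qed.
Let x01 : 0 <= x <= rho. Proof. by case/and4P: reg => /ltW -> ->. Qed.
Let y01 : 0 <= y <= rho. Proof. by case/and4P: reg => _ _ h _; rewrite (ltW y_gt0). Qed.

Lemma weights_sum : p + y `^ s = 1.
Proof. by have := dim; rewrite /is_similarity_dimension big_ord_recl big_ord1. Qed.

Lemma weight_in01 : 0 < p < 1.
Proof.
have h := weights_sum; have : 0 < y `^ s by apply: powR_gt0.
have : 0 < p by apply: powR_gt0.
by lra.
Qed.

(** [y ^ s = x ^ (al s) = p ^ al]: the weights depend on the exponent alone. *)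
Lemma natural_weight_eq : p + expR (al * ln p) = 1.
Proof.
rewrite -weights_sum; congr (_ + _).
by rewrite /p /powR (gt_eqF x_gt0) (gt_eqF y_gt0) expRK /y /yratio expRK mulrCA.
Qed.

Lemma natural_weight : weight al = p.
Proof. by apply: weightE => //; [exact: weight_in01|exact: natural_weight_eq]. Qed.

Lemma base_point_int : 0 <= base_point al x <= (1 - rho)^-1.
Proof.
have /andP[y0 y1] := y01; have r1 : 0 < 1 - rho by rewrite /rho; lra.
rewrite /base_point; case: ifP => _; first by rewrite lexx invr_ge0 ltW.
have y2 : 0 < 1 - yratio al x by apply: lt_le_trans r1 _; rewrite lerB.
by rewrite expR_ge0 /= expRN lnK// lef_pV2// ?posrE// lerB.
Qed.

Lemma word_point_foldr w :
  word_point al x w = foldr (ifs_map (ratios2 x y) (@shifts2 R)) (base_point al x) (code w).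
Proof.
elim: w => //= b w <-; rewrite -/(word_point al x w) /ifs_map.
by case: b; rewrite /ratios2 /shifts2 /= ?addr0 // addrC.
Qed.

Let N n := (2 * n + 4)%nat.

Lemma tail_le n : rho ^+ (N n) * (1 - rho)^-1 <= (2 ^+ n)^-1.
Proof. by apply: geometric_tail; rewrite /rho; lra. Qed.

Definition near_word n z w : R := if `|word_point al x w - z| < 2 * (2 ^+ n)^-1 then 1 else 0.

Lemma near_word_ge0 n z w : 0 <= near_word n z w. Proof. by rewrite /near_word; case: ifP. Qed.

(** Every sequence of the cylinder of a word of length [N n] codes a point within
    [2 ^ -n] of the point of the word. *)
Lemma ball_le_near_words n (z : R) :
  (nu (ball z (2 ^+ n)^-1) <= (word_avg p (N n) (near_word n z))%:E)%E.
Proof.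
have mB : measurable (ball z (2 ^+ n)^-1 : set RR) by exact: measurable_ball.
rewrite nuE// /pushforward.
apply: (@bernoulli_word_avg _ _ (fun j => ratios2 x y j `^ s)) => //.
- by have /andP[/ltW -> /ltW ->] := weight_in01.
- by rewrite /= -weights_sum addrAC subrr add0r.
- rewrite -[X in measurable X]setTI; apply: measurable_natural_projection => //.
- exact: near_word_ge0.
move=> u om su; rewrite /= -ball_normE /= => hz wom.
rewrite /near_word ifT//.
have := @natural_projection_approx R x y x01 y01 om (code u) (base_point al x) base_point_int wom.
rewrite -word_point_foldr size_map su => h.
have {h} := le_trans h (tail_le n).
set e := (2 ^+ n)^-1; set t := natural_projection _ _ _ in hz *.
rewrite -/t => h; rewrite distrC in hz.
have -> : word_point al x u - z = (word_point al x u - t) + (t - z) by ring.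
by apply: le_lt_trans (ler_normD _ _) _; rewrite mulr2n mulrDl mul1r ler_ltD.
Qed.

Lemma near_word_indic n w : (fun z => near_word n z w) = \1_(ball (word_point al x w) (2 * (2 ^+ n)^-1)) :> (RR -> R).
Proof.
apply/funext => z; rewrite /near_word indicE.
by case: ifPn => h; [rewrite mem_set|rewrite memNset] => //; rewrite -ball_normE //=; exact/negP.
Qed.

Lemma measurable_near_word n w : measurable_fun setT (fun z : RR => near_word n z w).
Proof. by rewrite near_word_indic; apply: measurable_indic; exact: measurable_ball. Qed.

Lemma integral_near_word2 n v w :
  (\int[mu]_z (near_word n z v * near_word n z w)%:E <= (4 / 2 ^+ n * close_pair al x (4 / 2 ^+ n) v w)%:E)%E.
Proof.
have e0 : 0 < (2 ^+ n)^-1 :> R by rewrite invr_gt0 exprn_gt0.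
rewrite /close_pair; case: ifPn => h.
  rewrite mulr1; apply: (@le_trans _ _ (\int[mu]_z (near_word n z v)%:E)%E).
    apply: ge0_le_integral => //.
    - by move=> z _; rewrite lee_fin mulr_ge0// near_word_ge0.
    - by apply/measurable_EFinP; apply: measurable_funM; exact: measurable_near_word.
    - by apply/measurable_EFinP; exact: measurable_near_word.
    - by move=> z _; rewrite lee_fin ler_piMr ?near_word_ge0// /near_word; case: ifP.
  have := near_word_indic n v => E.
  rewrite (_ : (fun z : RR => (near_word n z v)%:E) =
     fun z => (\1_(ball (word_point al x v) (2 * (2 ^+ n)^-1)) z)%:E); last first.
    by apply/funext => z; rewrite -E.
  rewrite integral_indic// ?setIT; last exact: measurable_ball.
  rewrite [leLHS](@lebesgue_measure_ball R); last by rewrite mulr_ge0// ltW.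
  by rewrite lee_fin -mulr_natl; lra.
rewrite mulr0 integral0_eq// => z _; rewrite /near_word.
case: ifPn => h1; rewrite ?mul0r//; case: ifPn => h2; rewrite ?mulr0//.
exfalso; move/negP: h; apply.
have -> : word_point al x v - word_point al x w = (word_point al x v - z) - (word_point al x w - z) by ring.
apply: le_lt_trans (ler_normB _ _) _.
have -> : 4 / 2 ^+ n = 2 * (2 ^+ n)^-1 + 2 * (2 ^+ n)^-1 :> R by ring.
exact: ltrD.
Qed.

Lemma word_avgZ N' c F : word_avg p N' (fun w => c * F w) = c * word_avg p N' F.
Proof.
rewrite -[RHS]addr0 -(mul0r (word_avg p N' F)) -word_avg_lin.
by congr word_avg; apply/funext => w; rewrite mul0r addr0.
Qed.

Lemma word_avg_mul N' F G : word_avg p N' F * word_avg p N' G =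
  word_avg p N' (fun v => word_avg p N' (fun w => F v * G w)).
Proof.
by rewrite mulrC -word_avgZ; congr word_avg; apply/funext => v; rewrite mulrC -word_avgZ.
Qed.

(** Squaring [ball_le_near_words] gives pairs of words near [z]; such words are
    within [4 r] of each other, for [r = 2 ^ -n], and the set of these [z] has
    length at most [4 r].  Hence the integral is at most
    [4 r / (2 r) ^ 2 = 2 ^ n] times the energy at scale [4 r]. *)
Lemma integral_ball_avg_sq n : (\int[mu]_z (ball_avg nu (2 ^+ n)^-1 z ^+ 2)%:E <= (correlation n al x)%:E)%E.
Proof.
set e := (2 ^+ n)^-1; have e0 : 0 < e by rewrite invr_gt0 exprn_gt0.
have p01 : 0 <= p <= 1 by have /andP[/ltW -> /ltW ->] := weight_in01.
pose W z := word_avg p (N n) (fun v => word_avg p (N n) (fun w => near_word n z v * near_word n z w)).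
have mhit v : measurable_fun setT (fun z : RR => word_avg p (N n) (fun w => near_word n z v * near_word n z w)).
  apply: (@measurable_word_avg R _ RR (fun=> p) (N n) (fun w z => near_word n z v * near_word n z w)) => // w.
  by apply: measurable_funM; exact: measurable_near_word.
have mW : measurable_fun setT (W : RR -> R).
  by apply: (@measurable_word_avg R _ RR (fun=> p) (N n)
    (fun v z => word_avg p (N n) (fun w => near_word n z v * near_word n z w))).
have hh z v w : 0 <= near_word n z v * near_word n z w by rewrite mulr_ge0// near_word_ge0.
have W0 z : 0 <= W z by do 2 (apply: word_avg_ge0 => // ?).
have c0 : 0 <= (2 * e)^-1 ^+ 2 by rewrite sqr_ge0.
apply: (@le_trans _ _ (\int[mu]_z (((2 * e)^-1 ^+ 2)%:E * (W z)%:E))%E).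
  apply: ge0_le_integral => //.
  - by move=> z _; rewrite lee_fin sqr_ge0.
  - by apply/measurable_EFinP; apply: measurable_funX; exact: measurable_ball_avg.
  - by apply: measurable_funeM; exact/measurable_EFinP.
  move=> z _; rewrite -EFinM lee_fin /ball_avg exprMn mulrC ler_wpM2l//.
  rewrite /W -word_avg_mul -expr2; apply: lerXn2r; rewrite ?nnegrE ?fine_ge0//.
    by apply: word_avg_ge0 => // ?; exact: near_word_ge0.
  have := ball_le_near_words n z; rewrite -{1}(fineK (nu_ball_fin nu e z)) lee_fin.
  exact.
rewrite ge0_integralZl_EFin//; last 2 first.
- by move=> z _; rewrite lee_fin.
- exact/measurable_EFinP.
apply: (@le_trans _ _ (((2 * e)^-1 ^+ 2)%:E *
   (word_avg p (N n) (fun v => word_avg p (N n) (fun w => 4 / 2 ^+ n * close_pair al x (4 / 2 ^+ n) v w)))%:E)%E).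
  apply: lee_wpmul2l; first by rewrite lee_fin.
  apply: (@integral_word_avg_le R _ RR mu setT p (N n)
    (fun v z => word_avg p (N n) (fun w => near_word n z v * near_word n z w))) => //.
    by move=> v z; apply: word_avg_ge0.
  move=> v; apply: (@integral_word_avg_le R _ RR mu setT p (N n)
    (fun w z => near_word n z v * near_word n z w)) => //.
    by move=> w; apply: measurable_funM; exact: measurable_near_word.
  by move=> w; exact: integral_near_word2.
rewrite -EFinM lee_fin /correlation natural_weight /energy -/(N n).
rewrite (_ : word_avg p (N n) _ = 4 / 2 ^+ n *
  word_avg p (N n) (fun v => word_avg p (N n) (fun w => close_pair al x (4 / 2 ^+ n) v w))); last first.
  by rewrite -word_avgZ; congr word_avg; apply/funext => v; rewrite word_avgZ.
rewrite mulrA -/e (_ : (2 * e)^-1 ^+ 2 * (4 * e) = 2 ^+ n)// /e.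
by field.
Qed.

(** Correlations that do not diverge are bounded along a subsequence. *)
Lemma natural_measure_L2 : ~ correlation_diverges al x -> ac_with_L2_density nu.
Proof.
move=> nd; have [k hk] : exists k : nat, forall n0 : nat, exists n, (n0 <= n)%nat /\ correlation n al x <= k%:R.
  apply: contrapT => h; apply: nd => k; apply: contrapT => h'; apply: h; exists k => n0.
  apply: contrapT => h; apply: h'; exists n0 => n nn; rewrite ltNge; apply/negP => hc.
  by apply: h; exists n.
have [N' hN] := choice hk.
apply: (@ac_with_L2_density_of_averages R nu (fun j => (2 ^+ (N' j))^-1) k%:R).
- by move=> j; rewrite invr_gt0 exprn_gt0.
- apply/cvgrPdist_lt => e e0.
  have /cvgrPdist_lt /(_ e e0) [n0 _ hn0] : (2^-1 : R) ^+ n @[n --> \oo] --> 0.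
    by apply: cvg_expr; rewrite ger0_norm ?invr_ge0// invf_lt1// ltr1n.
  exists n0 => // j /= nj; rewrite -exprVn; apply: hn0 => /=.
  by apply: leq_trans nj _; exact: (hN j).1.
- by move=> j; apply: le_trans (integral_ball_avg_sq _) _; rewrite lee_fin; exact: (hN j).2.
Qed.
End Natural.


Theorem corollary10p5 (R : realType) :
  {ae (@lebesgue_measure R \x @lebesgue_measure R)%E,
    forall l : measurableTypeR R * measurableTypeR R,
      0 < l.1 < 1 -> 0 < l.2 < 1 ->
      1 < l.1 + l.2 -> Num.max l.1 l.2 <= 668%:R / 1000%:R ->
      forall nu : probability (measurableTypeR R) R,
        is_natural_measure (ratios2 l.1 l.2) (@shifts2 R) nu ->
        ac_with_L2_density nu}.
Proof.
exists (@bad_ratios R); split; [exact: measurable_bad_ratios|exact: bad_ratios_null|].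
move=> l; apply: contra_notP => nbad x01 y01 sum1 max1 nu [s [P [dim bern nuE]]].
pose al := - ln l.2 * expR (- ln (- ln l.1)).
have alE : al = ln l.2 / ln l.1 by exact: exponentE.
have /andP[x0 x1] := x01; have /andP[y0 y1] := y01.
have lx : ln l.1 < 0 by rewrite ln_lt0// x0.
have ly : ln l.2 < 0 by rewrite ln_lt0// y0.
have al0 : 0 < al by rewrite alE nmulr_rgt0// invr_lt0.
have yE : yratio al l.1 = l.2 by rewrite /yratio alE divfK ?lt_eqF// lnK.
have reg : region al l.1.
  by move: max1; rewrite ge_max => /andP[mx my]; rewrite /region yE x0 mx my.
apply: (@natural_measure_L2 R al l.1 s P nu) => //; rewrite ?yE//.
move=> dv; apply: nbad; split => //; split => //=.
have w01 := @weight_in01 R al l.1 s reg; rewrite yE in w01.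
split; rewrite (@natural_weight R al l.1 s) ?yE//; first by have /andP[] := w01 dim.
by apply: natural_weight_eq => //; rewrite yE.
Qed.
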